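(* Let $\mu,\nu$ be complex numbers such that $\mu$, $\nu$ and $\mu+\nu$ are not integers. Consider the following data. The positive boxes are: (first family) the boxes $(i,k,1)$ of color $i+1$ mod $2$; (second family) the boxes $(i+1,k+\mu,0)$ of color $i+1$ mod $2$; (third family) the boxes $(0,\mu+\nu+k,0)$ of color $0$; here $i,k\in\mathbb{Z}_{\ge0}$. The negative boxes, also belonging to the third family, are the boxes $(0,\mu+\nu-k,0)$ of color $0$, $k\in\mathbb{Z}_{>0}$. Within each family boxes are ordered lexicographically, comparing first $y$, then $z$, then $x$; boxes of the third family are larger than boxes of the second family, which are larger than boxes of the first family. The set of states $S(G_0^{\mu,\nu})$ is the set of pairs of partitions positioned vertically together with an integer, that is, of triples $(D_1,D_2,k)$, where $D_1,D_2\subset\mathbb{Z}_{\ge0}^2$ are Young diagrams (finite subsets such that $(i,l)\in D$, $0\le i'\le i$, $0\le l'\le l$ imply $(i',l')\in D$) and $k\in\mathbb{Z}$. The state $(D_1,D_2,k)$ has $\lambda^+$ consisting of the boxes $(i,l,1)$ with $(i,l)\in D_1$, the boxes $(i+1,l+\mu,0)$ with $(i,l)\in D_2$ and, if $k>0$, the boxes $(0,\mu+\nu+j,0)$, $j=0,\dots,k-1$; and $\lambda^-$ is empty if $k\ge0$ and consists of the boxes $(0,\mu+\nu-j,0)$, $j=1,\dots,|k|$, if $k<0$. The reference state is $(\emptyset,\emptyset,0)$. Let $$\Psi(G_0^{\mu,\nu})=\Big(q_3q^{-\mu-2\nu}\frac{(z-q_3^{-2})(z-q_2^{-\mu+1})}{(z-q_2^{-\mu-\nu})(z-q_2^{-\mu-\nu+1})},\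 q^{\mu+2\nu}\frac{(z-q_3^{-1}q_2^{-\mu-\nu})(z-q_1^{-1}q_2^{-\mu-\nu})}{(z-q_3^{-1})(z-q_1^{-1}q_2^{-\mu})}\Big).$$ Then the space $G_0^{\mu,\nu}=\bigoplus_{\lambda\in S(G_0^{\mu,\nu})}\mathbb{C}|\lambda\rangle$ with the combinatorial action associated with $(S(G_0^{\mu,\nu}),\Psi(G_0^{\mu,\nu}))$ is an irreducible tame $\mathcal{E}$-module of level $q_3$.
   Context: **Parameters.** Fix $\log q,\log d\in\mathbb{C}$, $q=e^{\log q}$, $d=e^{\log d}$, $q_1=q^{-1}d$, $q_2=q^2$, $q_3=q^{-1}d^{-1}$, so $q_1q_2q_3=1$. Complex powers: $q^\alpha=e^{\alpha\log q}$, $q_2^\alpha=e^{2\alpha\log q}$. Assume $q,d$ generic: for rational $a,b$, $q^ad^b=1$ iff $a=b=0$. Write $[A,B]_p=AB-pBA$, $[A,B]=[A,B]_1$, $\delta(z)=\sum_{k\in\mathbb{Z}}z^k$, and $\mathrm{Sym}_{z_1,z_2,z_3}f=\frac1{6}\sum_{\pi\in\mathfrak{S}_3}f(z_{\pi(1)},z_{\pi(2)},z_{\pi(3)})$. For $i,j\in\mathbb{Z}/2\mathbb{Z}$ let $g_{i,j}(z,w)=z-q_2w$ if $i=j$ and $g_{i,j}(z,w)=(z-q_1w)(z-q_3w)$ if $i\ne j$. **Order.** Within one family all coordinates of two boxes differ by integers; $y(\Box_1)>y(\Box_2)$ means that $y(\Box_1)-y(\Box_2)$ is a positive integer, and similarly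 for $x,z$. **Algebra $\mathcal{E}$** (quantum toroidal $\mathfrak{gl}_2$, parallel realization). It is the unital associative $\mathbb{C}$-algebra generated by $E_{i,k},F_{i,k},H_{i,r},K_i^{\pm1}$ ($i\in\mathbb{Z}/2\mathbb{Z}$, $k\in\mathbb{Z}$, $r\in\mathbb{Z}\setminus\{0\}$) and an invertible central element ${\sf t}$ subject to no further relations. With $E_i(z)=\sum_kE_{i,k}z^{-k}$, $F_i(z)=\sum_kF_{i,k}z^{-k}$, $K_i^\pm(z)=K_i^{\pm1}\exp(\pm(q-q^{-1})\sum_{r>0}H_{i,\pm r}z^{\mp r})$, the relations are: all $K_i^\pm(z),K_j^\pm(w),K_j^\mp(w)$ commute; $(-1)^{i+j}g_{i,j}(z,w)K_i^\pm(z)E_j(w)+g_{j,i}(w,z)E_j(w)K_i^\pm(z)=0$; $(-1)^{i+j}g_{j,i}(w,z)K_i^\pm(z)F_j(w)+g_{i,j}(z,w)F_j(w)K_i^\pm(z)=0$; $[E_i(z),F_j(w)]=\frac{\delta_{i,j}}{q-q^{-1}}\delta(z/w)(K_i^+(w)-K_i^-(z))$; $(-1)^{i+j}g_{i,j}(z,w)E_i(z)E_j(w)+g_{j,i}(w,z)E_j(w)E_i(z)=0$; $(-1)^{i+j}g_{j,i}(w,z)F_i(z)F_j(w)+g_{i,j}(z,w)F_j(w)F_i(z)=0$; $\mathrm{Sym}_{z_1,z_2,z_3}[E_i(z_1),[E_i(z_2),[E_i(z_3),E_{i+1}(w)]_{q^2}]]_{q^{-2}}=0$ and the same with $E$ replaced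 by $F$. **Modules.** A vector $v$ of an $\mathcal{E}$-module has $\ell$-weight $\phi(z)=(\phi^0(z),\phi^1(z))$ if $K_i^\pm(z)v=\phi^i(z)v$, $i=0,1$, where the rational function $\phi^i$ is expanded at $z=\infty$ for $K_i^+$ and at $z=0$ for $K_i^-$. A module is tame if it has a basis of $\ell$-weight vectors with distinct $\ell$-weights. It has level $\kappa$ if the central element $K_0K_1$ acts as the scalar $\kappa$. **Combinatorial action.** A box $\Box$ has color $c(\Box)\in\{0,1\}$ and coordinates $(x,y,z)\in\mathbb{C}^3$; its position is $p(\Box)=q_1^{-x}q_2^{-y}q_3^{-z}$. As a general convention of the construction, boxes with the same position and different colors are not allowed. The set of boxes is totally ordered and divided into positive and negative boxes. A state $\lambda=\lambda^+\sqcup\lambda^-$ consists of a finite set $\lambda^+$ of positive boxes and a finite set $\lambda^-$ of negative boxes; $\emptyset$ is the reference state. Given a set of states $S\ni\emptyset$ and a pair $\Psi(z)=(\Psi^0(z),\Psi^1(z))$ of rational functions that are balanced (regular at $0$ and $\infty$, with product of the values at $0$ and $\infty$ equal to $1$): for $\lambda\in S$, a box $\Box$ is convex if either $\Box\in\lambda^+$ and $(\lambda^+\setminus\Box)\sqcup\lambda^-\in S$, or $\Box\notin\lambda^-$ is negative and $\lambda^+\sqcup(\lambda^-\sqcup\Box)\in S$ (new state denoted $\lambda\setminus\Box$); it is concave if either $\Box\notin\lambda^+$ is positive and $(\lambda^+\sqcup\Box)\sqcup\lambda^-\in S$, or $\Box\in\lambda^-$ and $\lambda^+\sqcup(\lambda^-\setminus\Box)\in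 S$ (new state denoted $\lambda\sqcup\Box$). $CV_i(\lambda)$, $CC_i(\lambda)$ are the sets of convex, concave boxes of color $i$. Pairs of rational functions are multiplied componentwise. Let $A_{0,a}(z)=\Big(\frac{q_2z-a}{z-q_2a},\frac{(q_1z-a)(q_3z-a)}{(z-q_1a)(z-q_3a)}\Big)$, $A_{1,a}(z)=\Big(\frac{(q_1z-a)(q_3z-a)}{(z-q_1a)(z-q_3a)},\frac{q_2z-a}{z-q_2a}\Big)$, $\phi_\lambda(z)=\Psi(z)\prod_{\Box\in\lambda^+}A^{-1}_{c(\Box),p(\Box)}(z)\prod_{\Box\in\lambda^-}A_{c(\Box),p(\Box)}(z)$, and, for every box $\Box$ (positive or negative), $\phi_{\lambda,<\Box}(z)=\Psi(z)\prod_{\Box_1\in\lambda^+,\Box_1<\Box}A^{-1}_{c(\Box_1),p(\Box_1)}(z)\prod_{\Box_1\in\lambda^-,\Box_1<\Box}A_{c(\Box_1),p(\Box_1)}(z)$, $\phi_{\lambda,>\Box}(z)=\prod_{\Box_1\in\lambda^+,\Box_1>\Box}A^{-1}_{c(\Box_1),p(\Box_1)}(z)\prod_{\Box_1\in\lambda^-,\Box_1>\Box}A_{c(\Box_1),p(\Box_1)}(z)$. Upper index $i\in\{0,1\}$ denotes the component. For $\Box\in CC_i(\lambda)$: $a^i_{\lambda,\Box}=\phi^i_{\lambda,>\Box}(p(\Box))$ if $\Box$ is positive, $a^i_{\lambda,\Box}=\frac{-1}{q-q^{-1}}\mathrm{res}_{z=p(\Box)}\phi^i_{\lambda,>\Box}(z)\frac{dz}{z}$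 if $\Box$ is negative. For $\Box\in CV_i(\lambda)$: $b^i_{\lambda,\Box}=\frac{1}{q-q^{-1}}\mathrm{res}_{z=p(\Box)}\phi^i_{\lambda,<\Box}(z)\frac{dz}{z}$ if $\Box$ is positive, $b^i_{\lambda,\Box}=\phi^i_{\lambda,<\Box}(p(\Box))$ if $\Box$ is negative. The combinatorial action associated with $(S,\Psi)$ on $\bigoplus_{\lambda\in S}\mathbb{C}|\lambda\rangle$ is ${\sf t}=1$ and $K_i^\pm(z)|\lambda\rangle=\phi^i_\lambda(z)|\lambda\rangle$, $F_i(z)|\lambda\rangle=\sum_{\Box\in CC_i(\lambda)}a^i_{\lambda,\Box}\delta(z/p(\Box))|\lambda\sqcup\Box\rangle$, $E_i(z)|\lambda\rangle=\sum_{\Box\in CV_i(\lambda)}b^i_{\lambda,\Box}\delta(z/p(\Box))|\lambda\setminus\Box\rangle$.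
   Formalization: Besides μ, ν, μ+ν not being integers, it is assumed that q_2^μ, q_2^ν, q_2^{μ+ν} are not in the group generated by q_1, q_2, q_3; and for the negative box (0,μ+ν−1,0), where Ψ^0 has a pole, the factor Ψ is put in φ_{λ,>□} instead of φ_{λ,<□}. *)

(* Defs.v *)
From HB Require Import structures.
From mathcomp Require Import all_boot all_order all_algebra all_fingroup.
From mathcomp Require Import finmap fraction complex.
From mathcomp Require Import mathcomp_extra boolp classical_sets functions.
From mathcomp Require Import fsbigop reals sequences exp trigo.
From mathcomp Require Import monalg.

Set Implicit Arguments.
Unset Strict Implicit.
Unset Printing Implicit Defensive.

Import Order.TTheory GRing.Theory Num.Theory.

Local Open Scope classical_set_scope.
Local Open Scope ring_scope.

Definition cexp (R : realType) (z : R[i]) : R[i] :=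
  let: (x +i* y)%C := z in ((expR x * cos y) +i* (expR x * sin y))%C.

Section RationalFunctions.
Variable K : fieldType.

Definition ratfun := {fraction {poly K}}.
Definition rpoly (p : {poly K}) : ratfun := tofrac p.
Definition rconst (c : K) : ratfun := rpoly c%:P.
Definition rlin (a : K) : ratfun := rpoly ('X - a%:P).

Definition is_value (f : ratfun) (a v : K) : Prop :=
  exists p s : {poly K},
    [/\ s.[a] != 0, f = rpoly p / rpoly s & v = p.[a] / s.[a]].

Definition is_value_at_infinity (f : ratfun) (v : K) : Prop :=
  exists p s : {poly K},
    [/\ s != 0, f = rpoly p / rpoly s, (size p <= size s)%N
      & v = p`_(size s).-1 / lead_coef s].

Definition regular_at (f : ratfun) (a : K) : Prop := exists v, is_value f a v.

(* [value] and [residue] are total; [value] is 0 at a pole *)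
Definition value (f : ratfun) (a : K) : K := xget 0 [set v | is_value f a v].

(* r is the coefficient of (z - a)^-1 in the principal part of f at a *)
Definition is_residue (f : ratfun) (a r : K) : Prop :=
  exists (m : nat) (c : nat -> K) (h : ratfun),
    [/\ regular_at h a,
        f = h + \sum_(j < m.+1) rconst (c j) / rlin a ^+ j.+1
      & r = c 0%N].

Definition residue (f : ratfun) (a : K) : K :=
  xget 0 [set r | is_residue f a r].

(* res_{z=a} f(z) dz/z *)
Definition res_dlog (f : ratfun) (a : K) : K := residue (f / rpoly 'X) a.

(* A formal series sum_k c_k z^{-k} is encoded by c : int -> K.  For f = p / s,
   it represents f when s(z) c(z) = p(z); the coefficient of z^e is compared. *)
Definition series_of (f : ratfun) (c : int -> K) : Prop :=
  exists p s : {poly K},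
    [/\ s != 0, f = rpoly p / rpoly s
      & forall e : int,
          \sum_(j < size s) s`_j * c (j%:Z - e)
          = (if e is Posz n then p`_n else 0)].

Definition expansion_at_infinity (f : ratfun) (c : int -> K) : Prop :=
  series_of f c /\ forall k : int, k < 0 -> c k = 0.

Definition expansion_at_zero (f : ratfun) (c : int -> K) : Prop :=
  series_of f c /\ forall k : int, 0 < k -> c k = 0.

Definition balanced (Psi : 'Z_2 -> ratfun) : Prop :=
  forall i, exists u v : K,
    [/\ is_value (Psi i) 0 u, is_value_at_infinity (Psi i) v & u * v = 1].

End RationalFunctions.

Section QParams.
Variables (R : realType) (lq ld : R[i]).

Definition q : R[i] := cexp lq.
Definition d : R[i] := cexp ld.
Definition q1 : R[i] := q^-1 * d.
Definition q2 : R[i] := q ^+ 2.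
Definition q3 : R[i] := q^-1 * d^-1.

Definition qpow (a : R[i]) : R[i] := cexp (a * lq).
Definition q1pow (a : R[i]) : R[i] := cexp (a * (ld - lq)).
Definition q2pow (a : R[i]) : R[i] := cexp (a * (2 * lq)).
Definition q3pow (a : R[i]) : R[i] := cexp (a * - (lq + ld)).

Definition generic_parameters : Prop :=
  forall a b : rat,
    cexp (ratr a * lq + ratr b * ld) = 1 <-> a = 0 /\ b = 0.

Definition not_integer (a : R[i]) : Prop := forall n : int, a <> n%:~R.

(* Only integer exponents a put q_2^a in the group generated by q_1, q_2, q_3.
   For a non-integer a this excludes accidents such as a = pi i / log q, for
   which q_2^a = 1 although a is not an integer. *)
Definition nonresonant (a : R[i]) : Prop :=
  forall m n l : int, q2pow a = q1 ^ m * q2 ^ n * q3 ^ l ->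
  exists k : int, a = k%:~R.

End QParams.

Section Toroidal.
Variables (R : realType) (lq ld : R[i]).
Local Notation C := R[i].
Local Notation q := (q lq).
Local Notation q1 := (q1 lq ld).
Local Notation q2 := (q2 lq).
Local Notation q3 := (q3 lq ld).

(* Action of the generators on V.  H_{i,r} is a generator only for r != 0;
   the component [genH i 0] is never used. *)
Record toroidal_ops (V : lmodType C) := ToroidalOps {
  genE : 'Z_2 -> int -> {linear V -> V};
  genF : 'Z_2 -> int -> {linear V -> V};
  genH : 'Z_2 -> int -> {linear V -> V};
  genK : 'Z_2 -> {linear V -> V};
  genKinv : 'Z_2 -> {linear V -> V};
  gent : {linear V -> V};
  gentinv : {linear V -> V}
}.

Section Relations.
Variables (V : lmodType C) (M : toroidal_ops V).
Local Notation E := (genE M).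
Local Notation F := (genF M).
Local Notation H := (genH M).

(* coefficient of u^n in (sum_{r > 0} h_r u^r)^m *)
Fixpoint pow_coef (h : nat -> V -> V) (m n : nat) (v : V) : V :=
  if m is m'.+1 then
    \sum_(r < n) h r.+1 (pow_coef h m' (n - r.+1) v)
  else if n == 0%N then v else 0.

(* coefficient of u^n in exp (sum_{r > 0} h_r u^r); the m-th power only
   contributes for m <= n *)
Definition exp_coef (h : nat -> V -> V) (n : nat) (v : V) : V :=
  \sum_(m < n.+1) (m`!%:R : C)^-1 *: pow_coef h m n v.

(* [Kplus i k] and [Kminus i k] are the coefficients of z^{-k} in K_i^+(z) and
   in K_i^-(z), and [Kser true], [Kser false] are K^+ and K^- *)
Definition Kplus (i : 'Z_2) (k : int) (v : V) : V :=
  if k is Posz n then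
    genK M i (exp_coef (fun r u => (q - q^-1) *: H i r%:Z u) n v)
  else 0.

Definition Kminus (i : 'Z_2) (k : int) (v : V) : V :=
  if - k is Posz n then
    genKinv M i (exp_coef (fun r u => - (q - q^-1) *: H i (- r%:Z) u) n v)
  else 0.

Definition Kser (s : bool) : 'Z_2 -> int -> V -> V :=
  if s then Kplus else Kminus.

(* A formal distribution sum_{k,l} f_{k,l} z^{-k} w^{-l} is encoded by f *)
Definition dist := int -> int -> V.
Definition mulz (f : dist) : dist := fun k l => f (k + 1) l.
Definition mulw (f : dist) : dist := fun k l => f k (l + 1).

(* multiplication by X - a Y, where X and Y are among [mulz], [mulw] *)
Definition mul_lin (a : C) (X Y : dist -> dist) (f : dist) : dist :=
  fun k l => X f k l - a *: Y f k l.

(* multiplication by g_{i,j}(X, Y) *)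
Definition mul_g (i j : 'Z_2) (X Y : dist -> dist) (f : dist) : dist :=
  if i == j then mul_lin q2 X Y f else mul_lin q1 X Y (mul_lin q3 X Y f).

(* (-1)^{i+j} g_{i,j}(z,w) A(z) B(w) + g_{j,i}(w,z) B(w) A(z) = 0 *)
Definition exchange (i j : 'Z_2) (A B : int -> V -> V) : Prop :=
  forall (k l : int) (v : V),
    (-1) ^+ (i + j)%N
      *: mul_g i j mulz mulw (fun k' l' => A k' (B l' v)) k l
    + mul_g j i mulw mulz (fun k' l' => B l' (A k' v)) k l = 0.

(* (-1)^{i+j} g_{j,i}(w,z) A(z) B(w) + g_{i,j}(z,w) B(w) A(z) = 0 *)
Definition exchange_op (i j : 'Z_2) (A B : int -> V -> V) : Prop :=
  forall (k l : int) (v : V),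
    (-1) ^+ (i + j)%N
      *: mul_g j i mulw mulz (fun k' l' => A k' (B l' v)) k l
    + mul_g i j mulz mulw (fun k' l' => B l' (A k' v)) k l = 0.

Definition commuting (A B : V -> V) : Prop := forall v, A (B v) = B (A v).

(* [A, B]_p = A B - p B A *)
Definition qbracket (p : C) (A B : V -> V) : V -> V :=
  fun v => A (B v) - p *: B (A v).

Definition serre (X : 'Z_2 -> int -> {linear V -> V}) : Prop :=
  forall (i : 'Z_2) (k : 'I_3 -> int) (l : int) (v : V),
    (6%:R : C)^-1 *: \sum_(s : 'S_3)
      qbracket (q ^- 2) (X i (k (s ord0)))
        (qbracket 1 (X i (k (s (inord 1))))
          (qbracket (q ^+ 2) (X i (k (s (inord 2)))) (X (i + 1) l))) v = 0.

Record toroidal_module : Prop := ToroidalModule {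
  rel_KKinv : forall i v, genK M i (genKinv M i v) = v;
  rel_KinvK : forall i v, genKinv M i (genK M i v) = v;
  rel_ttinv : forall v, gent M (gentinv M v) = v;
  rel_tinvt : forall v, gentinv M (gent M v) = v;
  rel_tE : forall i k, commuting (gent M) (E i k);
  rel_tF : forall i k, commuting (gent M) (F i k);
  rel_tH : forall i r, r != 0 -> commuting (gent M) (H i r);
  rel_tK : forall i, commuting (gent M) (genK M i);
  rel_KK : forall s s' i j k l, commuting (Kser s i k) (Kser s' j l);
  rel_KE : forall s i j, exchange i j (Kser s i) (fun l => E j l);
  rel_KF : forall s i j, exchange_op i j (Kser s i) (fun l => F j l);
  (* coefficient of z^{-k} w^{-l} of
     [E_i(z), F_j(w)]
       = delta_{i,j} / (q - q^-1) delta(z/w) (K_i^+(w) - K_i^-(z)) *)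
  rel_EF : forall i j k l v,
    E i k (F j l v) - F j l (E i k v)
    = if i == j then
        (q - q^-1)^-1 *: (Kplus i (k + l) v - Kminus i (k + l) v)
      else 0;
  rel_EE : forall i j, exchange i j (fun k => E i k) (fun l => E j l);
  rel_FF : forall i j, exchange_op i j (fun k => F i k) (fun l => F j l);
  rel_serreE : serre E;
  rel_serreF : serre F
}.

Definition has_lweight (v : V) (phi : 'Z_2 -> ratfun C) : Prop :=
  forall i,
    (exists2 c, expansion_at_infinity (phi i) c
              & forall k, Kplus i k v = c k *: v)
    /\ (exists2 c, expansion_at_zero (phi i) c
                 & forall k, Kminus i k v = c k *: v).

Definition linear_independent (B : set V) : Prop :=
  forall (s : seq V) (c : V -> C), uniq s -> (forall v, v \in s -> B v) ->
  \sum_(v <- s) c v *: v = 0 -> forall v, v \in s -> c v = 0.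

Definition spanning (B : set V) : Prop :=
  forall u : V, exists (s : seq V) (c : V -> C),
    (forall v, v \in s -> B v) /\ u = \sum_(v <- s) c v *: v.

Definition tame : Prop :=
  exists B : set V,
    [/\ linear_independent B, spanning B,
        (forall v, B v -> exists phi, has_lweight v phi)
      & forall v w phi, B v -> B w ->
          has_lweight v phi -> has_lweight w phi -> v = w].

Definition has_level (kappa : C) : Prop :=
  forall v, genK M 0 (genK M 1 v) = kappa *: v.

Definition submodule (W : set V) : Prop :=
  [/\ W 0, (forall (a : C) u v, W u -> W v -> W (a *: u + v)),
      (forall i k v, W v -> W (E i k v) /\ W (F i k v)),
      (forall i r v, r != 0 -> W v -> W (H i r v))
    & forall v, W v ->
        (forall i, W (genK M i v) /\ W (genKinv M i v))
        /\ W (gent M v) /\ W (gentinv M v)].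

Definition irreducible : Prop :=
  (exists v : V, v != 0)
  /\ forall W, submodule W -> W = [set 0] \/ W = setT.

End Relations.
End Toroidal.

Record box_system (R : realType) := BoxSystem {
  box :> choiceType;
  color : box -> 'Z_2;
  coordx : box -> R[i];
  coordy : box -> R[i];
  coordz : box -> R[i];
  positive : box -> bool;
  box_lt : rel box
}.

(* (lambda^+, lambda^-) *)
Definition state (R : realType) (B : box_system R) : choiceType :=
  ({fset B} * {fset B})%type.

Section Combinatorial.
Variables (R : realType) (lq ld : R[i]) (B : box_system R).
Variables (S : set (state B)) (Psi : 'Z_2 -> ratfun R[i]).
Local Notation C := R[i].
Local Notation q := (q lq).
Local Notation q1 := (q1 lq ld).
Local Notation q2 := (q2 lq).
Local Notation q3 := (q3 lq ld).

Definition position (b : B) : C :=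
  q1pow lq ld (- coordx b) * q2pow lq (- coordy b) * q3pow lq ld (- coordz b).

Definition empty_state : state B := (fset0, fset0).

Definition combinatorial_data : Prop :=
  [/\ irreflexive (@box_lt R B), transitive (@box_lt R B)
    & forall b b' : B, b != b' -> box_lt b b' || box_lt b' b]
  /\ [/\ forall b b' : B, position b = position b' -> color b = color b',
         (forall l, S l -> (forall b, b \in l.1 -> positive b)
                           /\ (forall b, b \in l.2 -> ~~ positive b)),
         S empty_state & balanced Psi].

Definition remove_box (l : state B) (b : B) : state B :=
  if positive b then ((l.1 `\ b)%fset, l.2) else (l.1, (b |` l.2)%fset).

Definition add_box (l : state B) (b : B) : state B :=
  if positive b then ((b |` l.1)%fset, l.2) else (l.1, (l.2 `\ b)%fset).

Definition convex (l : state B) (b : B) : Prop :=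
  (if positive b then b \in l.1 else b \notin l.2) /\ S (remove_box l b).

Definition concave (l : state B) (b : B) : Prop :=
  (if positive b then b \notin l.1 else b \in l.2) /\ S (add_box l b).

Definition CV (i : 'Z_2) (l : state B) : set B :=
  [set b | convex l b /\ color b = i].
Definition CC (i : 'Z_2) (l : state B) : set B :=
  [set b | concave l b /\ color b = i].

(* the i-th component of A_{c,a}(z) *)
Definition Afun (c : 'Z_2) (a : C) (i : 'Z_2) : ratfun C :=
  if i == c then
    rpoly (q2 *: 'X - a%:P) / rlin (q2 * a)
  else
    (rpoly (q1 *: 'X - a%:P) * rpoly (q3 *: 'X - a%:P))
    / (rlin (q1 * a) * rlin (q3 * a)).

(* contribution to the l-weight of the boxes of l satisfying P *)
Definition Aprod (P : pred B) (l : state B) (i : 'Z_2) : ratfun C :=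
  \prod_(b <- l.1 | P b) (Afun (color b) (position b) i)^-1
  * \prod_(b <- l.2 | P b) Afun (color b) (position b) i.

Definition phi (l : state B) (i : 'Z_2) : ratfun C := Psi i * Aprod predT l i.

(* Psi is a factor of phi_{l,<b}.  This is impossible for a negative box b at
   whose position Psi^{c(b)} has a pole: phi_{l,<b}(p(b)) would be undefined
   and the residue of phi_{l,>b} would miss that pole.  For such a box only,
   Psi is a factor of phi_{l,>b} instead; [psi_below] is then false. *)
Definition psi_below (b : B) : bool :=
  positive b || `[< regular_at (Psi (color b)) (position b) >].

Definition phi_lt (l : state B) (b : B) (i : 'Z_2) : ratfun C :=
  (if psi_below b then Psi i else 1) * Aprod (fun b1 => box_lt b1 b) l i.

Definition phi_gt (l : state B) (b : B) (i : 'Z_2) : ratfun C :=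
  (if psi_below b then 1 else Psi i) * Aprod (fun b1 => box_lt b b1) l i.

Definition acoef (i : 'Z_2) (l : state B) (b : B) : C :=
  if positive b then value (phi_gt l b i) (position b)
  else - (q - q^-1)^-1 * res_dlog (phi_gt l b i) (position b).

Definition bcoef (i : 'Z_2) (l : state B) (b : B) : C :=
  if positive b then (q - q^-1)^-1 * res_dlog (phi_lt l b i) (position b)
  else value (phi_lt l b i) (position b).

(* all values (as opposed to residues) in [acoef] and [bcoef] are values at
   regular points *)
Definition coefs_defined : Prop :=
  forall (i : 'Z_2) (l : state B) (b : B), S l ->
    (CC i l b -> positive b -> regular_at (phi_gt l b i) (position b))
    /\ (CV i l b -> ~~ positive b -> regular_at (phi_lt l b i) (position b)).

(* the direct sum of the lines C |l>, for l in S *)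
Definition state_space : lmodType C := {malg C[set_type S]}.

(* |l> if l is in S, and 0 otherwise *)
Definition ket (l : state B) : state_space :=
  if insub l is Some s then << 1 *g (s : set_type S) >> else 0.

(* the coefficient of z^{-k} in delta(z/p) is p^k *)
Definition combinatorial_action (M : toroidal_ops state_space) : Prop :=
  [/\ combinatorial_data, coefs_defined
    & [/\ (forall v, gent M v = v),
          (forall l, S l -> has_lweight lq M (ket l) (phi l)),
          (forall l, S l -> forall i (k : int),
             genF M i k (ket l)
             = \sum_(b \in CC i l)
                 (acoef i l b * position b ^ k) *: ket (add_box l b))
        & forall l, S l -> forall i (k : int),
             genE M i k (ket l)
             = \sum_(b \in CV i l)
                 (bcoef i l b * position b ^ k) *: ket (remove_box l b)]].

End Combinatorial.

(* [Box1 i k] is (i, k, 1), [Box2 i k] is (i+1, k+mu, 0) and [Box3 n] is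
   (0, mu+nu+n, 0), which is positive for n >= 0 and negative for n < 0 *)
Inductive Gbox := Box1 of nat & nat | Box2 of nat & nat | Box3 of int.

Definition Gbox_encode (b : Gbox) : (nat * nat + nat * nat) + int :=
  match b with
  | Box1 i k => inl (inl (i, k))
  | Box2 i k => inl (inr (i, k))
  | Box3 n => inr n
  end.

Definition Gbox_decode (u : (nat * nat + nat * nat) + int) : Gbox :=
  match u with
  | inl (inl (i, k)) => Box1 i k
  | inl (inr (i, k)) => Box2 i k
  | inr n => Box3 n
  end.

Lemma Gbox_encodeK : cancel Gbox_encode Gbox_decode.
Proof. by case. Qed.

HB.instance Definition _ := Countable.copy Gbox (can_type Gbox_encodeK).

Section GModule.
Variables (R : realType) (lq ld mu nu : R[i]).
Local Notation C := R[i].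

Definition Gfamily (b : Gbox) : nat :=
  match b with Box1 _ _ => 1 | Box2 _ _ => 2 | Box3 _ => 3 end.

Definition Gcolor (b : Gbox) : 'Z_2 :=
  match b with
  | Box1 i _ | Box2 i _ => i.+1%:R
  | Box3 _ => 0
  end.

Definition Gx (b : Gbox) : C :=
  match b with Box1 i _ => i%:R | Box2 i _ => i.+1%:R | Box3 _ => 0 end.

Definition Gy (b : Gbox) : C :=
  match b with
  | Box1 _ k => k%:R
  | Box2 _ k => k%:R + mu
  | Box3 n => mu + nu + n%:~R
  end.

Definition Gz (b : Gbox) : C := if b is Box1 _ _ then 1 else 0.

Definition Gpositive (b : Gbox) : bool := if b is Box3 n then 0 <= n else true.

(* u - v is a positive integer *)
Definition int_gt (u v : C) : bool := `[< exists n : nat, u - v = n.+1%:R >].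

Definition Glt (b b' : Gbox) : bool :=
  (Gfamily b < Gfamily b')%N
  || (Gfamily b == Gfamily b')
     && (int_gt (Gy b') (Gy b)
         || (Gy b' == Gy b)
            && (int_gt (Gz b') (Gz b)
                || (Gz b' == Gz b) && int_gt (Gx b') (Gx b))).

Definition Gsystem : box_system R :=
  @BoxSystem R Gbox Gcolor Gx Gy Gz Gpositive Glt.

Definition young_diagram (D : {fset nat * nat}) : Prop :=
  forall i l i' l' : nat,
    (i, l) \in D -> (i' <= i)%N -> (l' <= l)%N -> (i', l') \in D.

Definition Gstate (D1 D2 : {fset nat * nat}) (k : int) : state Gsystem :=
  (([fset Box1 u.1 u.2 | u in D1] `|` [fset Box2 u.1 u.2 | u in D2]
    `|` (if k is Posz n then [fset Box3 j%:Z | j in iota 0 n] else fset0))%fset,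
   (if k is Negz n then [fset Box3 (- j%:Z) | j in iota 1 n.+1]
    else fset0)%fset).

Definition Gstates : set (state Gsystem) :=
  [set l | exists D1 D2 k,
     [/\ young_diagram D1, young_diagram D2 & l = Gstate D1 D2 k]].

Local Notation q1 := (q1 lq ld).
Local Notation q3 := (q3 lq ld).
Local Notation q2pow := (q2pow lq).
Local Notation qpow := (qpow lq).

Definition GPsi (i : 'Z_2) : ratfun C :=
  if i == 0 then
    rconst (q3 * qpow (- mu - 2 * nu))
    * ((rlin (q3 ^- 2) * rlin (q2pow (- mu + 1)))
       / (rlin (q2pow (- mu - nu)) * rlin (q2pow (- mu - nu + 1))))
  else
    rconst (qpow (mu + 2 * nu))
    * ((rlin (q3^-1 * q2pow (- mu - nu)) * rlin (q1^-1 * q2pow (- mu - nu)))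
       / (rlin q3^-1 * rlin (q1^-1 * q2pow (- mu)))).

Definition Gspace : lmodType C := state_space Gstates.

End GModule.

(* Main.v *)
From HB Require Import structures.
From mathcomp Require Import all_boot all_order all_algebra all_fingroup.
From mathcomp Require Import finmap fraction complex.
From mathcomp Require Import mathcomp_extra boolp classical_sets functions.
From mathcomp Require Import fsbigop reals sequences exp trigo.
From mathcomp Require Import monalg zify ring.
Require Import Defs.

Set Implicit Arguments.
Unset Strict Implicit.
Unset Printing Implicit Defensive.

Import Order.TTheory GRing.Theory Num.Theory.

Local Open Scope classical_set_scope.
Local Open Scope ring_scope.

(** The action is controlled by the zeros and poles of the l-weights.

    Positions.  Multiplication by [q2] and [q1] moves the position of a box one
    step back in [y] and in [x], and multiplication by [q3] one step forward on
    the diagonal.  So the positions of each family sit in a lattice on which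
    the group generated by [q1] and [q2] acts freely, and non-resonance of
    [mu], [nu] and [mu + nu] makes the three lattices disjoint ([spos_inj]).
    Filling all negative boxes of the reference state turns the states into
    the order ideals of a partial order on the boxes ([inn], [cov],
    [GstatesP]); convex boxes are the maximal elements of the ideal and concave
    boxes the minimal elements of its complement ([okdP]).  Exchanging an ideal
    with its complement exchanges [E] and [F], which are treated together
    by means of a Boolean direction [d].

    Poles.  The divisor of [A^-1] at a box is a finite difference ([lap]) of
    the indicator of the box, and [Psi] is chosen so that the divisor of the
    l-weight of a state is the same difference of the indicator of the whole
    ideal ([ordl_phil]).  Since the ideal is closed downwards, the order is at
    least [-1] everywhere and equal to [-1] exactly at the corners of the state
    ([ordl_corner]).  Partial fractions then express the difference of the
    expansions of the l-weight at infinity and at zero as a sum over the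
    corners ([phi_expansion]), and the values and residues that define the
    action become leading coefficients, which are products over the boxes of
    factors [kap] ([bcoef_bl], [acoef_al]).

    Relations.  The factor [kap w v] is a ratio of the two values of the
    structure function [g] at the positions of [v] and [w] ([kap_gg]), and, for
    one of the two orders of its arguments, [g] vanishes exactly when one of the
    boxes covers the other or when they are neighbours on a diagonal
    ([gg_eq0]).  Hence exchanging two neighbouring letters of a word in the [E],
    or in the [F], multiplies its coefficient by the ratio required by the
    quadratic relations ([exchange_coef]).  The Serre relations become a polynomial identity in the
    positions of four boxes ([serre_identity], [serre_coef]), because a
    word that contains a diagonal pair also contains the two boxes between, and
    then two boxes of each color.  In the commutator of [E] and [F] the
    terms with two different boxes cancel ([em_remove_add]), and the others are
    the residues of the l-weight ([al_bl]), whose sum is the required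
    difference of the expansions of the l-weight.  The operators [H] are
    defined by the logarithms of the l-weights.

    Structure.  The divisor of the l-weight determines the ideal ([phi_inj]),
    so the l-weights are distinct and the module is tame.  A submodule
    therefore contains every state that occurs in one of its vectors
    ([submodule_component]); moving along corners, along which all
    coefficients are nonzero, leads from any state to the reference state and
    back, so the module is irreducible.  The level is the product of the values
    of the two components of [Psi] at infinity, because the two components of
    each [A] have inverse values there ([phic_level]). *)

(** * Leading coefficients of rational functions *)
Section FieldIdentities.
Variable F : fieldType.

Lemma divf_cross (a b c d x : F) : b != 0 -> d != 0 -> x != 0 ->
  x^-1 * (a / b) = c / d -> a * d = c * b * x.
Proof.
move=> b0 d0 x0 e; rewrite -[c](divfK d0) -e; field.
by rewrite b0 x0.
Qed.

Lemma divf_cross2 (a b c d u v x : F) : b != 0 -> d != 0 -> x != 0 ->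
  a / b + u / x = c / d + v / x -> (a * d - c * b) * x = (v - u) * (b * d).
Proof.
move=> b0 d0 x0 e.
have -> : v = (a / b + u / x - c / d) * x by rewrite e; field; rewrite x0 d0.
by field; rewrite b0 d0 x0.
Qed.

Lemma divf_mulK (a x y : F) : x != 0 -> a / y = a * (x / (x * y)).
Proof. by move=> x0; rewrite invfM mulVKf. Qed.

End FieldIdentities.

Section Leading.
Variable K : fieldType.
Implicit Types (f g : ratfun K) (p s : {poly K}) (a c : K) (m n : int).

Lemma rpoly_inj : injective (@rpoly K).
Proof. by move=> p s /eqP; rewrite tofrac_eq => /eqP. Qed.

Lemma rpolyM p s : rpoly (p * s) = rpoly p * rpoly s.
Proof. exact: tofracM. Qed.

Lemma rpolyD p s : rpoly (p + s) = rpoly p + rpoly s.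
Proof. exact: tofracD. Qed.

Lemma rpolyB p s : rpoly (p - s) = rpoly p - rpoly s.
Proof. exact: tofracB. Qed.

Lemma rpolyX p k : rpoly (p ^+ k) = rpoly p ^+ k.
Proof. exact: tofracXn. Qed.

Lemma rpoly1 : rpoly 1 = 1 :> ratfun K.
Proof. exact: tofrac1. Qed.

Lemma rpoly_eq0 p : (rpoly p == 0) = (p == 0).
Proof. exact: tofrac_eq0. Qed.

Lemma rpoly_neq0 p a : p.[a] != 0 -> rpoly p != 0.
Proof.
by move=> pa; rewrite rpoly_eq0; apply: contraNneq pa => ->; rewrite horner0.
Qed.

Lemma rlin_neq0 a : rlin a != 0.
Proof. by rewrite rpoly_eq0 polyXsubC_eq0. Qed.

Lemma rconstM a c : rconst (a * c) = rconst a * rconst c.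
Proof. by rewrite /rconst polyCM rpolyM. Qed.

Lemma rconst_neq0 c : c != 0 -> rconst c != 0.
Proof. by rewrite rpoly_eq0 polyC_eq0. Qed.

Lemma eq_divp p s p' s' : s != 0 -> s' != 0 ->
  rpoly p / rpoly s = rpoly p' / rpoly s' <-> p * s' = p' * s.
Proof.
move=> s0 s'0.
have h : rpoly p / rpoly s = rpoly p' / rpoly s' <->
   rpoly p * rpoly s' = rpoly p' * rpoly s.
  split=> [/eqP|/eqP]; rewrite ?eqr_div ?rpoly_eq0 // => /eqP //.
  by move=> e; apply/eqP; rewrite eqr_div ?rpoly_eq0 // e.
by rewrite h -!rpolyM; split=> [/rpoly_inj|->].
Qed.

(** Near [a] the function behaves like [c * (z - a) ^ n] with [c != 0]: the
    exponent and the leading coefficient, both multiplicative, contain every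
    value and every residue at a simple pole. *)
Definition has_lead f a n c := exists p s,
  [/\ p.[a] != 0, s.[a] != 0, f = rlin a ^ n * (rpoly p / rpoly s)
    & c = p.[a] / s.[a]].

Lemma has_lead_neq0 f a n c : has_lead f a n c -> c != 0.
Proof. by case=> p [s] [pa sa _ ->]; rewrite mulf_neq0 ?invr_eq0. Qed.

Lemma has_leadM f g a m n b c :
  has_lead f a m b -> has_lead g a n c -> has_lead (f * g) a (m + n) (b * c).
Proof.
case=> [p [s [pa sa -> ->]]] [p' [s' [pa' sa' -> ->]]].
exists (p * p'), (s * s'); rewrite !hornerM !mulf_neq0 //; split=> //.
  by rewrite expfzDr ?rlin_neq0 // !rpolyM invfM mulrACA; congr (_ * _); rewrite mulrACA.
by rewrite invfM mulrACA.
Qed.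

Lemma has_leadV f a n c : has_lead f a n c -> has_lead f^-1 a (- n) c^-1.
Proof.
case=> [p [s [pa sa -> ->]]]; exists s, p; split=> //.
  by rewrite invfM invf_div invr_expz.
by rewrite invfM invrK mulrC.
Qed.

Lemma has_lead_poly p a : p.[a] != 0 -> has_lead (rpoly p) a 0 p.[a].
Proof.
move=> pa; exists p, 1; rewrite hornerE oner_eq0 expr0z mul1r rpoly1 !divr1.
by split.
Qed.

Lemma has_lead_const c a : c != 0 -> has_lead (rconst c) a 0 c.
Proof. by move=> c0; have := @has_lead_poly c%:P a; rewrite hornerC; apply. Qed.

Lemma has_lead1 a : has_lead 1 a 0 1.
Proof. by have := @has_lead_const 1 a (oner_neq0 _); rewrite /rconst rpoly1. Qed.

Lemma has_lead_lin_ne b a : a != b -> has_lead (rlin b) a 0 (a - b).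
Proof.
move=> ab; have := @has_lead_poly ('X - b%:P) a.
by rewrite !hornerE subr_eq0; apply.
Qed.

Lemma has_lead_lin_eq a : has_lead (rlin a) a 1 1.
Proof. by exists 1, 1; rewrite hornerE oner_eq0 rpoly1 !divr1 mulr1. Qed.

Lemma has_leadX f a n c m : has_lead f a n c -> has_lead (f ^ m) a (n * m) (c ^ m).
Proof.
move=> fl; have hX k : has_lead (f ^+ k) a (n * k%:Z) (c ^+ k).
  elim: k => [|k IH]; first by rewrite mulr0; apply: has_lead1.
  by rewrite !exprS intS mulrDr mulr1; apply: has_leadM.
case: m => k; first exact: hX.
by rewrite !NegzE -!exprnN mulrN; apply/has_leadV/hX.
Qed.

Lemma is_value_uniq f a v w : is_value f a v -> is_value f a w -> v = w.
Proof.
case=> [p [s [sa -> ->]]] [p' [s' [sa' /eq_divp e ->]]].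
have /(congr1 (horner^~ a)) : p * s' = p' * s.
  by apply: e; rewrite -rpoly_eq0; apply: rpoly_neq0; eassumption.
by rewrite !hornerM => e'; apply/eqP; rewrite eqr_div // e'.
Qed.

Lemma value_eq f a v : is_value f a v -> value f a = v.
Proof. by move=> fv; apply: xget_unique => // w /(is_value_uniq fv). Qed.

Lemma is_value_lead f a c : has_lead f a 0 c -> is_value f a c.
Proof. by case=> p [s] [_ sa -> ->]; exists p, s; rewrite expr0z mul1r. Qed.

Lemma value_lead f a c : has_lead f a 0 c -> value f a = c.
Proof. by move=> /is_value_lead/value_eq. Qed.

Lemma regular_lead f a c : has_lead f a 0 c -> regular_at f a.
Proof. by move=> /is_value_lead fc; exists c. Qed.

Lemma pole_not_regular f a c : has_lead f a (- 1) c -> ~ regular_at f a.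
Proof.
case=> [p [s [pa sa -> _]]] [_ [p' [s' [sa' e _]]]].
have s0 : rpoly s != 0 by exact: rpoly_neq0 sa.
have s'0 : rpoly s' != 0 by exact: rpoly_neq0 sa'.
have : rpoly (p * s') = rpoly (p' * s * ('X - a%:P)).
  rewrite !rpolyM; apply: (divf_cross s0 s'0 (rlin_neq0 a)).
  by rewrite -exprN1.
move=> /rpoly_inj/(congr1 (horner^~ a)); rewrite !hornerM !hornerE subrr mulr0.
by move/eqP; rewrite mulf_eq0 (negPf pa) (negPf sa').
Qed.

(** Over a common power of [z - a] the difference of two principal parts is a
    polynomial of degree less than the exponent.  Since the denominators of the
    regular parts are coprime to [z - a], the power divides it, so it is zero. *)
Lemma is_residue_uniq f a r t : is_residue f a r -> is_residue f a t -> r = t.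
Proof.
case=> [m [c [h [[_ [p [s [sa -> _]]]] -> ->]]]].
case=> [m' [c' [h' [[_ [p' [s' [sa' -> _]]]] e ->]]]].
pose N := maxn m m'.
have s0 : rpoly s != 0 by exact: rpoly_neq0 sa.
have s'0 : rpoly s' != 0 by exact: rpoly_neq0 sa'.
pose ext k (c : nat -> K) j := if (j < k.+1)%N then c j else 0.
have extE k (d : nat -> K) : (k <= N)%N ->
    \sum_(j < k.+1) rconst (d j) / rlin a ^+ j.+1
    = rpoly (\sum_(j < N.+1) ext k d j *: ('X - a%:P) ^+ (N - j)) / rlin a ^+ N.+1.
  move=> kN; rewrite (big_ord_widen N.+1 (fun j => rconst (d j) / rlin a ^+ j.+1)) //.
  rewrite /rpoly rmorph_sum mulr_suml big_mkcond /=; apply: eq_bigr => j _.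
  rewrite /ext; case: ifP => _; last by rewrite scale0r rmorph0 mul0r.
  rewrite -mul_polyC tofracM tofracXn -/(rpoly _) -/(rlin a) -mulrA.
  have -> : rlin a ^+ N.+1 = rlin a ^+ (N - j) * rlin a ^+ j.+1.
    by rewrite -exprD; congr (_ ^+ _); have := ltn_ord j; lia.
  exact: (divf_mulK _ _ (expf_neq0 _ (rlin_neq0 a))).
move: e; rewrite (extE m) ?leq_maxl // (extE m') ?leq_maxr //.
set P := \sum_(j < _) _; set P' := \sum_(j < _) _ => e.
have ra : rlin a ^+ N.+1 != 0 := expf_neq0 _ (rlin_neq0 a).
have e1 : (p * s' - p' * s) * ('X - a%:P) ^+ N.+1 = (P' - P) * (s * s').
  apply: rpoly_inj; rewrite rpolyM rpolyX -/(rlin a) rpolyB rpolyM rpolyM rpolyM rpolyB rpolyM.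
  exact: (divf_cross2 s0 s'0 ra e).
(* regularity at [a] enters here: [s] and [s'] do not vanish at [a] *)
have cop : coprimep (('X - a%:P) ^+ N.+1) (s * s').
  apply: coprimep_expl; rewrite coprimepMr.
  by rewrite !(coprimep_sym _ s) !(coprimep_sym _ s') !coprimep_XsubC /root sa sa'.
have sz (k : nat) (d : nat -> K) :
    (size (\sum_(j < N.+1) ext k d j *: ('X - a%:P) ^+ (N - j))%R <= N.+1)%N.
  apply: (leq_trans (size_sum _ _ _)); apply/bigmax_leqP => j _.
  apply: (leq_trans (size_scale_leq _ _)).
  by rewrite size_exp_XsubC ltnS leq_subr.
have dv : (('X - a%:P) ^+ N.+1 %| P' - P)%R.
  by rewrite -(Gauss_dvdpl _ cop) -e1 dvdp_mull.
have PP : P' - P = 0.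
  apply/eqP; rewrite -size_poly_eq0 -leqn0; rewrite leqNgt; apply/negP => gt0.
  have := dvdp_leq _ dv; rewrite -size_poly_gt0 gt0 size_exp_XsubC => /(_ isT).
  rewrite leqNgt ltnS (leq_trans (size_polyD _ _)) //.
  by rewrite size_polyN geq_max !sz.
have ext0 k d : ext k d 0%N = d 0%N by [].
(* the residue is the coefficient of highest degree after clearing denominators *)
have coef0 (Q : nat -> K) : \sum_(j < N.+1) Q j *: ('X - a%:P) ^+ (N - j) = 0 :> {poly K} ->
    Q 0%N = 0.
  move=> /(congr1 (fun P : {poly K} => P`_N)); rewrite coef0 coef_sum.
  rewrite big_ord_recl /= coefZ subn0 big1 ?addr0.
    have := monicP (monic_exp N (monicXsubC a)).
    by rewrite /lead_coef size_exp_XsubC /= => ->; rewrite mulr1.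
  move=> j _; rewrite coefZ nth_default ?mulr0 // size_exp_XsubC /bump /=.
  by rewrite add1n; have := ltn_ord j; lia.
have := coef0 (fun j => ext m' c' j - ext m c j).
have -> : \sum_(j < N.+1) (ext m' c' j - ext m c j) *: ('X - a%:P) ^+ (N - j) = P' - P.
  by rewrite -sumrB; apply: eq_bigr => j _; rewrite scalerBl.
by move=> /(_ PP)/eqP; rewrite !ext0 subr_eq0 => /eqP.
Qed.

Lemma is_residue_lead f a c : has_lead f a (- 1) c -> is_residue f a c.
Proof.
case=> p [s] [pa sa -> ->]; set r : K := p.[a] / s.[a].
have /factor_theorem[u eu] : root (p - r *: s) a.
  by rewrite /root !hornerE /r divfK // subrr.
exists 0%N, (fun=> r), (rpoly u / rpoly s); split=> //.
  by exists (u.[a] / s.[a]), u, s.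
have -> : p = u * ('X - a%:P) + r%:P * s by rewrite -eu mul_polyC subrK.
rewrite rpolyD !rpolyM big_ord_recl big_ord0 addr0 /= expr1 exprN1.
rewrite mulrDl !mulrDr mulfK ?(rpoly_neq0 sa) // mulrC; congr (_ + _).
  by rewrite mulrAC mulfK ?rlin_neq0.
by rewrite mulrC.
Qed.

Lemma residue_lead f a c : has_lead f a (- 1) c -> residue f a = c.
Proof.
move=> /is_residue_lead rf; by apply: xget_unique => // t /(is_residue_uniq rf).
Qed.

(** The form [dz / z] of the residue divides the leading coefficient by [a]. *)
Lemma res_dlog_lead f a c : a != 0 -> has_lead f a (- 1) c ->
  res_dlog f a = c / a.
Proof.
move=> a0 fc; apply: residue_lead.
have : has_lead (rpoly 'X) a 0 a.
  by have := @has_lead_poly 'X a; rewrite hornerX; apply.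
by move/has_leadV/(has_leadM fc); rewrite oppr0 addr0.
Qed.

Lemma is_valueD f g a v w :
  is_value f a v -> is_value g a w -> is_value (f + g) a (v + w).
Proof.
case=> [p [s [sa -> ->]]] [p' [s' [sa' -> ->]]].
exists (p * s' + p' * s), (s * s'); rewrite !hornerE mulf_neq0 //; split=> //.
  by rewrite rpolyD !rpolyM (addf_div _ _ (rpoly_neq0 sa) (rpoly_neq0 sa')).
by rewrite addf_div.
Qed.

Lemma is_value_const c a : is_value (rconst c) a c.
Proof.
exists c%:P, 1; rewrite !hornerE oner_eq0 /rconst rpoly1.
by split=> //; rewrite divr1.
Qed.

Lemma is_value_simple r b a : a != b ->
  is_value (rconst r / rlin b) a (r / (a - b)).
Proof. by move=> ab; exists r%:P, ('X - b%:P); rewrite !hornerE subr_eq0. Qed.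

Lemma is_value_sum (I : Type) (P : seq I) (Q : pred I) (F : I -> ratfun K) (v : I -> K) a :
  (forall i, Q i -> is_value (F i) a (v i)) ->
  is_value (\sum_(i <- P | Q i) F i) a (\sum_(i <- P | Q i) v i).
Proof.
move=> h; elim: P => [|i P IH].
  by rewrite !big_nil -(rmorph0 (@tofrac _)) -(polyC0 K); apply: is_value_const.
by rewrite !big_cons; case: ifP => [/h /is_valueD|_]; [apply|].
Qed.

Lemma has_lead_lt_absurd f a c e m n :
  has_lead f a m c -> has_lead f a n e -> ~ (m < n).
Proof.
move=> [p [s [pa sa -> _]]] [p' [s' [pa' sa' + _]]] mn.
have -> : n = m + (`|n - m|%N)%:Z by lia.
case k : `|n - m|%N => [|k']; first by lia.
rewrite expfzDr ?rlin_neq0 // -mulrA => /(mulfI (expfz_neq0 _ (rlin_neq0 _))) h.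
have cross (F : fieldType) (u1 u2 r w1 w2 : F) : u2 != 0 -> w2 != 0 ->
    u1 / u2 = r * (w1 / w2) -> u1 * w2 = r * w1 * u2.
  by move=> u0 w0 h0; rewrite -[u1](divfK u0) h0; field.
have {}h := cross _ (rpoly p) (rpoly s) (rlin a ^+ k'.+1) (rpoly p') (rpoly s')
  (rpoly_neq0 sa) (rpoly_neq0 sa') h.
have /rpoly_inj hp : rpoly (p * s') = rpoly (('X - a%:P) ^+ k'.+1 * p' * s).
  by rewrite [LHS]rpolyM [RHS]rpolyM [rpoly (_ * p')]rpolyM [rpoly (_ ^+ _)]rpolyX.
have := congr1 (fun r : {poly K} => r.[a]) hp; rewrite !hornerM horner_exp hornerXsubC subrr expr0n.
by move/eqP; rewrite /= !mul0r mulf_eq0 (negPf pa) (negPf sa').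
Qed.

Lemma has_lead_ord f a c e m n :
  has_lead f a m c -> has_lead f a n e -> m = n.
Proof.
move=> h1 h2; apply/eqP; rewrite eq_le !leNgt.
by apply/andP; split; apply/negP; [exact: has_lead_lt_absurd h2 h1 | exact: has_lead_lt_absurd h1 h2].
Qed.

End Leading.

(** * Split rational functions *)
Section Split.
Variable K : fieldType.
Implicit Types (a c : K) (l : seq (K * int)).

(** A rational function given by its divisor: the entry [(b, n)] of the list
    is the factor [(z - b) ^ n]. *)
Definition srat c l : ratfun K := rconst c * \prod_(x <- l) rlin x.1 ^ x.2.

Definition ordl l a : int := \sum_(x <- l | x.1 == a) x.2.
Definition leadl l a : K := \prod_(x <- l | x.1 != a) (a - x.1) ^ x.2.
Definition degl l : int := \sum_(x <- l) x.2.
Definition negl l := [seq (x.1, - x.2) | x <- l].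

Lemma ordl_cat l1 l2 a : ordl (l1 ++ l2) a = ordl l1 a + ordl l2 a.
Proof. exact: big_cat. Qed.

Lemma degl_cat l1 l2 : degl (l1 ++ l2) = degl l1 + degl l2.
Proof. exact: big_cat. Qed.

Lemma leadl_cat l1 l2 a : leadl (l1 ++ l2) a = leadl l1 a * leadl l2 a.
Proof. exact: big_cat. Qed.

Lemma ordl_neg l a : ordl (negl l) a = - ordl l a.
Proof. by rewrite /ordl big_map sumrN. Qed.

Lemma degl_neg l : degl (negl l) = - degl l.
Proof. by rewrite /degl big_map sumrN. Qed.

Lemma leadl_neg l a : leadl (negl l) a = (leadl l a)^-1.
Proof.
rewrite /leadl big_map -prodfV; apply: eq_bigr => x _ /=.
by rewrite invr_expz.
Qed.

Lemma srat_cat c1 c2 l1 l2 : srat c1 l1 * srat c2 l2 = srat (c1 * c2) (l1 ++ l2).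
Proof. by rewrite /srat rconstM big_cat mulrACA. Qed.

Lemma srat_catC c l1 l2 : srat c (l1 ++ l2) = srat c (l2 ++ l1).
Proof. by rewrite /srat; congr (_ * _); apply: perm_big; rewrite perm_catC. Qed.

Lemma rconst_srat c : rconst c = srat c [::].
Proof. by rewrite /srat big_nil mulr1. Qed.

Lemma srat_prod (I : Type) (r : seq I) (P : pred I) (F : I -> ratfun K)
    (c : I -> K) (L : I -> seq (K * int)) :
  (forall i, F i = srat (c i) (L i)) ->
  \prod_(i <- r | P i) F i
  = srat (\prod_(i <- r | P i) c i) (flatten [seq L i | i <- r & P i]).
Proof.
move=> e; elim: r => [|i r IH].
  by rewrite !big_nil /srat big_nil mulr1 /rconst rpoly1.
by rewrite !big_cons /=; case: ifP => // Pi /=; rewrite e IH srat_cat.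
Qed.

Lemma ordl_flatten (I : Type) (r : seq I) (P : pred I) (L : I -> seq (K * int)) a :
  ordl (flatten [seq L i | i <- r & P i]) a = \sum_(i <- r | P i) ordl (L i) a.
Proof.
elim: r => [|i r IH]; first by rewrite /ordl !big_nil.
by rewrite big_cons /=; case: ifP => //= Pi; rewrite ordl_cat IH.
Qed.

Lemma degl_flatten (I : Type) (r : seq I) (P : pred I) (L : I -> seq (K * int)) :
  degl (flatten [seq L i | i <- r & P i]) = \sum_(i <- r | P i) degl (L i).
Proof.
elim: r => [|i r IH]; first by rewrite big_nil; apply: big_nil.
by rewrite big_cons /=; case: ifP => //= Pi; rewrite degl_cat IH.
Qed.

Lemma leadl_flatten (I : Type) (r : seq I) (P : pred I) (L : I -> seq (K * int)) a :
  leadl (flatten [seq L i | i <- r & P i]) a = \prod_(i <- r | P i) leadl (L i) a.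
Proof.
elim: r => [|i r IH]; first by rewrite /leadl !big_nil.
by rewrite big_cons /=; case: ifP => //= Pi; rewrite leadl_cat IH.
Qed.

Lemma srat_neg c l : (srat c l)^-1 = srat c^-1 (negl l).
Proof.
rewrite /srat invfM big_map -prodfV; congr (_ * _).
  have [->|c0] := eqVneq c 0.
    have -> : rconst 0 = 0 :> ratfun K by rewrite /rconst polyC0; apply: tofrac0.
    by rewrite !invr0 /rconst polyC0; apply/esym/tofrac0.
  apply: (mulfI (rconst_neq0 c0)); rewrite divff ?rconst_neq0 //.
  by rewrite -rconstM divff // /rconst rpoly1.
by apply: eq_bigr => x _; rewrite invr_expz.
Qed.

Lemma has_lead_srat c l a : c != 0 ->
  has_lead (srat c l) a (ordl l a) (c * leadl l a).
Proof.
move=> c0; rewrite -[ordl l a]add0r.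
apply: has_leadM; first exact: has_lead_const.
rewrite /ordl /leadl; elim: l => [|[b n] l IH].
  by rewrite !big_nil; apply: has_lead1.
rewrite !big_cons /=; case: eqVneq => [->|ab] /=.
  rewrite -[X in has_lead _ _ _ X]mul1r; apply: has_leadM => //.
  by have := has_leadX n (has_lead_lin_eq a); rewrite mul1r exp1rz.
rewrite -[X in has_lead _ _ X _]add0r; apply: has_leadM => //.
have := @has_leadX _ _ _ _ _ n (@has_lead_lin_ne _ b a _).
by rewrite mul0r; apply; rewrite eq_sym.
Qed.

Lemma leadl_neq0 l a : leadl l a != 0.
Proof.
by have /has_lead_neq0 := has_lead_srat l a (oner_neq0 K); rewrite mul1r.
Qed.

End Split.

(** * Formal series of rational functions *)
Section Series.
Variable K : fieldType.
Implicit Types (p s : {poly K}) (c x : int -> K) (f g : ratfun K).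

(** [z] acts on the series of coefficients of [z ^ (- k)] as a shift. *)
Definition pmul s c : int -> K := fun k => \sum_(j < size s) s`_j * c (k + j%:Z).
Definition ser p : int -> K := fun k => if - k is Posz n then p`_n else 0.

Lemma pmul_wide n s c k : (size s <= n)%N ->
  pmul s c k = \sum_(j < n) s`_j * c (k + j%:Z).
Proof.
move=> sn; rewrite /pmul (big_ord_widen n (fun j => s`_j * c (k + j%:Z))) //.
rewrite big_mkcond; apply: eq_bigr => j _ /=.
by case: ltnP => // ?; rewrite nth_default ?mul0r.
Qed.

Lemma pmulDl s t c k : pmul (s + t) c k = pmul s c k + pmul t c k.
Proof.
pose n := maxn (size s) (size t).
rewrite !(@pmul_wide n) ?leq_maxl ?leq_maxr ?size_polyD // -big_split /=.
by apply: eq_bigr => j _; rewrite coefD mulrDl.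
Qed.

Lemma pmulBr s c d k : pmul s (fun k => c k - d k) k = pmul s c k - pmul s d k.
Proof. by rewrite /pmul -sumrB; apply: eq_bigr => j _; rewrite mulrBr. Qed.

Lemma pmulDr s c d k : pmul s (fun k => c k + d k) k = pmul s c k + pmul s d k.
Proof. by rewrite /pmul -big_split; apply: eq_bigr => j _; rewrite mulrDr. Qed.

Lemma pmulC a c k : pmul a%:P c k = a * c k.
Proof. by rewrite (@pmul_wide 1) ?size_polyC_leq1 // big_ord1 coefC addr0. Qed.

Lemma pmul0 c k : pmul 0 c k = 0.
Proof. by rewrite -polyC0 pmulC mul0r. Qed.

Lemma eq_pmul s c d : c =1 d -> pmul s c =1 pmul s d.
Proof. by move=> cd k; apply: eq_bigr => j _; rewrite cd. Qed.

Lemma pmulMX s c k : pmul (s * 'X) c k = pmul s c (k + 1).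
Proof.
rewrite (@pmul_wide (size s).+1); last first.
  by apply: (leq_trans (size_polyMleq _ _)); rewrite size_polyX addn2.
rewrite big_ord_recl coefMX mul0r add0r; apply: eq_bigr => j _.
by rewrite coefMX /= /bump add1n add0n -addrA -intS.
Qed.

Lemma pmulM s t c k : pmul (s * t) c k = pmul s (pmul t c) k.
Proof.
elim/poly_ind: s k => [|s a IH] k; first by rewrite mul0r !pmul0.
rewrite mulrDl !pmulDl mulrAC !pmulMX pmulC IH; congr (_ + _).
rewrite (@pmul_wide (size t)); last by rewrite mul_polyC size_scale_leq.
by rewrite /pmul mulr_sumr; apply: eq_bigr => j _; rewrite coefCM mulrA.
Qed.

Lemma serD p s k : ser (p + s) k = ser p k + ser s k.
Proof. by rewrite /ser; case: (- k) => n; rewrite ?coefD ?addr0. Qed.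

Lemma serMX p k : ser (p * 'X) k = ser p (k + 1).
Proof.
rewrite /ser; case e : (- k) => [[|n]|n]; case e' : (- (k + 1)) => [m|m];
  rewrite ?coefMX //=; try (by exfalso; lia).
by congr (p`_ _); lia.
Qed.

Lemma serC a s k : ser (a%:P * s) k = a * ser s k.
Proof. by rewrite /ser; case: (- k) => n; rewrite ?coefCM ?mulr0. Qed.

Lemma pmul_ser s p : pmul s (ser p) =1 ser (s * p).
Proof.
elim/poly_ind: s => [|s a IH] k.
  by rewrite mul0r pmul0 /ser; case: (- k) => n; rewrite ?coef0.
by rewrite mulrDl serD serC pmulDl mulrAC serMX pmulMX pmulC IH.
Qed.

Lemma ser_inj p s : ser p =1 ser s -> p = s.
Proof. by move=> e; apply/polyP => n; have := e (- n%:Z); rewrite /ser opprK. Qed.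

Lemma series_ofP f c : series_of f c <->
  exists p s, [/\ s != 0, f = rpoly p / rpoly s & pmul s c =1 ser p].
Proof.
split=> [[p [s [s0 fE e]]]|[p [s [s0 fE e]]]]; exists p, s; split=> //.
  move=> k; rewrite /ser -(e (- k)) /pmul; apply: eq_bigr => j _.
  by rewrite opprK addrC.
move=> k; have := e (- k); rewrite /ser opprK /pmul => <-.
by apply: eq_bigr => j _; rewrite addrC.
Qed.

(** The two expansions of a function are told apart from the other series that
    represent it by the direction in which they are bounded; [true] stands for
    series in nonnegative powers of the inverse of [z], up to a shift. *)
Definition one_sided (b : bool) c :=
  exists k0 : int, forall k : int, (if b then k < k0 else k0 < k) -> c k = 0.

Lemma one_sidedB b c d : one_sided b c -> one_sided b d ->
  one_sided b (fun k => c k - d k).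
Proof.
move=> [k0 hc] [k1 hd]; exists (if b then Num.min k0 k1 else Num.max k0 k1) => k.
by case: b hc hd => hc hd; [rewrite lt_min|rewrite gt_max] => /andP[? ?];
  rewrite hc ?hd ?subr0.
Qed.

Lemma one_sided_pmul b s c : one_sided b c -> one_sided b (pmul s c).
Proof.
move=> [k0 hc]; exists (if b then k0 - (size s)%:Z else k0) => k hk.
rewrite /pmul big1 // => j _; rewrite hc ?mulr0 //.
by have := ltn_ord j; case: b hc hk => _; lia.
Qed.

(** A nonzero polynomial acts injectively on the series bounded in one
    direction: its extreme coefficient isolates, one after the other, the
    coefficients of the series starting from the bound. *)
Lemma pmul_eq0 b s c : s != 0 -> one_sided b c ->
  (forall k, pmul s c k = 0) -> forall k, c k = 0.
Proof.
move=> s0 [k0 hc] sc; have nz := s0; rewrite -lead_coef_eq0 in nz.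
case: b hc => hc.
  suff h n (k : int) : k < k0 + n%:Z -> c k = 0.
    by move=> k; apply: (h (absz (k - k0 + 1)%R)); lia.
  elim: n k => [|n IH] k kn; first by apply: hc; lia.
  have := sc (k - (size s).-1%:Z); rewrite /pmul.
  have : (size s).-1.+1 = size s by rewrite prednK // size_poly_gt0.
  move=> <-; rewrite big_ord_recr big1 /= => [|j _].
    rewrite add0r subrK => /eqP; rewrite mulf_eq0 -/(lead_coef s) (negPf nz).
    by move/eqP.
  by rewrite IH ?mulr0 //; have := ltn_ord j; lia.
have exs : exists j, s`_j != 0 by exists (size s).-1.
case: (ex_minnP exs) => v sv vmin.
have vs : (v < size s)%N.
  by rewrite ltnNge; apply: contra sv => /(nth_default 0) ->.
suff h n (k : int) : k0 - n%:Z < k -> c k = 0.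
  by move=> k; have := h (absz (k - k0 - 1)%R) k; apply; lia.
elim: n k => [|n IH] k kn; first by apply: hc; lia.
have := sc (k - v%:Z); rewrite /pmul (bigD1 (Ordinal vs)) //= big1 => [|j jv].
  by rewrite addr0 subrK => /eqP; rewrite mulf_eq0 (negPf sv) => /eqP.
have [jlt|jge] := ltnP j v.
  have [->|nj] := eqVneq s`_j 0; first by rewrite mul0r.
  by have := vmin _ nj; lia.
rewrite IH ?mulr0 //; have : (j : nat) != v by [].
lia.
Qed.

(** Both sides become equal after multiplication by the denominators of [f] and
    of [g], which can be cancelled.  In this form a relation between two
    l-weights becomes a relation between the operators [K_i]. *)
Lemma series_quot b f g c d (N D : {poly K}) :
  series_of f c -> series_of g d -> one_sided b c -> one_sided b d ->
  g * rpoly D = f * rpoly N -> pmul D d =1 pmul N c.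
Proof.
move=> /series_ofP[p [s [s0 -> sc]]] /series_ofP[p' [s' [s'0 -> sd]]] bc bd e.
have e1 : p' * D * s = p * N * s'.
  by apply/eq_divp => //; rewrite !rpolyM mulrAC e mulrAC.
have ss : s * s' != 0 by rewrite mulf_neq0.
move=> k; apply/eqP; rewrite -subr_eq0; apply/eqP.
apply: (pmul_eq0 (c := fun k => pmul D d k - pmul N c k) ss
  (one_sidedB (one_sided_pmul D bd) (one_sided_pmul N bc))) => {}k.
rewrite pmulBr -!pmulM.
have -> : s * s' * D = (s * D) * s' by rewrite mulrAC.
have -> : s * s' * N = (s' * N) * s by rewrite mulrAC mulrC mulrA mulrAC.
rewrite !(pmulM _ s') !(pmulM _ s) (eq_pmul _ sd) (eq_pmul _ sc) !pmul_ser.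
have -> : s * D * p' = s' * N * p by transitivity (p' * D * s); [ring|rewrite e1; ring].
by rewrite subrr.
Qed.

(** Multiplying the series by both denominators gives the same polynomial,
    whichever function is used to compute it. *)
Lemma series_inj f g c : series_of f c -> series_of g c -> f = g.
Proof.
move=> /series_ofP[p [s [s0 -> sc]]] /series_ofP[p' [s' [s'0 -> sc']]].
apply/eq_divp => //; apply: ser_inj => k.
have e1 : ser (s' * p) k = pmul (s' * s) c k.
  by rewrite -pmul_ser pmulM; apply/esym/eq_pmul.
have e2 : ser (s * p') k = pmul (s * s') c k.
  by rewrite -pmul_ser pmulM; apply/esym/eq_pmul.
by rewrite (mulrC p) (mulrC p') e1 e2 (mulrC s).
Qed.

Lemma series_ofD f g c d : series_of f c -> series_of g d ->
  series_of (f + g) (fun k => c k + d k).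
Proof.
move=> /series_ofP[p [s [s0 -> sc]]] /series_ofP[p' [s' [s'0 -> sc']]].
apply/series_ofP; exists (p * s' + p' * s), (s * s'); split.
- by rewrite mulf_neq0.
- by rewrite rpolyD !rpolyM addf_div // rpoly_eq0.
move=> k; rewrite pmulDr serD; congr (_ + _).
  by rewrite mulrC pmulM (eq_pmul _ sc) pmul_ser mulrC.
by rewrite pmulM (eq_pmul _ sc') pmul_ser mulrC.
Qed.

Lemma series_of_ext f c d : c =1 d -> series_of f c -> series_of f d.
Proof.
move=> cd /series_ofP[p [s [s0 -> sc]]]; apply/series_ofP.
by exists p, s; split=> // k; rewrite -sc; apply/esym/eq_pmul.
Qed.

(** [true] selects the expansion at infinity and [false] the one at zero. *)
Definition expansion (b : bool) f c :=
  if b then expansion_at_infinity f c else expansion_at_zero f c.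

Lemma expansion_series b f c : expansion b f c -> series_of f c.
Proof. by case: b => -[]. Qed.

Lemma expansion_one_sided b f c : expansion b f c -> one_sided b c.
Proof. by case: b => -[_ h]; exists 0. Qed.

Lemma expansion_uniq b f c d : expansion b f c -> expansion b f d -> c =1 d.
Proof.
move=> hc hd k; have := series_quot (expansion_series hd) (expansion_series hc)
  (expansion_one_sided hd) (expansion_one_sided hc) (erefl (f * rpoly 1)) k.
by rewrite -polyC1 !pmulC !mul1r.
Qed.

Lemma expansionD b f g c d : expansion b f c -> expansion b g d ->
  expansion b (f + g) (fun k => c k + d k).
Proof.
by case: b => -[hc c0] [hd d0]; split=> [|k kn];
  rewrite ?c0 ?d0 ?addr0 //; apply: series_ofD.
Qed.

Lemma expansion_const b v : expansion b (rconst v) (fun k => if k == 0 then v else 0).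
Proof.
have h : series_of (rconst v) (fun k => if k == 0 then v else 0).
  apply/series_ofP; exists v%:P, 1; split; rewrite ?oner_eq0 ?rpoly1 ?divr1 //.
  move=> k; rewrite -polyC1 pmulC mul1r /ser.
  case: eqVneq => [->|k0]; first by rewrite oppr0 /= coefC.
  case e : (- k) => [n|n] //; rewrite coefC; case: n e => // e.
  by exfalso; lia.
by case: b; split=> // k; case: eqVneq => // ->; rewrite ltxx.
Qed.

Lemma expansion_simple b r a : a != 0 ->
  expansion b (rconst r / rlin a)
    (fun k => if b then if 0 < k then r * a ^ (k - 1) else 0
              else if k <= 0 then - (r * a ^ (k - 1)) else 0).
Proof.
move=> a0; set c := fun k => _.
have h : series_of (rconst r / rlin a) c.
  apply/series_ofP; exists r%:P, ('X - a%:P); split.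
  - by rewrite polyXsubC_eq0.
  - by [].
  move=> k; rewrite -polyCN pmulDl pmulC -['X]mul1r pmulMX -polyC1 pmulC mul1r.
  rewrite {}/c /ser mulNr addrK.
  have ak : r * a ^ k = a * (r * a ^ (k - 1)).
    by rewrite mulrCA -{2}[a]expr1z -expfzDr // addrC subrK.
  case: b; case: (ltrgtP k 0) => k0.
  - have -> : 0 < k + 1 = false by lia.
    case e : (- k) => [[|n]|n]; rewrite ?mulr0 ?subrr //; first by exfalso; lia.
    by rewrite coefC ?subr0.
  - have -> : 0 < k + 1 by lia.
    by rewrite -ak subrr; case e : (- k) => [n|n] //; exfalso; lia.
  - by rewrite k0 add0r oppr0 /= coefC mulr0 subr0 expr0z mulr1.
  - have -> : k + 1 <= 0 by lia.
    rewrite mulrN opprK -ak addNr.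
    by case e : (- k) => [[|n]|n] //; rewrite ?coefC //; exfalso; lia.
  - have -> : k + 1 <= 0 = false by lia.
    by rewrite mulr0 subr0; case e : (- k) => [n|n] //; exfalso; lia.
  - by rewrite lt_geF ?k0 // mulrN opprK -k0 -ak k0 oppr0 /= coefC add0r expr0z mulr1.
case: b @c h => c h; split=> // k k0; rewrite /c; first by rewrite ltNge ltW.
by rewrite leNgt k0.
Qed.

Lemma expansion_sum b (I : Type) (P : seq I) (F : I -> ratfun K) (v : I -> int -> K) :
  (forall i, expansion b (F i) (v i)) ->
  expansion b (\sum_(i <- P) F i) (fun k => \sum_(i <- P) v i k).
Proof.
move=> h; elim: P => [|i P IH].
  have := expansion_const b 0; rewrite /rconst polyC0 /rpoly tofrac0 => h0.
  rewrite big_nil; have -> : (fun k => \sum_(i <- [::]) v i k)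
    = (fun k : int => if k == 0 then 0 else 0 : K); last by [].
  by apply: funext => k; rewrite big_nil if_same.
rewrite big_cons; have -> : (fun k => \sum_(j <- i :: P) v j k)
    = (fun k => v i k + \sum_(j <- P) v j k).
  by apply: funext => k; rewrite big_cons.
exact: expansionD.
Qed.

End Series.

(** * Partial fractions *)
Section PartialFractions.
Variable K : fieldType.
Implicit Types (P U : seq K) (N : {poly K}) (l : seq (K * int)).

Lemma size_prod_pow (U : seq K) (Q : pred K) (n : K -> nat) :
  let p := \prod_(a <- U | Q a) ('X - a%:P) ^+ n a in
  p \is monic /\ size p = (\sum_(a <- U | Q a) n a).+1.
Proof.
elim: U => [|a U [IHm IHs]] /=; first by rewrite !big_nil monic1 size_poly1.
rewrite !big_cons; case: ifP => // _.
split; first by rewrite monicMl // monic_exp // monicXsubC.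
by rewrite size_Mmonic ?monic_neq0 ?monic_exp ?monicXsubC // IHs size_exp_XsubC addnS.
Qed.

Lemma pfrac_poly P N : uniq P -> (size N <= (size P).+1)%N ->
  N = N`_(size P) *: \prod_(a <- P) ('X - a%:P)
    + \sum_(a <- P) (N.[a] / \prod_(b <- P | b != a) (a - b))
        *: \prod_(b <- P | b != a) ('X - b%:P).
Proof.
move=> uP sN; set v := N`_ _; set M := \prod_(a <- P) _.
have sM : size M = (size P).+1 by apply: size_prod_XsubC.
have mM : M \is monic by apply: monic_prod_XsubC.
set S := \sum_(_ <- _) _.
have sS : (size S <= size P)%N.
  rewrite /S big_seq_cond; apply: (leq_trans (size_sum _ _ _)).
  apply/bigmax_leqP_seq => a aP /andP[_ _].
  apply: (leq_trans (size_scale_leq _ _)).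
  rewrite -big_filter size_prod_XsubC size_filter.
  by rewrite -(count_predC (pred1 a) P) addnC -addn1 leq_add2l -has_count has_pred1.
have e0 : N - v *: M - S = 0.
  apply: (@roots_geq_poly_eq0 _ _ P) => //.
    apply/allP => a aP; rewrite /root !hornerE.
    have -> : M.[a] = 0.
      by apply/eqP; rewrite -[_ == 0]/(root M a) root_prod_XsubC.
    rewrite mulr0 subr0 /S horner_sum (bigD1_seq a) //=.
    rewrite [X in _ - (_ + X)]big1 ?addr0 => [|b ba].
      rewrite hornerZ horner_prod.
      have -> : \prod_(b <- P | b != a) ('X - b%:P).[a] = \prod_(b <- P | b != a) (a - b).
        by apply: eq_bigr => b _; rewrite hornerXsubC.
      rewrite divfK ?subrr // prodf_seq_neq0; apply/allP => b _.
      by apply/implyP; rewrite subr_eq0 eq_sym.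
    rewrite hornerZ; apply/eqP; rewrite mulf_eq0; apply/orP; right.
    rewrite -[_ == 0]/(root _ a) -big_filter root_prod_XsubC mem_filter aP.
    by rewrite eq_sym ba.
  rewrite (leq_trans (size_polyD _ _)) // size_polyN geq_max sS andbT.
  apply/leq_sizeP => j; rewrite leq_eqVlt => /orP[/eqP <-|jP].
    rewrite coefB coefZ; move/monicP: mM; rewrite /lead_coef sM /= => ->.
    by rewrite mulr1 subrr.
  rewrite coefB coefZ !nth_default ?mulr0 ?subr0 ?sM //.
  by rewrite (leq_trans sN).
by apply/eqP; rewrite -subr_eq0 opprD addrA; apply/eqP.
Qed.

Lemma rpoly_prod P (Q : pred K) :
  rpoly (\prod_(a <- P | Q a) ('X - a%:P)) = \prod_(a <- P | Q a) rlin a.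
Proof. exact: rmorph_prod. Qed.

Lemma prod_rlin_neq0 P (Q : pred K) : \prod_(a <- P | Q a) rlin a != 0.
Proof.
rewrite prodf_seq_neq0; apply/allP => a _; apply/implyP => _.
exact: rlin_neq0.
Qed.

Lemma rpoly_sum (I : Type) (r : seq I) (F : I -> {poly K}) :
  rpoly (\sum_(i <- r) F i) = \sum_(i <- r) rpoly (F i).
Proof. exact: rmorph_sum. Qed.

Lemma pfrac P N : uniq P -> (size N <= (size P).+1)%N ->
  exists r : K -> K, rpoly N / \prod_(a <- P) rlin a
    = rconst N`_(size P) + \sum_(a <- P) rconst (r a) / rlin a.
Proof.
move=> uP sN; have e := pfrac_poly uP sN.
exists (fun a => N.[a] / \prod_(b <- P | b != a) (a - b)).
rewrite [in X in X / _]e; set v := N`_ _.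
rewrite -mul_polyC rpolyD rpolyM rpoly_prod mulrDl; congr (_ + _).
  exact: (mulfK (prod_rlin_neq0 P xpredT)).
rewrite rpoly_sum mulr_suml big_seq [RHS]big_seq.
apply: eq_bigr => a aP; rewrite -mul_polyC rpolyM rpoly_prod.
rewrite [X in _ / X](bigD1_seq a) //= -/(rconst _) invfM mulrA.
by rewrite mulrAC (mulfK (prod_rlin_neq0 P _)).
Qed.

Lemma srat_gather (c : K) l U : uniq U -> {subset [seq x.1 | x <- l] <= U} ->
  srat c l = rconst c * \prod_(a <- U) rlin a ^ ordl l a.
Proof.
move=> uU sU; rewrite /srat; congr (_ * _); elim: l sU => [|x l IH] sU.
  by rewrite big_nil big1 // => a _; rewrite /ordl big_nil expr0z.
rewrite big_cons IH => [|a al]; last by apply: sU; rewrite inE al orbT.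
have xU : x.1 \in U by apply: sU; rewrite inE eqxx.
rewrite (bigD1_seq x.1) //= [RHS](bigD1_seq x.1) //= mulrA; congr (_ * _).
  by rewrite /ordl big_cons eqxx expfzDr ?rlin_neq0.
by apply: eq_bigr => a ax; rewrite /ordl big_cons eq_sym (negPf ax).
Qed.

Lemma degl_gather l U : uniq U -> {subset [seq x.1 | x <- l] <= U} ->
  degl l = \sum_(a <- U) ordl l a.
Proof.
move=> uU sU; elim: l sU => [|x l IH] sU.
  by rewrite /degl big_nil big1 // => a _; rewrite /ordl big_nil.
rewrite /degl big_cons -/(degl l) IH => [|a al]; last first.
  by apply: sU; rewrite inE al orbT.
have xU : x.1 \in U by apply: sU; rewrite inE eqxx.
rewrite (bigD1_seq x.1) //= [RHS](bigD1_seq x.1) //= addrA; congr (_ + _).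
  by rewrite /ordl big_cons eqxx.
by apply: eq_bigr => a ax; rewrite /ordl big_cons eq_sym (negPf ax).
Qed.

Lemma ordl_notin l a : a \notin [seq x.1 | x <- l] -> ordl l a = 0.
Proof.
move=> al; rewrite /ordl big_seq_cond big1 // => x /andP[xl /eqP xa].
by case/negP: al; rewrite -xa map_f.
Qed.

(** By partial fractions the function is the sum of its value at infinity and
    of the terms [r / (z - a)] over its poles.  The expansions of such a term at
    infinity and at zero are the two halves of one geometric series, so that
    they differ by a multiple of the delta function at [a]. *)
Lemma simple_poles (c : K) l P : c != 0 -> degl l = 0 ->
  (forall a, -1 <= ordl l a) -> uniq P ->
  (forall a, (a \in P) = (ordl l a == -1)) -> ordl l 0 = 0 ->
  exists cp cm : int -> K,
  [/\ expansion true (srat c l) cp, expansion false (srat c l) cm,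
      cp 0 = c, cm 0 = c * leadl l 0
    & forall k, cp k - cm k = \sum_(a <- P) c * leadl l a / a * a ^ k]
  /\ is_value_at_infinity (srat c l) c.
Proof.
move=> c0 deg0 ord uP inP ord0.
pose U := undup [seq x.1 | x <- l].
have uU : uniq U := undup_uniq _.
have sU : {subset [seq x.1 | x <- l] <= U} by move=> a; rewrite mem_undup.
pose pos := [pred a | 0 <= ordl l a].
pose M := \prod_(a <- U | pos a) ('X - a%:P) ^+ `|ordl l a|%N.
have [mM sM] := size_prod_pow U pos (fun a => `|ordl l a|%N).
have PU : perm_eq P [seq a <- U | ~~ pos a].
  apply: uniq_perm; rewrite ?filter_uniq // => a.
  rewrite inP mem_filter /= -ltNge; apply/eqP/andP => [oa|[oa _]].
    split; first by rewrite oa.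
    by rewrite mem_undup; apply/negPn/negP => /ordl_notin; rewrite oa.
  by apply/eqP; rewrite eq_le ord andbT; lia.
have eP : \prod_(a <- U | ~~ pos a) rlin a ^ ordl l a = (\prod_(a <- P) rlin a)^-1.
  rewrite -[LHS]big_filter -(perm_big _ PU) -prodfV big_seq [RHS]big_seq.
  by apply: eq_bigr => a; rewrite inP => /eqP ->; rewrite exprN1.
have sP : (\sum_(a <- U | pos a) `|ordl l a|)%N = size P.
  apply/eqP; rewrite -eqz_nat; apply/eqP.
  have := degl_gather uU sU; rewrite deg0 (bigID pos) /= => /eqP.
  rewrite eq_sym addr_eq0 => /eqP.
  rewrite -[in RHS]big_filter -(perm_big _ PU) big_seq.
  rewrite [in RHS](eq_bigr (fun=> -1)) => [|a]; last by rewrite inP => /eqP.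
  rewrite -big_seq sumrN opprK big_const_seq count_predT iter_addr_0.
  move=> e.
  transitivity (\sum_(a <- U | pos a) ordl l a : int).
    rewrite (big_morph Posz PoszD (erefl _)); apply: eq_bigr => a /= ?.
    by rewrite gez0_abs.
  by rewrite e natz.
pose N := c *: M.
have sN : size N = (size P).+1 by rewrite size_scale // sM sP.
have vN : N`_(size P) = c.
  by have := monicP mM; rewrite /lead_coef sM sP /= /N coefZ => ->; rewrite mulr1.
have fE : srat c l = rpoly N / \prod_(a <- P) rlin a.
  rewrite (srat_gather c uU sU) (bigID pos) /= eP mulrA; congr (_ / _).
  rewrite /N -mul_polyC rpolyM -/(rconst c); congr (_ * _).
  rewrite /M /rpoly rmorph_prod; apply: eq_bigr => a /= oa.
  by rewrite tofracXn exprnP gez0_abs.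
have [r rE] := pfrac uP (eq_leq sN).
rewrite -fE vN in rE.
have P0 a : a \in P -> a != 0.
  by rewrite inP => oa; apply: contraTneq oa => ->; rewrite ord0.
have rP a : a \in P -> r a = c * leadl l a.
  move=> aP; have := has_lead_srat l a c0.
  move: (aP); rewrite inP => /eqP -> /is_residue_lead h.
  apply: is_residue_uniq h; rewrite rE (bigD1_seq a) //= addrCA addrC.
  exists 0%N, (fun=> r a), (rconst c + \sum_(b <- P | b != a) rconst (r b) / rlin b).
  split=> //; last by rewrite big_ord_recl big_ord0 addr0 expr1.
  eexists; apply: is_valueD; first exact: is_value_const.
  by apply: is_value_sum => b ba; apply: is_value_simple; rewrite eq_sym.
pose e b a (k : int) : K := if a == 0 then 0 else
  if b then if 0 < k then r a * a ^ (k - 1) else 0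
  else if k <= 0 then - (r a * a ^ (k - 1)) else 0.
pose cc b k := (if k == 0 then c else 0) + \sum_(a <- P) e b a k.
have exp b : expansion b (srat c l) (cc b).
  rewrite rE; apply: expansionD; first exact: expansion_const.
  pose F a := if a == 0 then 0 else rconst (r a) / rlin a.
  have -> : \sum_(a <- P) rconst (r a) / rlin a = \sum_(a <- P) F a.
    by rewrite big_seq [RHS]big_seq; apply: eq_bigr => a /P0/negPf aP; rewrite /F aP.
  apply: expansion_sum => a; rewrite /F /e; case: eqVneq => [_|a0].
    have := expansion_const b (0 : K); rewrite /rconst polyC0 /rpoly tofrac0.
    by congr expansion; apply: funext => k; rewrite if_same.
  exact: expansion_simple.
exists (cc true), (cc false); split; last first.
  exists N, (\prod_(a <- P) ('X - a%:P)).
  rewrite rpoly_prod size_prod_XsubC sN (monicP (monic_prod_XsubC _ _ _)).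
  by rewrite -size_poly_eq0 size_prod_XsubC /= vN divr1.
split=> //.
- rewrite /cc eqxx big1 ?addr0 // => a _; rewrite /e ltxx; exact: if_same.
- have := has_lead_srat l 0 c0; rewrite ord0 => /is_value_lead h.
  apply: is_value_uniq h; rewrite rE /cc eqxx.
  apply: is_valueD; first exact: is_value_const.
  rewrite big_seq [X in is_value _ _ X]big_seq.
  apply: is_value_sum => a /P0 a0; rewrite /e (negPf a0) lexx.
  rewrite sub0r exprN1 -mulrN -invrN -[- a]sub0r.
  by apply: is_value_simple; rewrite eq_sym.
move=> k; rewrite /cc opprD addrACA subrr add0r -sumrB big_seq [RHS]big_seq.
apply: eq_bigr => a aP; rewrite /e (negPf (P0 _ aP)) -rP //.
have -> : r a / a * a ^ k = r a * a ^ (k - 1).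
  by rewrite expfzDr ?P0 // exprN1 mulrAC mulrA.
by case: ltrP => _; rewrite ?subr0 // sub0r opprK.
Qed.

End PartialFractions.

(** * Exponentials and logarithms of scalar series *)
Section FormalExp.
Variable K : fieldType.
Implicit Types (h c : nat -> K).

Fixpoint spow h (m n : nat) : K :=
  if m is m'.+1 then \sum_(r < n) h r.+1 * spow h m' (n - r.+1)
  else (n == 0%N)%:R.

Definition sexp h (n : nat) : K := \sum_(m < n.+1) (m`!%:R)^-1 * spow h m n.

(** The part of the [n.+1]-st coefficient of the exponential that only involves
    the coefficients of index at most [n]. *)
Definition sexp_rest h n : K :=
  \sum_(m < n) (m.+2`!%:R)^-1 * spow h m.+2 n.+1.

Lemma sexpS h n : sexp h n.+1 = h n.+1 + sexp_rest h n.
Proof.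
rewrite /sexp !big_ord_recl /= mulr0 add0r; congr (_ + _).
  rewrite (_ : (bump 0 0)`!%:R^-1 = 1) ?invr1 // mul1r big_ord_recr /= big1 ?add0r => [|r _].
    by rewrite subnn mulr1.
  by rewrite subSS subn_eq0 leqNgt ltn_ord mulr0.
Qed.

Lemma spow_ext h h' m n : (forall r, (0 < r <= n)%N -> h r = h' r) ->
  spow h m n = spow h' m n.
Proof.
elim: m n => //= m IH n e; apply: eq_bigr => r _.
have rn := ltn_ord r; rewrite e ?rn //; congr (_ * _).
by apply: IH => s sn; apply: e; lia.
Qed.

Lemma sexp_rest_ext h h' n : (forall r, (r <= n)%N -> h r = h' r) ->
  sexp_rest h n = sexp_rest h' n.
Proof.
move=> e; apply: eq_bigr => m _; congr (_ * _).
rewrite [LHS]big_ord_recr [RHS]big_ord_recr /= subnn !big_ord0 !mulr0 !addr0.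
apply: eq_bigr => r _; rewrite e ?ltn_ord //; congr (_ * _).
by apply: (@spow_ext _ _ m.+1) => s sn; apply: e; have := ltn_ord r; lia.
Qed.

(** The coefficient of index [n] of the logarithm is determined by the previous
    ones, because the exponential contains it linearly ([sexpS]). *)
Fixpoint slog_upto c (n : nat) : nat -> K :=
  if n is n'.+1 then
    let h := slog_upto c n' in
    fun r => if r == n'.+1 then c n'.+1 - sexp_rest h n' else h r
  else fun=> 0.

Definition slog c (n : nat) : K := slog_upto c n n.

Lemma slog_uptoE c n r : (r <= n)%N -> slog_upto c n r = slog c r.
Proof.
elim: n => [|n IH]; first by rewrite leqn0 => /eqP ->.
rewrite leq_eqVlt => /orP[/eqP -> //|]; rewrite ltnS => rn /=.
by rewrite ltn_eqF ?ltnS // IH.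
Qed.

Lemma sexp_slog c n : c 0%N = 1 -> sexp (slog c) n = c n.
Proof.
case: n => [|n] c0.
  by rewrite /sexp big_ord_recl big_ord0 addr0 fact0 invr1 mul1r c0.
rewrite sexpS {1}/slog /= eqxx.
rewrite (@sexp_rest_ext (slog_upto c n) (slog c)) ?subrK // => r rn.
exact: slog_uptoE.
Qed.

End FormalExp.

(** * Free modules *)
Section FreeModule.
Variables (K : fieldType) (T : choiceType).
Local Notation V := {malg K[T]}.
Implicit Types (v : V).

Lemma malg_sumZ v : v = \sum_(t <- msupp v) v@_t *: << t >>.
Proof.
rewrite [LHS]monalgE; apply: eq_bigr => t _; apply/malgP => s.
by rewrite mcoeffZ !mcoeffU mulr_natr.
Qed.

Section LinearExtension.
Variables (W : lmodType K) (f : T -> W).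

Definition lext_fun v : W := \sum_(t <- msupp v) v@_t *: f t.

Lemma lext_wide v (D : {fset T}) : (msupp v `<=` D)%fset ->
  lext_fun v = \sum_(t <- D) v@_t *: f t.
Proof.
move=> vD; apply: big_fset_incl => // t _ /mcoeff_outdom ->.
by rewrite scale0r.
Qed.

Lemma lext_is_linear : linear lext_fun.
Proof.
move=> a u v; pose D := (msupp u `|` msupp v `|` msupp (a *: u + v))%fset.
rewrite !(@lext_wide _ D) ?fsubsetUr //; first last.
- by rewrite /D -fsetUA fsubsetUl.
- by rewrite /D fsetUAC fsubsetUr.
rewrite scaler_sumr -big_split; apply: eq_bigr => t _.
by rewrite mcoeffD mcoeffZ scalerDl scalerA.
Qed.

HB.instance Definition _ := GRing.isLinear.Build K V W *:%R lext_fun lext_is_linear.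

Definition lext : {linear V -> W} := lext_fun.

Lemma lext_basis t : lext << t >> = f t.
Proof.
rewrite /lext /= /lext_fun msuppU oner_eq0 big_seq_fset1 mcoeffUU.
exact: scale1r.
Qed.

End LinearExtension.

Definition diag (f : T -> K) : {linear V -> V} := lext (fun t => f t *: << t >>).

Lemma diag_basis f t : diag f << t >> = f t *: << t >>.
Proof. exact: lext_basis. Qed.

Lemma linear_ext0 (W : lmodType K) (G : V -> W) : linear G ->
  (forall t, G << t >> = 0) -> forall v, G v = 0.
Proof.
move=> lG G0 v; pose L := GRing.isLinear.Build K V W *:%R G lG.
pose G' : {linear V -> W} := HB.pack G L.
have -> : G v = G' v by [].
rewrite [v]malg_sumZ raddf_sum big1 // => t _.
by transitivity (v@_t *: G' << t >>); [exact: linearZ|rewrite /= G0 scaler0].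
Qed.

End FreeModule.

(** * Order ideals of boxes *)
Section Ideals.
Variables (R : realType) (mu nu : R[i]).
Local Notation Gsys := (Gsystem mu nu).
Local Notation S := (@Gstates R mu nu).
Implicit Types (l : state Gsys) (b u v w : Gbox).

(** Filling all negative boxes of the reference state, as in a Dirac sea, turns
    a state into an order ideal, and the removal of a negative box from the
    ideal into an element of the negative part of the state. *)
Definition inn l b : bool := if Gpositive b then b \in l.1 else b \notin l.2.

(** In [cov u v] the box [v] comes directly after [u].  The third family is a
    chain that is infinite in both directions, so that its
    nonempty proper ideals are half-lines. *)
Definition cov u v : bool :=
  match u, v with
  | Box1 i k, Box1 i' k' | Box2 i k, Box2 i' k' =>
      (i' == i.+1) && (k' == k) || (i' == i) && (k' == k.+1)
  | Box3 n, Box3 n' => n' == n + 1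
  | _, _ => false
  end.

Lemma inn_remove l b b' : inn (remove_box l b) b' = (b' != b) && inn l b'.
Proof.
rewrite /inn /remove_box /=; case Pb : (Gpositive b); case Pb' : (Gpositive b') => /=.
- by rewrite !inE.
- by case: eqVneq => // e; rewrite e Pb in Pb'.
- by case: eqVneq => // e; rewrite e Pb in Pb'.
- by rewrite !inE negb_or.
Qed.

Lemma inn_add l b b' : inn (add_box l b) b' = (b' == b) || inn l b'.
Proof.
rewrite /inn /add_box /=; case Pb : (Gpositive b); case Pb' : (Gpositive b') => /=.
- by rewrite !inE.
- by case: eqVneq => // e; rewrite e Pb in Pb'.
- by case: eqVneq => // e; rewrite e Pb in Pb'.
- by rewrite !inE negb_and negbK.
Qed.

Definition signed l : Prop :=
  (forall b, b \in l.1 -> Gpositive b) /\ (forall b, b \in l.2 -> ~~ Gpositive b).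

Lemma state_ext l l' : signed l -> signed l' -> inn l =1 inn l' -> l = l'.
Proof.
case: l l' => [p n] [p' n'] [/= hp hn] [/= hp' hn'] e.
congr (_, _); apply/fsetP => b; have := e b; rewrite /inn /=.
  case Pb : (Gpositive b) => // _.
  by apply/idP/idP => [/hp|/hp']; rewrite Pb.
case: ifP => Pb eb; last exact: (negb_inj eb).
by apply/idP/idP => [/hn|/hn']; rewrite Pb.
Qed.

Lemma signed_remove l b : signed l -> signed (remove_box l b).
Proof.
move=> [hp hn]; rewrite /remove_box /=; case Pb : (Gpositive b); split=> //= b'.
  by rewrite !inE => /andP[_ /hp].
by rewrite !inE => /orP[/eqP ->|/hn //]; rewrite Pb.
Qed.

Lemma signed_add l b : signed l -> signed (add_box l b).
Proof.
move=> [hp hn]; rewrite /add_box /=; case Pb : (Gpositive b); split=> //= b'.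
  by rewrite !inE => /orP[/eqP ->|/hp //].
by rewrite !inE => /andP[_ /hn].
Qed.

Lemma signed_Gstate D1 D2 k : signed (@Gstate R mu nu D1 D2 k).
Proof.
split=> b; rewrite /Gstate /=.
  rewrite !inE => /orP[/orP[/imfsetP[u _ ->]|/imfsetP[u _ ->]]|] //.
  by case: k => n; rewrite ?inE // => /imfsetP[j _ ->].
case: k => n; rewrite ?inE // => /imfsetP[j /=].
by rewrite inE mem_iota => h ->; rewrite /=; lia.
Qed.

Lemma inn_Gstate D1 D2 k b : inn (@Gstate R mu nu D1 D2 k) b =
  match b with
  | Box1 i j => (i, j) \in D1
  | Box2 i j => (i, j) \in D2
  | Box3 n => n < k
  end.
Proof.
rewrite /inn /Gstate /=; case: b => [i j|i j|n] /=.
- rewrite !inE; apply/idP/idP => [|h].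
    move=> /orP[/orP[/imfsetP[[a c] /= h [-> ->]]|/imfsetP[u _ //]]|] //.
    by case: k => n; rewrite ?inE // => /imfsetP[].
  by apply/orP; left; apply/orP; left; apply/imfsetP; exists (i, j).
- rewrite !inE; apply/idP/idP => [|h].
    move=> /orP[/orP[/imfsetP[u _ //]|/imfsetP[[a c] /= h [-> ->]]]|] //.
    by case: k => n; rewrite ?inE // => /imfsetP[].
  by apply/orP; left; apply/orP; right; apply/imfsetP; exists (i, j).
case: ifP => n0.
  rewrite !inE; apply/idP/idP => [|h].
    move=> /orP[/orP[/imfsetP[u _ //]|/imfsetP[u _ //]]|].
    case: k => m; rewrite ?inE // => /imfsetP[j /=].
    by rewrite mem_iota => /andP[_ jm] [->]; lia.
  apply/orP; right; case: k h => m h; last by exfalso; lia.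
  apply/imfsetP; exists `|n|%N; last by rewrite gez0_abs.
  by rewrite mem_iota; lia.
case: k => m; first by rewrite inE; apply/esym; lia.
apply/idP/idP => [h|h].
  rewrite ltNge; apply: contra h => h; apply/imfsetP; exists `|n|%N => /=.
    by rewrite inE mem_iota; lia.
  by congr Box3; lia.
apply/negP => /imfsetP[j /=]; rewrite inE mem_iota => jm [e].
by move: h; rewrite e; lia.
Qed.

Definition bsize b : nat :=
  match b with Box1 i k | Box2 i k => maxn i k | Box3 n => `|n|%N end.

Definition within (N : nat) l : Prop :=
  (forall b, b \in l.1 -> (bsize b < N)%N) /\ (forall b, b \in l.2 -> (bsize b < N)%N).

Lemma within_exists l : exists N, within N l.
Proof.
exists (\max_(b <- (l.1 `|` l.2)%fset) bsize b).+1.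
by split=> b bl; rewrite ltnS; apply: (@leq_bigmax_seq _ _ predT bsize b) => //;
  rewrite inE bl ?orbT.
Qed.

Definition closed_under_cov l := forall u v, cov u v -> inn l v -> inn l u.

Lemma closed_Box3 l n m : closed_under_cov l -> m <= n ->
  inn l (Box3 n) -> inn l (Box3 m).
Proof.
move=> cl mn; have -> : n = m + `|n - m|%N by lia.
elim: `|n - m|%N => [|j IH]; first by rewrite addr0.
by move=> h; apply: IH; apply: cl h; rewrite /=; apply/eqP; lia.
Qed.

Lemma closed_Box1 l i k i' k' : closed_under_cov l -> (i' <= i)%N -> (k' <= k)%N ->
  inn l (Box1 i k) -> inn l (Box1 i' k').
Proof.
move=> cl /subnK <- /subnK <-.
elim: (i - i')%N => [|n IH] h; last first.
  by apply: IH; apply: cl h; rewrite /= addSn !eqxx.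
move: h; rewrite add0n; elim: (k - k')%N => [|n IH] h; first by rewrite add0n in h.
by apply: IH; apply: cl h; rewrite /= addSn !eqxx orbT.
Qed.

Lemma closed_Box2 l i k i' k' : closed_under_cov l -> (i' <= i)%N -> (k' <= k)%N ->
  inn l (Box2 i k) -> inn l (Box2 i' k').
Proof.
move=> cl /subnK <- /subnK <-.
elim: (i - i')%N => [|n IH] h; last first.
  by apply: IH; apply: cl h; rewrite /= addSn !eqxx.
move: h; rewrite add0n; elim: (k - k')%N => [|n IH] h; first by rewrite add0n in h.
by apply: IH; apply: cl h; rewrite /= addSn !eqxx orbT.
Qed.

(** An ideal of a plane family is a Young diagram.  An ideal of the chain of the
    third family which differs from the negative half-line by finitely many
    boxes is a half-line [n < k]. *)
Lemma GstatesP l : S l <-> signed l /\ closed_under_cov l.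
Proof.
split=> [[D1 [D2 [k [y1 y2 ->]]]]|[sl cl]].
  split; first exact: signed_Gstate.
  move=> [i j|i j|n] [i' j'|i' j'|n'] //=; rewrite !inn_Gstate.
  - by move=> /orP[] /andP[/eqP -> /eqP ->] h; apply: y1 h _ _.
  - by move=> /orP[] /andP[/eqP -> /eqP ->] h; apply: y2 h _ _.
  - by move=> /eqP ->; lia.
pose c1 b := if b is Box1 i k then (i, k) else (0, 0)%N.
pose c2 b := if b is Box2 i k then (i, k) else (0, 0)%N.
pose D1 := [fset c1 b | b in [fset b in l.1 | if b is Box1 _ _ then true else false]%fset]%fset.
pose D2 := [fset c2 b | b in [fset b in l.1 | if b is Box2 _ _ then true else false]%fset]%fset.
have D1E i k : ((i, k) \in D1) = inn l (Box1 i k).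
  apply/imfsetP/idP => /= [[[a c|a c|a]]|h].
  - by rewrite !inE /= andbT => h [-> ->].
  - by rewrite !inE andbF.
  - by rewrite !inE andbF.
  by exists (Box1 i k); rewrite // !inE andbT.
have D2E i k : ((i, k) \in D2) = inn l (Box2 i k).
  apply/imfsetP/idP => /= [[[a c|a c|a]]|h].
  - by rewrite !inE andbF.
  - by rewrite !inE /= andbT => h [-> ->].
  - by rewrite !inE andbF.
  by exists (Box2 i k); rewrite // !inE andbT.
have [N [N1 N2]] := within_exists l.
have inN n : n < - N%:Z -> inn l (Box3 n).
  rewrite /inn /=; case: ifP => [|_ h]; first by lia.
  by apply/negP => /N2 /=; lia.
have ninN : ~~ inn l (Box3 N%:Z) by rewrite /inn /=; apply/negP => /N1 /=; lia.
have ex : exists m : nat, ~~ inn l (Box3 (m%:Z - N%:Z)).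
  by exists (N + N)%N; have -> : (N + N)%N%:Z - N%:Z = N%:Z by lia.
case: (ex_minnP ex) => m hm mmin.
exists D1, D2, (m%:Z - N%:Z); split.
- by move=> i k i' k'; rewrite !D1E => h ii kk; apply: closed_Box1 h.
- by move=> i k i' k'; rewrite !D2E => h ii kk; apply: closed_Box2 h.
apply: state_ext => //; first exact: signed_Gstate.
move=> b; rewrite inn_Gstate; case: b => [i k|i k|n]; rewrite ?D1E ?D2E //.
have [lt_n|ge_n] := ltP n.
  have [/inN //|nN] := ltP n (- N%:Z).
  apply/negPn/negP => h; have := mmin (absz (n + N%:Z)%R).
  have -> : (absz (n + N%:Z)%R)%:Z - N%:Z = n by lia.
  by move=> /(_ h); lia.
by apply/negP => h; case/negP: hm; apply: closed_Box3 h.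
Qed.

Lemma Gstates_signed l : S l -> signed l.
Proof. by case/GstatesP. Qed.

Lemma Gstates_closed l : S l -> closed_under_cov l.
Proof. by case/GstatesP. Qed.

Lemma inn_empty b : inn (fset0, fset0) b = ~~ Gpositive b.
Proof. by rewrite /inn !inE; case: Gpositive. Qed.

Lemma Gstates_empty : S (fset0, fset0).
Proof.
apply/GstatesP; split; first by split=> b; rewrite inE.
move=> u v; rewrite !inn_empty; case: u v => [i k|i k|n] [i' k'|i' k'|n'] //=.
by move=> /eqP ->; lia.
Qed.

(** Both directions at once: [d = true] removes boxes from the ideal, as [E]
    does, and [d = false] adds boxes to it, as [F] does; the second is the
    first for the complementary filter. *)
Definition innd (d : bool) l b := inn l b == d.
Definition covd (d : bool) u v := if d then cov u v else cov v u.
Definition tog (d : bool) l b := if d then remove_box l b else add_box l b.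
Definition okd (d : bool) l b := if d then convex S l b else concave S l b.

Lemma cov_irr u : cov u u = false.
Proof. by case: u => [i k|i k|n] /=; lia. Qed.

Lemma covd_irr d u : covd d u u = false.
Proof. by case: d; apply: cov_irr. Qed.

Lemma innd_tog d l b b' : innd d (tog d l b) b' = (b' != b) && innd d l b'.
Proof.
case: d; rewrite /innd /tog ?inn_remove ?inn_add ?eqb_id //.
by rewrite !eqbF_neg negb_or.
Qed.

Lemma innd_closed d l u v : S l -> covd d u v -> innd d l v -> innd d l u.
Proof.
move=> /Gstates_closed cl; rewrite /innd /covd; case: d; rewrite ?eqb_id ?eqbF_neg.
  exact: cl.
by move=> uv; apply/contra/cl.
Qed.

(** Removing [b] from an ideal leaves an ideal when no box of it comes after
    [b], and adding [b] gives one when all boxes before [b] are present. *)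
Lemma okdP d l b : S l ->
  okd d l b <-> innd d l b /\ (forall v, covd d b v -> ~~ innd d l v).
Proof.
move=> /GstatesP[sl cl].
have inP : (if positive (b : Gsys) then b \in l.1 else b \notin l.2) = inn l b by [].
have outP : (if positive (b : Gsys) then b \notin l.1 else b \in l.2) = ~~ inn l b.
  by rewrite /inn /=; case: ifP => // _; rewrite negbK.
rewrite /innd /okd /covd; case: d; rewrite ?eqb_id ?eqbF_neg.
  rewrite /convex inP; split=> [[bl /GstatesP[_ cr]]|[bl h]].
    split=> // v bv; apply/negP => vl.
    have := cr _ _ bv; rewrite !inn_remove (eqP vl) eqxx andbT /=.
    by case: eqVneq bv => [->|_ _ /(_ isT) //]; rewrite cov_irr.
  split=> //; apply/GstatesP; split; first exact: signed_remove.
  move=> u v uv; rewrite !inn_remove => /andP[vb vl].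
  rewrite (cl _ _ uv vl) andbT; apply/eqP => ub.
  by move: (h v); rewrite -ub uv vl => /(_ isT).
rewrite /concave outP; split=> [[bl /GstatesP[_ cr]]|[bl h]].
  split=> // v bv; rewrite eqbF_neg negbK.
  have := cr _ _ bv; rewrite !inn_add eqxx => /(_ isT).
  by case: eqVneq bv => // ->; rewrite cov_irr.
split=> //; apply/GstatesP; split; first exact: signed_add.
move=> u v uv; rewrite !inn_add => /orP[/eqP vb|vl].
  by have := h u; rewrite -vb uv eqbF_neg negbK => /(_ isT) ->; rewrite orbT.
by rewrite (cl _ _ uv vl) orbT.
Qed.

Lemma okd_state d l b : okd d l b -> S (tog d l b).
Proof. by case: d => -[]. Qed.

Lemma togC d l u v : tog d (tog d l u) v = tog d (tog d l v) u.
Proof.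
rewrite /tog; case: d; rewrite /remove_box /add_box /=;
  case: (Gpositive u); case: (Gpositive v) => //=; congr (_, _).
- by apply/fsetP => x; rewrite !inE andbCA.
- by rewrite !fsetUA (fsetUC [fset v]%fset).
- by rewrite !fsetUA (fsetUC [fset v]%fset).
- by apply/fsetP => x; rewrite !inE andbCA.
Qed.

Lemma remove_addC l u v : u != v ->
  remove_box (add_box l u) v = add_box (remove_box l v) u.
Proof.
move=> uv; rewrite /remove_box /add_box /=;
  case: (Gpositive u); case: (Gpositive v) => //=; congr (_, _); apply/fsetP => b;
  rewrite !inE; case: (eqVneq b u) => [->|_] //=; rewrite ?uv ?(negPf uv) //.
Qed.

Lemma signed_tog d l b : signed l -> signed (tog d l b).
Proof. by case: d; [apply: signed_remove|apply: signed_add]. Qed.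

Lemma togK d l b : signed l -> innd d l b -> tog (~~ d) (tog d l b) b = l.
Proof.
move=> sl bl; apply: state_ext => //; first by do 2!apply: signed_tog.
move=> b'; move: bl; rewrite /innd /tog; case: d; rewrite /= ?inn_remove ?inn_add ?eqb_id.
  by rewrite inn_remove; case: eqVneq => [->|].
by rewrite eqbF_neg; case: eqVneq => [-> /negPf ->|].
Qed.

Lemma okd_tog d l b : S l -> okd d l b -> okd (~~ d) (tog d l b) b.
Proof.
move=> Sl ok; have Sb := okd_state ok; have [bl h] := (okdP _ _ Sl).1 ok.
have sl := Gstates_signed Sl.
have inv : innd (~~ d) (tog d l b) b.
  have := innd_tog d l b b; rewrite eqxx /innd /=.
  by case: d {ok Sb bl h}; case: inn.
have back : S (tog (~~ d) (tog d l b) b) by rewrite togK.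
rewrite /innd in bl h inv *; case: d ok Sb bl h inv back => /= ok Sb bl h inv back.
  split=> //=; move: inv; rewrite /inn; case: ifP => //= _.
    by move=> /eqP/negbT.
  by rewrite eqbF_neg negbK.
by split=> //; move: inv; rewrite /inn eqb_id.
Qed.

End Ideals.

(** * The order of the boxes *)
Lemma exists_max (T : eqType) (r : rel T) (s : seq T) : irreflexive r -> transitive r ->
  s != [::] -> exists2 m, m \in s & forall z, z \in s -> ~~ r m z.
Proof.
move=> ir tr; elim: s => // x [|x' s] IH _.
  by exists x => [|z]; rewrite inE // => /eqP ->; rewrite ir.
have [//|m ms hm] := IH; case rm : (r m x).
  exists x; rewrite ?mem_head // => z; rewrite inE => /orP[/eqP ->|zs]; first by rewrite ir.
  by apply: contra (hm _ zs) => /(tr _ _ _ rm).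
exists m; first by rewrite inE ms orbT.
by move=> z; rewrite inE => /orP[/eqP ->|/hm //]; rewrite rm.
Qed.

Section BoxOrder.
Variables (R : realType) (mu nu : R[i]).
Implicit Types (b u v w : Gbox).

Definition glt b b' : bool :=
  match b, b' with
  | Box1 i k, Box1 i' k' | Box2 i k, Box2 i' k' =>
      (k < k')%N || (k == k') && (i < i')%N
  | Box3 n, Box3 n' => n < n'
  | _, _ => (Gfamily b < Gfamily b')%N
  end.

Lemma int_gtE (n : int) (x y : R[i]) : x - y = n%:~R -> int_gt x y = (0 < n).
Proof.
move=> e; rewrite /int_gt e; apply/asboolP/idP => [[m]|n0].
  by rewrite -[m.+1%:R]/((m.+1%:Z)%:~R) => /intr_inj ->.
by exists `|n|.-1%N; rewrite -[_.+1%:R]/((Posz _.+1)%:~R); congr (_%:~R); lia.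
Qed.

Lemma int_gt_nat (m n : nat) : @int_gt R m%:R n%:R = (n < m)%N.
Proof. by rewrite (@int_gtE (m%:Z - n%:Z)) ?rmorphB //=; lia. Qed.

Lemma GltE b b' : Glt mu nu b b' = glt b b'.
Proof.
case: b b' => [i k|i k|n] [i' k'|i' k'|n'] //=; rewrite /Glt /=.
- rewrite -[X in int_gt X X]/(1%:R) !int_gt_nat eqr_nat ltnn eqxx /=.
  by congr (_ || _); rewrite eq_sym.
- rewrite (@int_gtE (k'%:Z - k%:Z)) ?rmorphB /=; last by rewrite opprD addrACA subrr addr0.
  rewrite (inj_eq (addIr mu)) eqr_nat eqxx int_gt_nat ltnS eq_sym.
  rewrite -[X in int_gt X X]/(0%:R) int_gt_nat ltnn /=.
  by congr (_ || _); lia.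
rewrite (@int_gtE (n' - n)) ?rmorphB /=; last by rewrite opprD addrACA subrr add0r.
rewrite -[X in int_gt X X]/(0%:R) int_gt_nat ltnn eqxx andbF orbF.
by rewrite andbF orbF subr_gt0.
Qed.

Lemma glt_irr b : glt b b = false.
Proof. by case: b => [i k|i k|n] /=; lia. Qed.

Lemma glt_trans : transitive glt.
Proof. by move=> [i k|i k|n] [i' k'|i' k'|n'] [i'' k''|i'' k''|n''] //=; lia. Qed.

Lemma glt_total b b' : b != b' -> glt b b' || glt b' b.
Proof.
case: b b' => [i k|i k|n] [i' k'|i' k'|n'] //= bb.
- have : ~ (i = i' /\ k = k') by case=> e1 e2; rewrite e1 e2 eqxx in bb.
  by lia.
- have : ~ (i = i' /\ k = k') by case=> e1 e2; rewrite e1 e2 eqxx in bb.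
  by lia.
have : n <> n' by move=> e; rewrite e eqxx in bb.
by lia.
Qed.

Lemma glt_asym b b' : glt b b' -> glt b' b = false.
Proof. by case: b b' => [i k|i k|n] [i' k'|i' k'|n'] //=; lia. Qed.

(** Diagonal neighbours are not comparable to each other by [cov], although [q3]
    relates their positions. *)
Definition dia u v : bool :=
  match u, v with
  | Box1 i k, Box1 i' k' | Box2 i k, Box2 i' k' => (i' == i.+1) && (k' == k.+1)
  | _, _ => false
  end.

Lemma cov_glt u v : cov u v -> glt u v.
Proof. by case: u v => [i k|i k|n] [i' k'|i' k'|n'] //=; lia. Qed.

Lemma dia_glt u v : dia u v -> glt u v.
Proof. by case: u v => [i k|i k|n] [i' k'|i' k'|n'] //=; lia. Qed.

Lemma cov_positive u v : cov u v -> Gpositive u -> Gpositive v.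
Proof. by case: u v => [i k|i k|n] [i' k'|i' k'|n'] //= /eqP ->; lia. Qed.

Lemma colorS (n : nat) : (n.+1%:R : 'Z_2) = n%:R + 1.
Proof. by rewrite -natr1. Qed.

Lemma Z2_addr1 (c : 'Z_2) : c + 1 != c.
Proof. by rewrite -subr_eq0 addrAC subrr add0r. Qed.

Lemma Z2_addr11 (c : 'Z_2) : c + 1 + 1 = c.
Proof. by rewrite -addrA (_ : 1 + 1 = 0) ?addr0 //; apply/val_inj. Qed.

Lemma Z2_neq (c c' : 'Z_2) : c != c' -> c' = c + 1.
Proof.
by case: c c' => [[|[|//]] ?] [[|[|//]] ?] //= _; apply/val_inj.
Qed.

(** The two boxes that complete two diagonal neighbours to a square have
    different colors, so any family of boxes closed under passing to boxes in
    between contains two boxes of each color as soon as it contains the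
    neighbours. *)
Lemma dia_between u v : dia u v -> Gcolor v != Gcolor u /\ exists w w',
  [/\ cov u w, cov w v, cov u w', cov w' v & Gcolor w = Gcolor u /\ Gcolor w' = Gcolor v].
Proof.
case: u v => [i k|i k|n] [i' k'|i' k'|n'] //= /andP[/eqP -> /eqP ->].
  split; first by rewrite (colorS i.+1) Z2_addr1.
  by exists (Box1 i k.+1), (Box1 i.+1 k); rewrite /= !eqxx !orbT.
split; first by rewrite (colorS i.+1) Z2_addr1.
by exists (Box2 i k.+1), (Box2 i.+1 k); rewrite /= !eqxx !orbT.
Qed.

End BoxOrder.

(** * Sums and linear maps *)
Lemma sum_perm3 (U : zmodType) (f : 'I_3 -> 'I_3 -> 'I_3 -> U) :
  let x : 'I_3 := ord0 in let y : 'I_3 := inord 1 in let z : 'I_3 := inord 2 in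
  \sum_(s : 'S_3) f (s x) (s y) (s z)
  = f x y z + f x z y + f y x z + f y z x + f z x y + f z y x.
Proof.
move=> x y z.
have yE : y = @Ordinal 3 1 isT by apply/val_inj; rewrite /= inordK.
have zE : z = @Ordinal 3 2 isT by apply/val_inj; rewrite /= inordK.
pose L : seq 'S_3 := [:: 1; tperm y z; tperm x y; tperm x y * tperm x z; tperm x z * tperm x y; tperm x z]%g.
pose ev (s : 'S_3) := (s x, s y, s z).
have evL : map ev L = [:: (x, y, z); (x, z, y); (y, x, z); (y, z, x); (z, x, y); (z, y, x)].
  rewrite /L /ev /= !permE /= yE zE /x.
  by do !congr (_ :: _); apply/eqP; rewrite !xpair_eqE /= ?permE.
have uL : uniq L by apply: (@map_uniq _ _ ev); rewrite evL yE zE.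
have cL : L =i predT.
  by apply/subset_cardP; [rewrite (card_uniqP uL) -[RHS]/(#|'S_3|) card_Sn | apply/fintype.subsetP].
have -> : \sum_(s : 'S_3) f (s x) (s y) (s z) = \sum_(u <- map ev L) f u.1.1 u.1.2 u.2.
  by rewrite big_map (big_uniq _ uL); apply: eq_bigl => s; rewrite cL.
by rewrite evL !big_cons big_nil /= addr0 !addrA.
Qed.

Lemma factor6 (F : fieldType) (V : lmodType F) (s1 s2 s3 s4 s5 s6 r : F) (x : V) :
  (s1 + s2 + s3 + s4 + s5 + s6) * r = 0 ->
  (s1 * r) *: x + (s2 * r) *: x + (s3 * r) *: x + (s4 * r) *: x + (s5 * r) *: x + (s6 * r) *: x = 0.
Proof. by move=> e; rewrite -!scalerDl -!mulrDl e scale0r. Qed.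

Lemma EF_scalar (F : fieldType) (e1 e2 e3 e4 r z x y : F) : e4 * e3 - e2 * e1 = r * z ->
  e4 * y * (e3 * x) - e2 * x * (e1 * y) = r * (z * (x * y)).
Proof. by move=> h; rewrite [RHS]mulrA -h; ring. Qed.

Section LinearMaps.
Variables (R : realType) (V : lmodType R[i]).

Lemma qbracket_linear (p : R[i]) (A B : V -> V) :
  linear A -> linear B -> linear (qbracket p A B).
Proof.
move=> lA lB a x y; rewrite /qbracket lB lA lA lB.
by rewrite scalerDr scalerBr !scalerA [a * p]mulrC opprD addrACA.
Qed.

Lemma linear_sub (f g : V -> V) : linear f -> linear g ->
  linear (fun x => f x - g x).
Proof. by move=> lf lg a x y; rewrite lf lg scalerBr opprD addrACA. Qed.

Lemma linear_if (b : bool) (c : R[i]) (f : V -> V) : linear f ->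
  linear (fun x => if b then c *: f x else 0).
Proof.
move=> lf a x y; case: b; last by rewrite scaler0 addr0.
by rewrite lf scalerDr !scalerA [c * a]mulrC.
Qed.

Section Eigenvectors.
Variable h : nat -> V -> V.

Lemma pow_coef_linear m n : (forall r, linear (h r)) -> linear (pow_coef h m n).
Proof.
move=> lh; elim: m n => [|m IH] n a x y /=.
  by case: ifP => _ //; rewrite scaler0 addr0.
rewrite scaler_sumr -big_split; apply: eq_bigr => r _ /=.
by rewrite IH lh.
Qed.

Lemma exp_coef_linear n : (forall r, linear (h r)) -> linear (exp_coef h n).
Proof.
move=> lh a x y; rewrite /exp_coef scaler_sumr -big_split; apply: eq_bigr => m _ /=.
by rewrite (pow_coef_linear _ _ lh) scalerDr !scalerA [_ * a]mulrC.
Qed.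

Lemma exp_coef_eigen (x : V) (e : nat -> R[i]) n : (forall r, linear (h r)) ->
  (forall r, h r x = e r *: x) -> exp_coef h n x = sexp e n *: x.
Proof.
move=> lh he.
have hZ r (a : R[i]) y : h r (a *: y) = a *: h r y.
  have h0 : h r 0 = 0 by have := lh r (-1) 0 0; rewrite scaler0 addr0 scaleN1r addNr.
  by rewrite -[a *: y]addr0 lh h0 addr0.
have pe m n' : pow_coef h m n' x = spow e m n' *: x.
  elim: m n' => [|m IH] n' /=; first by case: eqP => _; rewrite ?scale1r ?scale0r.
  rewrite scaler_suml; apply: eq_bigr => r _.
  by rewrite IH hZ he scalerA mulrC.
rewrite /exp_coef /sexp scaler_suml; apply: eq_bigr => m _.
by rewrite pe scalerA.
Qed.

End Eigenvectors.

End LinearMaps.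

(** * The polynomial identity behind the Serre relations *)
Section SerreIdentity.
Variables (F : fieldType) (T : Type).
Implicit Types (f : T -> T -> F) (W : seq T -> F).

(** Exchanging two adjacent letters of a word changes only one factor of this
    product. *)
Fixpoint pairw f (s : seq T) : F :=
  if s is x :: s' then foldr (fun y r => f x y * r) 1 s' * pairw f s' else 1.

(** The expansion of [X_a, [X_b, [X_c, X_y]_r]]_p, when [W] gives the
    coefficient of a word whose first letter acts first *)
Definition serre3 (r p : F) W (a b c y : T) : F :=
  (W [:: y; c; b; a] - r * W [:: c; y; b; a]
   - (W [:: b; y; c; a] - r * W [:: b; c; y; a]))
  - p * (W [:: a; y; c; b] - r * W [:: a; c; y; b]
         - (W [:: a; b; y; c] - r * W [:: a; b; c; y])).

Definition serre_sum r p W (a b c y : T) : F :=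
  serre3 r p W a b c y + serre3 r p W a c b y + serre3 r p W b a c y
  + serre3 r p W b c a y + serre3 r p W c a b y + serre3 r p W c b a y.

(** Exchanging two letters of one color produces antisymmetric factors
    [A g(a, b)], [- A g(b, a)], and exchanging [y] with one of them symmetric
    factors.  After division by the common factors [A], [B], [D], [X], [Y], [Z]
    the assertion is a polynomial identity in the four positions, linear in [g]
    on each pair; [h] is [g] on letters of different colors up to a scalar. *)
Lemma serre_identity (e : bool) (r t : F) f (pt : T -> F) (a b c y : T) (A B D X Y Z : F) :
  let g u v := if e then pt u - r * pt v else pt v - r * pt u in
  let h u v := if e then r * pt u ^+ 2 - t * pt u * pt v + pt v ^+ 2
               else r * pt v ^+ 2 - t * pt v * pt u + pt u ^+ 2 in
  r != 0 ->
  f a b = A * g a b -> f b a = - (A * g b a) ->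
  f a c = B * g a c -> f c a = - (B * g c a) ->
  f b c = D * g b c -> f c b = - (D * g c b) ->
  f a y = X * h a y -> f y a = X * h y a ->
  f b y = Y * h b y -> f y b = Y * h y b ->
  f c y = Z * h c y -> f y c = Z * h y c ->
  serre_sum r r^-1 (pairw f) a b c y = 0.
Proof.
move=> g h r0 e1 e2 e3 e4 e5 e6 e7 e8 e9 e10 e11 e12.
apply: (mulfI r0); rewrite mulr0 /serre_sum /serre3 /=.
rewrite e1 e2 e3 e4 e5 e6 e7 e8 e9 e10 e11 e12 /g /h {g h e1 e2 e3 e4 e5 e6 e7 e8 e9 e10 e11 e12}.
move: (pt a) (pt b) (pt c) (pt y) => {}a {}b {}c {}y.
by case: e; field.
Qed.

End SerreIdentity.

(** * Complex exponentials and positions *)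
Section Monomials.
Variables (K : fieldType) (x y : K).
Hypotheses (x0 : x != 0) (y0 : y != 0).

Definition mono (a b : int) : K := x ^ a * y ^ b.

Lemma monoD a b a' b' : mono a b * mono a' b' = mono (a + a') (b + b').
Proof. by rewrite /mono mulrACA !expfzDr. Qed.

Lemma mono00 : mono 0 0 = 1. Proof. by rewrite /mono !expr0z mulr1. Qed.
Lemma mono10 : mono 1 0 = x. Proof. by rewrite /mono expr0z mulr1 expr1z. Qed.
Lemma mono01 : mono 0 1 = y. Proof. by rewrite /mono expr0z mul1r expr1z. Qed.

Lemma mono_neq0 a b : mono a b != 0.
Proof. by rewrite mulf_neq0 // expfz_neq0. Qed.

Lemma monoV a b : (mono a b)^-1 = mono (- a) (- b).
Proof.
apply: (mulfI (mono_neq0 a b)); rewrite monoD !subrr mono00 divff //.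
exact: mono_neq0.
Qed.

End Monomials.

Section Positions.
Variables (R : realType) (lq ld mu nu : R[i]).
Local Notation C := R[i].
Local Notation q := (q lq).
Local Notation q1 := (q1 lq ld).
Local Notation q2 := (q2 lq).
Local Notation q3 := (q3 lq ld).
Local Notation q2pow := (q2pow lq).

Lemma cexpD (x y : C) : cexp (x + y) = cexp x * cexp y.
Proof.
case: x y => [a b] [a' b'] /=; rewrite /cexp /=; apply/eqP.
by rewrite eq_complex /= expRD cosD sinD; apply/andP; split; apply/eqP; ring.
Qed.

Lemma cexp0 : cexp 0 = 1 :> C.
Proof. by rewrite /cexp /= expR0 cos0 sin0 mulr1 mulr0. Qed.

Lemma cexp_neq0 (x : C) : cexp x != 0.
Proof.
by apply/eqP => e; have := cexpD x (- x); rewrite subrr cexp0 e mul0r => /eqP;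
  rewrite oner_eq0.
Qed.

Lemma cexpN (x : C) : cexp (- x) = (cexp x)^-1.
Proof.
by apply: (mulfI (cexp_neq0 x)); rewrite -cexpD subrr cexp0 divff // cexp_neq0.
Qed.

Lemma cexpMz (n : int) (x : C) : cexp (n%:~R * x) = cexp x ^ n.
Proof.
have h (m : nat) : cexp (m%:R * x) = cexp x ^+ m.
  elim: m => [|m IH]; first by rewrite mul0r cexp0.
  by rewrite exprS -IH -cexpD -{2}[x]mul1r -mulrDl -natr1 addrC.
case: n => n; first exact: h.
by rewrite NegzE rmorphN mulNr cexpN h -exprnN.
Qed.

Lemma q_neq0 : q != 0. Proof. exact: cexp_neq0. Qed.
Lemma d_neq0 : d ld != 0. Proof. exact: cexp_neq0. Qed.
Lemma q1_neq0 : q1 != 0.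
Proof. by rewrite mulf_neq0 ?invr_eq0 ?q_neq0 ?d_neq0. Qed.
Lemma q2_neq0 : q2 != 0. Proof. by rewrite expf_neq0 ?q_neq0. Qed.
Lemma q3_neq0 : q3 != 0.
Proof. by rewrite mulf_neq0 ?invr_eq0 ?q_neq0 ?d_neq0. Qed.
Lemma q2pow_neq0 a : q2pow a != 0. Proof. exact: cexp_neq0. Qed.

Let mD := monoD q1_neq0 q2_neq0.
Let mV := monoV q1_neq0 q2_neq0.

Lemma q3E : q3 = mono q1 q2 (-1) (-1).
Proof.
rewrite /mono !exprN1 /Defs.q3 /Defs.q1 /Defs.q2; have := q_neq0; have := d_neq0.
by move: (Defs.q lq) (Defs.d ld) => x y y0 x0; field; rewrite x0 y0.
Qed.

Lemma q1pow_int (n : int) : q1pow lq ld n%:~R = mono q1 q2 n 0.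
Proof. rewrite /mono expr0z mulr1; by rewrite /q1pow cexpMz addrC cexpD cexpN. Qed.

Lemma q2pow_int (n : int) : q2pow n%:~R = mono q1 q2 0 n.
Proof. rewrite /mono expr0z mul1r; by rewrite /Defs.q2pow cexpMz mulr_natl mulr2n cexpD. Qed.

Lemma q3pow_int (n : int) : q3pow lq ld n%:~R = q3 ^ n.
Proof. by rewrite /q3pow cexpMz opprD cexpD !cexpN. Qed.

Lemma q2powD a b : q2pow (a + b) = q2pow a * q2pow b.
Proof. by rewrite /Defs.q2pow mulrDl cexpD. Qed.

Lemma q2powN a : q2pow (- a) = (q2pow a)^-1.
Proof. by rewrite /Defs.q2pow mulNr cexpN. Qed.

(** The plane of each family is extended to all integer coordinates, because
    zeros and poles of factors of the l-weights also occur outside the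
    boxes.  The families are [None], [Some false], [Some true]; the
    normalization of the first coordinate makes the color the same function of
    it in the three families. *)
Definition site : Type := (option bool * (int * int))%type.

Definition site_of (b : Gbox) : site :=
  match b with
  | Box1 i k => (None, (i%:Z, k%:Z))
  | Box2 i k => (Some false, (i%:Z, k%:Z))
  | Box3 n => (Some true, (1, n))
  end.

Definition shift (f : option bool) : C :=
  match f with None => 0 | Some false => - mu | Some true => - (mu + nu) end.
Definition offx (f : option bool) : int := if f is Some false then -1 else 1.
Definition offy (f : option bool) : int := if f is None then 1 else 0.

Definition spos (s : site) : C :=
  q2pow (shift s.1) * mono q1 q2 (offx s.1 - s.2.1) (offy s.1 - s.2.2).

Definition scol (s : site) : 'Z_2 := (s.2.1 + 1)%:~R.

Lemma scol_site b : Gcolor b = scol (site_of b).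
Proof.
case: b => [i k|i k|n]; rewrite /scol /=.
- by rewrite -[i%:Z + 1]/((i + 1)%N%:Z) addn1.
- by rewrite -[i%:Z + 1]/((i + 1)%N%:Z) addn1.
by apply/val_inj.
Qed.

Lemma site_inj : injective site_of.
Proof. by move=> [i k|i k|n] [i' k'|i' k'|n'] //= [] => [-> ->|-> ->|->]. Qed.

Lemma position_site b : position lq ld (b : Gsystem mu nu) = spos (site_of b).
Proof.
rewrite /position /spos; case: b => [i k|i k|n] /=.
- rewrite -[i%:R]/((i%:Z)%:~R) -[k%:R]/((k%:Z)%:~R) -[1]/((1%:Z)%:~R) -!mulrNz.
  rewrite q1pow_int q2pow_int q3pow_int exprN1 q3E mV -[X in q2pow X]/((0%:Z)%:~R).
  by rewrite q2pow_int !mD; congr mono; lia.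
- rewrite oppr0 -[i.+1%:R]/((i.+1%:Z)%:~R) opprD -!mulrNz q1pow_int q2powD.
  rewrite -[k%:R]/((k%:Z)%:~R) -mulrNz q2pow_int.
  rewrite -[X in q3pow _ _ X]/((0%:Z)%:~R) q3pow_int expr0z mulr1.
  rewrite mulrA mD mulrC; congr (_ * mono _ _ _ _); lia.
rewrite oppr0 -[X in q3pow _ _ X]/((0%:Z)%:~R) q3pow_int expr0z mulr1.
rewrite -[X in q1pow _ _ X]/((0%:Z)%:~R) q1pow_int.
rewrite opprD q2powD -mulrNz q2pow_int mulrCA mD.
by congr (_ * mono _ _ _ _); lia.
Qed.

Lemma spos_neq0 s : spos s != 0.
Proof. exact: (mulf_neq0 (q2pow_neq0 _) (mono_neq0 q1_neq0 q2_neq0 _ _)). Qed.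

Lemma spos_shift f x y m n :
  mono q1 q2 m n * spos (f, (x, y)) = spos (f, (x - m, y - n)).
Proof. by rewrite /spos /= mulrCA mD; congr (_ * mono _ _ _ _); lia. Qed.

Lemma q1_spos f x y : q1 * spos (f, (x, y)) = spos (f, (x - 1, y)).
Proof. by have := spos_shift f x y 1 0; rewrite mono10 subr0. Qed.

Lemma q2_spos f x y : q2 * spos (f, (x, y)) = spos (f, (x, y - 1)).
Proof. by have := spos_shift f x y 0 1; rewrite mono01 subr0. Qed.

Lemma q3_spos f x y : q3 * spos (f, (x, y)) = spos (f, (x + 1, y + 1)).
Proof. by have := spos_shift f x y (-1) (-1); rewrite -q3E !opprK. Qed.

Hypothesis gen : generic_parameters lq ld.

Lemma monomial_eq1 (a b : int) : mono q1 q2 a b = 1 -> a = 0 /\ b = 0.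
Proof.
move=> e; have : cexp (ratr (b *+ 2 - a)%:~R * lq + ratr a%:~R * ld) = 1.
  rewrite !ratr_int -[RHS]e -[a]addr0 -[b]add0r -mD addr0 add0r.
  rewrite -q1pow_int -q2pow_int /q1pow /Defs.q2pow -cexpD.
  by congr cexp; rewrite rmorphB rmorphMn /= mulr2n; ring.
move=> /gen[/eqP]; rewrite intr_eq0 => /eqP e1 /eqP; rewrite intr_eq0 => /eqP e2.
by split=> //; move: e1; rewrite e2; lia.
Qed.

(** [q1] and [q2] are multiplicatively independent because [q] and [d] are. *)
Lemma monomial_inj (a b a' b' : int) :
  mono q1 q2 a b = mono q1 q2 a' b' -> a = a' /\ b = b'.
Proof.
move=> e; have : mono q1 q2 (a - a') (b - b') = 1.
  by rewrite -mD e mD !subrr mono00.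
by move=> /monomial_eq1[]; lia.
Qed.

Lemma nonresonant_monomial a (m n : int) : not_integer a -> nonresonant lq ld a ->
  q2pow a <> mono q1 q2 m n.
Proof.
move=> na ra e; have := ra m n 0; rewrite expr0z mulr1 => /(_ e)[k].
exact: na.
Qed.

Hypotheses (mu_int : not_integer mu) (nu_int : not_integer nu)
  (munu_int : not_integer (mu + nu)).
Hypotheses (mu_res : nonresonant lq ld mu) (nu_res : nonresonant lq ld nu)
  (munu_res : nonresonant lq ld (mu + nu)).

(** Positions of two families differ by a monomial in [q1] and [q2] times
    [q2] to the power [mu], [nu] or [mu + nu] or an inverse of it; by
    non-resonance such a product is not [1].  Within one family, exponents are
    determined by [monomial_inj]. *)
Lemma spos_inj : injective spos.
Proof.
have nores a f g x y x' y' : not_integer a -> nonresonant lq ld a ->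
    shift f - shift g = a -> spos (f, (x, y)) <> spos (g, (x', y')).
  move=> ai ar e1 e.
  apply: (nonresonant_monomial (m := (offx g - x') - (offx f - x))
    (n := (offy g - y') - (offy f - y)) ai ar).
  rewrite -e1 q2powD q2powN -mD -mV; apply/eqP.
  rewrite (eqr_div _ _ (q2pow_neq0 _) (mono_neq0 q1_neq0 q2_neq0 _ _)).
  by apply/eqP; rewrite [RHS]mulrC.
move=> [f [x y]] [g [x' y']] e.
have : f = g.
  case: f g e => [[]|] [[]|] // e; exfalso.
  - by apply: (nores _ _ _ _ _ _ _ nu_int nu_res _ (esym e)); rewrite /=; ring.
  - by apply: (nores _ _ _ _ _ _ _ munu_int munu_res _ (esym e)); rewrite /=; ring.
  - by apply: (nores _ _ _ _ _ _ _ nu_int nu_res _ e); rewrite /=; ring.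
  - by apply: (nores _ _ _ _ _ _ _ mu_int mu_res _ (esym e)); rewrite /=; ring.
  - by apply: (nores _ _ _ _ _ _ _ munu_int munu_res _ e); rewrite /=; ring.
  - by apply: (nores _ _ _ _ _ _ _ mu_int mu_res _ e); rewrite /=; ring.
move=> fg; move: e; rewrite fg /spos /= => /(mulfI (q2pow_neq0 _)) /monomial_inj[].
by move=> e1 e2; congr (_, (_, _)); lia.
Qed.

(** ** Divisors of the l-weights *)
Implicit Types (s t : site) (l : state (Gsystem mu nu)) (b u v w : Gbox).
Local Notation pos b := (spos (site_of b)).

(** The divisor of the [i]-th component of [A^-1] at the site [w]. *)
Definition Bsites (w : site) (i : 'Z_2) : seq (site * int) :=
  let: (f, (x, y)) := w in
  if i == scol w then [:: ((f, (x, y - 1)), 1); ((f, (x, y + 1)), -1)]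
  else [:: ((f, (x - 1, y)), 1); ((f, (x + 1, y + 1)), 1);
           ((f, (x + 1, y)), -1); ((f, (x - 1, y - 1)), -1)].

Definition Psites (i : 'Z_2) : seq (site * int) :=
  if i == 0 then [:: ((None, (-1, -1)), 1); ((Some false, (-1, -1)), 1);
                     ((Some true, (1, 0)), -1); ((Some true, (1, -1)), -1)]
  else [:: ((Some true, (0, -1)), 1); ((Some true, (2, 0)), 1);
           ((None, (0, 0)), -1); ((Some false, (0, 0)), -1)].

Definition at_pos (L : seq (site * int)) : seq (C * int) :=
  [seq (spos x.1, x.2) | x <- L].

Definition Bcst (w : site) (i : 'Z_2) : C := if i == scol w then q2^-1 else q2.
Definition Pcst (i : 'Z_2) : C :=
  if i == 0 then q3 * qpow lq (- mu - 2 * nu) else qpow lq (mu + 2 * nu).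

Lemma rpoly_scale (c a : C) : c != 0 ->
  rpoly (c *: 'X - a%:P) = srat c [:: (c^-1 * a, 1)].
Proof.
move=> c0; rewrite /srat big_seq1 expr1z /rconst /rlin -rpolyM mul_polyC.
by rewrite scalerBr -mul_polyC -[c *: _%:P]mul_polyC -polyCM mulrA divff // mul1r mul_polyC.
Qed.

Lemma rlin_srat (a : C) : rlin a = srat 1 [:: (a, 1)].
Proof. by rewrite /srat big_seq1 expr1z /rconst rpoly1 mul1r. Qed.

Lemma q1V_spos f x y : q1^-1 * spos (f, (x, y)) = spos (f, (x + 1, y)).
Proof. by rewrite -[in LHS](addrK 1 x) -q1_spos mulKf ?q1_neq0. Qed.

Lemma q2V_spos f x y : q2^-1 * spos (f, (x, y)) = spos (f, (x, y + 1)).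
Proof. by rewrite -[in LHS](addrK 1 y) -q2_spos mulKf ?q2_neq0. Qed.

Lemma q3V_spos f x y : q3^-1 * spos (f, (x, y)) = spos (f, (x - 1, y - 1)).
Proof.
by rewrite -[in LHS](subrK 1 x) -[in LHS](subrK 1 y) -q3_spos mulKf ?q3_neq0.
Qed.

Lemma q1q3 : q1 * q3 = q2^-1.
Proof.
rewrite q3E -[X in X * _](mono10 q1 q2) mD /mono expr0z mul1r; exact: exprN1.
Qed.

Lemma AfunV_srat (w : site) i :
  (Afun lq ld (scol w) (spos w) i)^-1 = srat (Bcst w i) (at_pos (Bsites w i)).
Proof.
case: w => f [x y]; rewrite /Afun /Bcst /Bsites; case: (i == _).
  rewrite (rpoly_scale _ q2_neq0) rlin_srat q2V_spos q2_spos srat_neg srat_cat.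
  by rewrite srat_neg divr1; exact: (srat_catC _ [:: _] [:: _]).
rewrite (rpoly_scale _ q1_neq0) (rpoly_scale _ q3_neq0) !rlin_srat.
rewrite q1V_spos q3V_spos q1_spos q3_spos !srat_cat srat_neg srat_cat srat_neg.
rewrite mul1r divr1 q1q3 invrK; exact: (srat_catC _ [:: _; _] [:: _; _]).
Qed.

Lemma GPsi_srat i : GPsi lq ld mu nu i = srat (Pcst i) (at_pos (Psites i)).
Proof.
have sE f x y a m n : a = shift f -> m = offx f - x -> n = offy f - y ->
  q2pow a * mono q1 q2 m n = spos (f, (x, y)) by move=> -> -> ->.
have q3V : q3^-1 = mono q1 q2 1 1 by rewrite q3E mV !opprK.
have q1V : q1^-1 = mono q1 q2 (-1) 0 by rewrite -[in LHS](mono10 q1 q2) mV oppr0.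
have q2p0 : 1 = q2pow 0 by rewrite (q2pow_int 0) mono00.
have p1 : q3 ^- 2 = spos (None, (-1, -1)).
  by rewrite -exprVn q3V expr2 mD -[LHS]mul1r q2p0; apply: sE.
have p2 : q2pow (- mu + 1) = spos (Some false, (-1, -1)).
  by rewrite q2powD (q2pow_int 1); apply: sE.
have p3 : q2pow (- mu - nu) = spos (Some true, (1, 0)).
  by rewrite -opprD -[LHS]mulr1 -(mono00 q1 q2); apply: sE.
have p4 : q2pow (- mu - nu + 1) = spos (Some true, (1, -1)).
  by rewrite -opprD q2powD (q2pow_int 1); apply: sE.
have p5 : q3^-1 * q2pow (- mu - nu) = spos (Some true, (0, -1)).
  by rewrite -opprD q3V mulrC; apply: sE.
have p6 : q1^-1 * q2pow (- mu - nu) = spos (Some true, (2, 0)).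
  by rewrite -opprD q1V mulrC; apply: sE.
have p7 : q3^-1 = spos (None, (0, 0)).
  by rewrite q3V -[LHS]mul1r q2p0; apply: sE.
have p8 : q1^-1 * q2pow (- mu) = spos (Some false, (0, 0)).
  by rewrite q1V mulrC; apply: sE.
rewrite /GPsi p1 p2 p5 p6 p3 p4 p7 p8 /Pcst /Psites.
case: (i == 0).
  by rewrite rconst_srat !rlin_srat !srat_cat srat_neg !srat_cat !(mulr1, invr1).
by rewrite rconst_srat !rlin_srat !srat_cat srat_neg !srat_cat !(mulr1, invr1).
Qed.

Definition sord (L : seq (site * int)) s : int := \sum_(x <- L | x.1 == s) x.2.

Lemma ordl_at_pos L s : ordl (at_pos L) (spos s) = sord L s.
Proof. by rewrite /ordl big_map; apply: eq_bigl => x /=; rewrite (inj_eq spos_inj). Qed.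

Lemma sordE L s : sord L s = \sum_(x <- L) x.2 * (x.1 == s)%:Z.
Proof.
rewrite /sord big_mkcond; apply: eq_bigr => x _.
by case: eqP; rewrite ?mulr1 ?mulr0.
Qed.

(** At a site only the component of its color matters.  For [A_w^-1] this is
    linear over linear when [w] has the same color and quadratic over quadratic
    otherwise; both cases are given by this one difference of the indicator of
    [w], since the terms with [x] unchanged and those with [x] changed by one
    belong to different colors. *)
Definition lap (I : site -> int) s : int :=
  let: (f, (x, y)) := s in
  I (f, (x, y + 1)) + I (f, (x + 1, y)) + I (f, (x - 1, y - 1))
  - I (f, (x, y - 1)) - I (f, (x - 1, y)) - I (f, (x + 1, y + 1)).

Lemma scolD1 f x y : scol (f, (x + 1, y)) = scol (f, (x, y)) + 1.
Proof. by rewrite /scol /= !rmorphD. Qed.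

Lemma scolB1 f x y : scol (f, (x - 1, y)) = scol (f, (x, y)) + 1.
Proof. by rewrite -{2}[x](subrK 1) scolD1 Z2_addr11. Qed.

Lemma sord_Bsites (w : site) s : sord (Bsites w (scol s)) s = lap (fun t => (w == t)%:Z) s.
Proof.
case: w s => f [x y] [g [x' y']]; rewrite /lap /Bsites sordE.
have c2 : scol (g, (x', y')) == scol (f, (x, y)) -> (x' != x - 1) && (x' != x + 1).
  move=> /eqP e; apply/andP; split; apply/eqP => e2; move: e; rewrite e2.
    by rewrite scolB1 => e; have := Z2_addr1 (scol (g, (x, y'))); rewrite e eqxx.
  by rewrite scolD1 => e; have := Z2_addr1 (scol (g, (x, y'))); rewrite e eqxx.
have c1 : scol (g, (x', y')) != scol (f, (x, y)) -> x' != x.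
  by apply: contraNneq => ->.
have eqE (f1 g1 : option bool) (a b a' b' : int) :
    ((f1, (a, b)) == (g1, (a', b')) :> site) = (f1 == g1) && ((a == a') && (b == b')).
  by [].
have eqB1 (a b : int) : (a - 1 == b) = (a == b + 1) by lia.
have eqD1 (a b : int) : (a + 1 == b) = (a == b - 1) by lia.
case: ifP => [/c2/andP[h1 h2]|/negbT/c1 h1];
  rewrite !big_cons big_nil /= !eqE !eqB1 !eqD1; case: (f == g) => //=.
  have -> : (x == x' + 1) = false by lia.
  have -> : (x == x' - 1) = false by lia.
  by rewrite /=; ring.
have -> : (x == x') = false by rewrite eq_sym; apply: negPf.
by rewrite /=; ring.
Qed.

(** The plane families are surrounded by a filled complement of the positive
    quadrant, because then the zeros and poles of [Psi] are the corners of the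
    reference state ([sord_Psites]), and the third family is a filled half-line
    in an empty plane. *)
Definition ext l t : bool :=
  let: (f, (x, y)) := t in
  match f with
  | None => [|| x < 0, y < 0 | inn l (Box1 `|x| `|y|)]
  | Some false => [|| x < 0, y < 0 | inn l (Box2 `|x| `|y|)]
  | Some true => (x == 1) && inn l (Box3 y)
  end.

Definition vac : state (Gsystem mu nu) := (fset0, fset0).

Lemma sord_Psites s : sord (Psites (scol s)) s = lap (fun t => (ext vac t)%:Z) s.
Proof.
case: s => f [x y]; rewrite /lap /Psites sordE.
have sx c : x = c -> scol (f, (x, y)) = (c + 1)%:~R by move=> ->.
have eqE (f1 g1 : option bool) (a b a' b' : int) :
    ((f1, (a, b)) == (g1, (a', b')) :> site) = (f1 == g1) && ((a == a') && (b == b')).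
  by [].
have c0 : scol (f, (x, y)) == 0 -> (x != 0) && (x != 2).
  by move=> /eqP e; apply/andP; split; apply/eqP => /sx; rewrite e => /eqP.
have c1 : scol (f, (x, y)) != 0 -> (x != -1) && (x != 1).
  by move=> e; apply/andP; split; apply/eqP => /sx; apply/eqP.
case: ifP => [/c0|/negbT/c1] h; rewrite !big_cons big_nil !eqE;
  case: f {sx c0 c1} => [[]|] /=; rewrite !inn_empty /=; lia.
Qed.

Definition Blist i b : seq (C * int) := at_pos (Bsites (site_of b) i).

(** The divisor and the constant of the part of the l-weight of [l] that
    comes from the boxes satisfying [P]. *)
Definition Al (P : pred Gbox) l i : seq (C * int) :=
  flatten [seq Blist i b | b <- l.1 & P b] ++ flatten [seq negl (Blist i b) | b <- l.2 & P b].
Definition Ac (P : pred Gbox) l i : C :=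
  \prod_(b <- l.1 | P b) Bcst (site_of b) i * \prod_(b <- l.2 | P b) (Bcst (site_of b) i)^-1.

Lemma Bcst_neq0 (w : site) i : Bcst w i != 0.
Proof. by rewrite /Bcst; case: ifP; rewrite ?invr_eq0 q2_neq0. Qed.

Lemma AfunV_box b i :
  (Afun lq ld (color (b : Gsystem mu nu)) (position lq ld (b : Gsystem mu nu)) i)^-1
  = srat (Bcst (site_of b) i) (Blist i b).
Proof. by rewrite position_site /= scol_site AfunV_srat. Qed.

Lemma Aprod_srat (P : pred (Gsystem mu nu)) l i :
  Aprod lq ld P l i = srat (Ac P l i) (Al P l i).
Proof.
rewrite /Aprod -srat_cat; congr (_ * _); apply: srat_prod => b.
  exact: AfunV_box.
by rewrite -[LHS]invrK AfunV_box srat_neg.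
Qed.

Lemma Ac_neq0 P l i : Ac P l i != 0.
Proof.
rewrite /Ac mulf_neq0 // prodf_seq_neq0; apply/allP => b _; apply/implyP => _;
  by rewrite ?invr_eq0 Bcst_neq0.
Qed.

Lemma Pcst_neq0 i : Pcst i != 0.
Proof.
rewrite /Pcst; case: ifP => _; last exact: cexp_neq0.
exact: (mulf_neq0 q3_neq0 (cexp_neq0 _)).
Qed.

Definition phil l i := at_pos (Psites i) ++ Al predT l i.
Definition phic l i := Pcst i * Ac predT l i.

Lemma phi_srat l i :
  phi lq ld (GPsi lq ld mu nu) l i = srat (phic l i) (phil l i).
Proof. by rewrite /phi GPsi_srat (Aprod_srat predT) srat_cat. Qed.

Lemma phic_neq0 l i : phic l i != 0.
Proof. by rewrite mulf_neq0 ?Pcst_neq0 ?Ac_neq0. Qed.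

(** ** Orders of the l-weights *)
Lemma sum_lap (I : Type) (r : seq I) (P : pred I) (F : I -> site -> int) s :
  \sum_(i <- r | P i) lap (F i) s = lap (fun t => \sum_(i <- r | P i) F i t) s.
Proof. by case: s => f [x y]; rewrite /lap /= !sumrB !big_split. Qed.

Lemma ordl_Al P l s : ordl (Al P l (scol s)) (spos s) =
  lap (fun t => \sum_(b <- l.1 | P b) (site_of b == t)%:Z
               - \sum_(b <- l.2 | P b) (site_of b == t)%:Z) s.
Proof.
rewrite /Al ordl_cat !ordl_flatten.
rewrite (eq_bigr (fun b => lap (fun t => (site_of b == t)%:Z) s)) => [|b _]; last first.
  by rewrite ordl_at_pos sord_Bsites.
rewrite [X in _ + X](eq_bigr (fun b => - lap (fun t => (site_of b == t)%:Z) s)) => [|b _]; last first.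
  by rewrite ordl_neg ordl_at_pos sord_Bsites.
by rewrite sumrN !sum_lap; case: s => f [x y]; rewrite /lap; ring.
Qed.

Lemma sum_site (A : {fset Gbox}) t : \sum_(b <- A) (site_of b == t)%:Z
  = (t \in [seq site_of b | b <- A])%:Z.
Proof.
have [/mapP[b bA ->]|tA] := boolP (t \in _).
  rewrite (big_fsetD1 b) //= eqxx big1_fset ?addr0 // => b'.
  by rewrite !inE => /andP[bb _] _; rewrite (inj_eq site_inj) (negPf bb).
rewrite big_seq big1 // => b bA; case: eqP => // e.
by case/negP: tA; rewrite -e map_f.
Qed.

Lemma ext_site l b : ext l (site_of b) = inn l b.
Proof. by case: b => [i k|i k|n]. Qed.

Lemma ext_not_site l l' t : (forall b, site_of b <> t) -> ext l t = ext l' t.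
Proof.
case: t => [[[]|] [x y]] h /=.
- by case: eqP (h (Box3 y)) => [->|].
- case: ltrP => //= x0; case: ltrP => //= y0.
  by case: (h (Box2 `|x| `|y|)); rewrite /= !gez0_abs.
- case: ltrP => //= x0; case: ltrP => //= y0.
  by case: (h (Box1 `|x| `|y|)); rewrite /= !gez0_abs.
Qed.

Lemma sum_ext l t : signed l ->
  \sum_(b <- l.1) (site_of b == t)%:Z - \sum_(b <- l.2) (site_of b == t)%:Z
  = (ext l t)%:Z - (ext vac t)%:Z.
Proof.
move=> [s1 s2]; rewrite !sum_site.
have [[b <-]|h] := pselect (exists b, site_of b = t).
  rewrite !ext_site inn_empty !(mem_map site_inj) /inn.
  have := s1 b; have := s2 b.
  case: (Gpositive b); case: (b \in l.1); case: (b \in l.2) => //= h1 h2;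
    by [have := h1 isT|have := h2 isT].
have nb b : site_of b <> t by move=> e; apply: h; exists b.
rewrite (ext_not_site l vac nb) subrr.
by do 2 (case: mapP => [[b _ e]|_]; first by case: (nb b)).
Qed.

(** [Psi] contributes the difference operator of the reference state and the
    boxes of [l] contribute that of the difference of the two ideals. *)
Lemma ordl_phil l s : signed l ->
  ordl (phil l (scol s)) (spos s) = lap (fun t => (ext l t)%:Z) s.
Proof.
move=> sl; rewrite ordl_cat ordl_at_pos sord_Psites ordl_Al.
case: s => f [x y]; rewrite /lap /= !(sum_ext _ sl).
ring.
Qed.

Lemma cov_succ (P : pred Gbox) b : (forall v, cov b v -> P v) <->
  match b with
  | Box1 i k => P (Box1 i k.+1) && P (Box1 i.+1 k)
  | Box2 i k => P (Box2 i k.+1) && P (Box2 i.+1 k)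
  | Box3 n => P (Box3 (n + 1))
  end.
Proof.
case: b => [i k|i k|n]; split=> [h|].
- by rewrite !h //= !eqxx ?orbT.
- by move=> /andP[h1 h2] [i' k'|//|//] /= /orP[]/andP[/eqP -> /eqP ->].
- by rewrite !h //= !eqxx ?orbT.
- by move=> /andP[h1 h2] [//|i' k'|//] /= /orP[]/andP[/eqP -> /eqP ->].
- by rewrite h /=.
by move=> h [//|//|n'] /= /eqP ->.
Qed.

Lemma cov_pred (P : pred Gbox) b : (forall u, cov u b -> P u) <->
  match b with
  | Box1 i k => ((k == 0%N) || P (Box1 i k.-1)) && ((i == 0%N) || P (Box1 i.-1 k))
  | Box2 i k => ((k == 0%N) || P (Box2 i k.-1)) && ((i == 0%N) || P (Box2 i.-1 k))
  | Box3 n => P (Box3 (n - 1))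
  end.
Proof.
case: b => [i k|i k|n]; split=> [h|].
- by case: k h => [|k] h; case: i h => [|i] h; rewrite /= ?h //= !eqxx ?orbT.
- move=> /andP[h1 h2] [i' k'|//|//] /= /orP[]/andP[/eqP e1 /eqP e2].
    by move: h2; rewrite e1 e2.
  by move: h1; rewrite e1 e2.
- by case: k h => [|k] h; case: i h => [|i] h; rewrite /= ?h //= !eqxx ?orbT.
- move=> /andP[h1 h2] [//|i' k'|//] /= /orP[]/andP[/eqP e1 /eqP e2].
    by move: h2; rewrite e1 e2.
  by move: h1; rewrite e1 e2.
- by rewrite h //= subrK.
by move=> h [//|//|n'] /= /eqP e; rewrite -[n'](addrK 1) -e.
Qed.

Lemma okd_ext l b : Gstates l ->
  let: (f, (x, y)) := site_of b in
  (okd true l b <-> [&& ext l (f, (x, y)), ~~ ext l (f, (x, y + 1))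
                      & (f == Some true) || ~~ ext l (f, (x + 1, y))])
  /\ (okd false l b <-> [&& ~~ ext l (f, (x, y)), ext l (f, (x, y - 1))
                      & (f == Some true) || ext l (f, (x - 1, y))]).
Proof.
move=> Sl; have okT := okdP true b Sl; have okF := okdP false b Sl.
have S1 (n : nat) : n%:Z + 1 = n.+1%:Z by lia.
have B1 (n : nat) : (n%:Z - 1 < 0) = (n == 0%N) by lia.
have A1 (n : nat) (P : nat -> bool) :
    (n == 0%N) || P (absz (n%:Z - 1)%R) = (n == 0%N) || P n.-1.
  by case: n => [|n] //=; congr P; lia.
have sT := cov_succ (fun v => ~~ innd true l v) b.
have sF := cov_pred (fun v => ~~ innd false l v) b.
have hT : okd true l b <-> innd true l b /\ match b with
  | Box1 i k => ~~ innd true l (Box1 i k.+1) && ~~ innd true l (Box1 i.+1 k)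
  | Box2 i k => ~~ innd true l (Box2 i k.+1) && ~~ innd true l (Box2 i.+1 k)
  | Box3 n => ~~ innd true l (Box3 (n + 1)) end.
  by rewrite okT; split=> -[h /sT].
have hF : okd false l b <-> innd false l b /\ match b with
  | Box1 i k => ((k == 0%N) || ~~ innd false l (Box1 i k.-1))
                && ((i == 0%N) || ~~ innd false l (Box1 i.-1 k))
  | Box2 i k => ((k == 0%N) || ~~ innd false l (Box2 i k.-1))
                && ((i == 0%N) || ~~ innd false l (Box2 i.-1 k))
  | Box3 n => ~~ innd false l (Box3 (n - 1)) end.
  by rewrite okF; split=> -[h /sF].
case: b hT hF {okT okF sT sF} => [i k|i k|n] hT hF; split;
  first [apply: (iff_trans hT)|apply: (iff_trans hF)];
  rewrite /innd ?eqb_id ?eqbF_neg ?negbK /= ?S1 ?B1 ?andbT;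
  rewrite ?(A1 _ (fun m => inn l (Box1 m _))) ?(A1 _ (fun m => inn l (Box1 _ m)));
  rewrite ?(A1 _ (fun m => inn l (Box2 m _))) ?(A1 _ (fun m => inn l (Box2 _ m)));
  rewrite ?addn1; exact: (rwP andP).
Qed.

Lemma corner_plane (c u r p n m t : bool) :
  c ==> m -> c ==> n -> n ==> p -> m ==> p -> u ==> c -> r ==> c -> t ==> u -> t ==> r ->
  let D : int := u%:Z + r%:Z + p%:Z - n%:Z - m%:Z - t%:Z in
  -1 <= D /\ (D == -1) = [&& c, ~~ u & ~~ r] || [&& ~~ c, n & m].
Proof. by case: c u r p n m t => [] [] [] [] [] [] []. Qed.

Lemma corner_line (c u n e0 e1 e2 : bool) : u ==> c -> c ==> n ->
  ~~ (e1 && e0) -> ~~ (e1 && e2) -> ~~ (e0 && e2) ->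
  let D : int := (e1 && u)%:Z + (e0 && c)%:Z + (e2 && n)%:Z
               - (e1 && n)%:Z - (e2 && c)%:Z - (e0 && u)%:Z in
  -1 <= D /\ (D == -1)
    = [&& e1 && c, ~~ (e1 && u) & true] || [&& ~~ (e1 && c), e1 && n & true].
Proof. by case: c u n e0 e1 e2 => [] [] [] [] [] []. Qed.

Lemma ext_outside l f x y : f != Some true -> (x < 0) || (y < 0) -> ext l (f, (x, y)).
Proof. by case: f => [[]|] //= _ /orP[] ->; rewrite ?orbT. Qed.

Lemma ext_closed l f x y : closed_under_cov l -> f != Some true ->
  ext l (f, (x, y)) ==> ext l (f, (x - 1, y)) /\ ext l (f, (x, y)) ==> ext l (f, (x, y - 1)).
Proof.
move=> cl nf; split; apply/implyP.
  have [y0|y0] := ltP y 0; first by move=> _; apply: ext_outside; rewrite // y0 orbT.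
  have [x0|x0] := ltP (x - 1) 0; first by move=> _; apply: ext_outside; rewrite // x0.
  case: f nf => [[]|] //= _ /or3P[|| h]; do 1?lia; apply/or3P; apply: Or33.
    by apply: (closed_Box2 cl _ _ h); lia.
  by apply: (closed_Box1 cl _ _ h); lia.
have [x0|x0] := ltP x 0; first by move=> _; apply: ext_outside; rewrite // x0.
have [y0|y0] := ltP (y - 1) 0; first by move=> _; apply: ext_outside; rewrite // y0 orbT.
case: f nf => [[]|] //= _ /or3P[|| h]; do 1?lia; apply/or3P; apply: Or33.
  by apply: (closed_Box2 cl _ _ h); lia.
by apply: (closed_Box1 cl _ _ h); lia.
Qed.

Lemma not_site_outside f x y : f != Some true ->
  (forall b, (f, (x, y)) <> site_of b) -> (x < 0) || (y < 0).
Proof.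
move=> nf nb; have [x0|x0] := ltP x 0 => //=; have [y0|y0] := ltP y 0 => //=.
by case: f nf nb => [[]|] // _ nb; [case: (nb (Box2 `|x| `|y|))|case: (nb (Box1 `|x| `|y|))];
  rewrite /= !gez0_abs.
Qed.

(** Inside a plane ideal the site below and the site to the left are filled,
    so the order at [(x, y)] is [I(x, y+1) + I(x+1, y) - I(x+1, y+1) - 1]; it is
    [-1] only when nothing follows, and otherwise nonnegative, since
    [I(x+1, y+1)] is at most each of the other two.  Outside the ideal it is
    [I(x-1, y-1) - I(x, y-1) - I(x-1, y)], and [-1] only when both predecessors
    are filled.  On the line of the third family only the two boxes next to
    the end have order [-1]; beside the line the orders are nonnegative. *)
Lemma lap_corner l s : Gstates l ->
  let D := lap (fun t => (ext l t)%:Z) s in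
  -1 <= D /\ (D == -1 <-> exists2 b, s = site_of b & okd true l b \/ okd false l b).
Proof.
move=> Sl D; have cl := Gstates_closed Sl.
have oE b : s = site_of b -> let: (f, (x, y)) := s in
  ([&& ext l s, ~~ ext l (f, (x, y + 1)) & (f == Some true) || ~~ ext l (f, (x + 1, y))]
  || [&& ~~ ext l s, ext l (f, (x, y - 1)) & (f == Some true) || ext l (f, (x - 1, y))])
   <-> okd true l b \/ okd false l b.
  move=> sb; have := okd_ext b Sl; rewrite -sb; case: s {D} sb => f [x y] sb [h1 h2].
  by split=> [/orP[/h1|/h2]|[/h1 ->|/h2 ->]]; rewrite ?orbT; [left|right| |].
pose cond : bool := let: (f, (x, y)) := s in
  [&& ext l s, ~~ ext l (f, (x, y + 1)) & (f == Some true) || ~~ ext l (f, (x + 1, y))]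
  || [&& ~~ ext l s, ext l (f, (x, y - 1)) & (f == Some true) || ext l (f, (x - 1, y))].
have {}oE b : s = site_of b -> cond <-> okd true l b \/ okd false l b.
  by move=> /oE; rewrite /cond; case: (s) => f [x y].
suff [h1 h2 h3] : [/\ -1 <= D, (D == -1) = cond
    & (forall b, s <> site_of b) -> cond = false].
  split=> //; split=> [D1|[b sb] /(oE b sb)]; last by rewrite h2.
  have [[b sb]|nb] := pselect (exists b, s = site_of b).
    by exists b => //; apply/(oE b sb); rewrite -h2.
  by move: D1; rewrite h2 h3 // => b sb; apply: nb; exists b.
rewrite /D /cond {oE D cond}; case: s => f [x y].
have [->|nf] := eqVneq f (Some true).
  have c (n m : int) : m <= n -> inn l (Box3 n) ==> inn l (Box3 m).
    by move=> mn; apply/implyP; apply: closed_Box3.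
  have e0 : (x + 1 == 1) = (x == 0) by lia.
  have e2 : (x - 1 == 1) = (x == 2) by lia.
  have [|||||h1 h2] := @corner_line (inn l (Box3 y)) (inn l (Box3 (y + 1)))
    (inn l (Box3 (y - 1))) (x == 0) (x == 1) (x == 2); rewrite ?c //; do 1?lia.
  rewrite /lap /= e0 e2; split=> // nb.
  by case: eqP (nb (Box3 y)) => [->|].
have cx (a c : int) := (ext_closed a c cl nf).1.
have cy (a c : int) := (ext_closed a c cl nf).2.
have xK (a b : int) : a + b - b = a by rewrite addrK.
have [||||||||h1 h2] := @corner_plane (ext l (f, (x, y)))
    (ext l (f, (x, y + 1))) (ext l (f, (x + 1, y)))
    (ext l (f, (x - 1, y - 1))) (ext l (f, (x, y - 1)))
    (ext l (f, (x - 1, y))) (ext l (f, (x + 1, y + 1))) => //.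
- by have := cy x (y + 1); rewrite addrK.
- by have := cx (x + 1) y; rewrite addrK.
- by have := cx (x + 1) (y + 1); rewrite addrK.
- by have := cy (x + 1) (y + 1); rewrite addrK.
rewrite /lap !orFb; split=> // /(not_site_outside nf) out.
rewrite (ext_outside l nf out) andFb orbF andTb; apply/negP => /andP[/negP h3 /negP h4].
case/orP: out => out; [apply: h3|apply: h4]; apply: ext_outside => //.
  by rewrite out.
by rewrite out orbT.
Qed.

Lemma ordl_corner l s : Gstates l ->
  let D := ordl (phil l (scol s)) (spos s) in
  -1 <= D /\ (D == -1 <-> exists2 b, s = site_of b & okd true l b \/ okd false l b).
Proof.
move=> Sl D; rewrite /D ordl_phil; last exact: Gstates_signed.
exact: lap_corner.
Qed.

(** ** Expansions of the l-weights *)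
Lemma scol_Bsites (w : site) i x : x \in Bsites w i -> scol x.1 = i.
Proof.
case: w => f [a b]; rewrite /Bsites; case: eqP => [-> |/eqP/Z2_neq e].
  by rewrite !inE => /orP[]/eqP -> /=.
have {}e : i = scol (f, (a, b)) + 1 by rewrite e Z2_addr11.
by rewrite !inE => /or4P[]/eqP -> /=; rewrite ?scolB1 ?scolD1 e.
Qed.

Lemma scol_Psites i x : x \in Psites i -> scol x.1 = i.
Proof.
rewrite /Psites; case: eqP => [->|/eqP/Z2_neq e].
  by rewrite !inE => /or4P[]/eqP -> /=; apply/val_inj.
have {}e : i = 1 by rewrite -(Z2_addr11 i) -e add0r.
by rewrite e !inE => /or4P[]/eqP -> /=; apply/val_inj.
Qed.

Lemma phil_site l i a : a \in [seq x.1 | x <- phil l i] ->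
  exists2 s, a = spos s & scol s = i.
Proof.
have hB (c : C) b : c \in [seq x.1 | x <- Blist i b] -> exists2 s, c = spos s & scol s = i.
  move=> /mapP[_ /mapP[x xB ->] ->] /=; exists x.1 => //.
  exact: scol_Bsites xB.
rewrite !map_cat !mem_cat => /or3P[].
- move=> /mapP[_ /mapP[x xB ->] ->] /=; exists x.1 => //.
  exact: scol_Psites xB.
- by move=> /mapP[x /flatten_mapP[b _ xb] ->]; apply: (hB _ b); apply: map_f.
move=> /mapP[x /flatten_mapP[b _ /mapP[y yb ->]] ->] /=.
by apply: (hB _ b); apply: map_f.
Qed.

Lemma degl_phil l i : degl (phil l i) = 0.
Proof.
have hB b : degl (Blist i b) = 0.
  rewrite /degl big_map; case: (site_of b) => f [x y]; rewrite /Bsites.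
  by case: ifP => _; rewrite !big_cons big_nil.
rewrite /phil /Al !degl_cat !degl_flatten.
rewrite [X in _ + (X + _)]big1 => [|b _]; last exact: hB.
rewrite [X in _ + (_ + X)]big1 => [|b _]; last by rewrite degl_neg hB.
rewrite !addr0 /degl big_map /Psites.
by case: ifP => _; rewrite !big_cons big_nil.
Qed.

Lemma ordl_phil0 l i : ordl (phil l i) 0 = 0.
Proof.
apply: ordl_notin; apply/negP => /phil_site[s /esym/eqP].
by rewrite (negPf (spos_neq0 s)).
Qed.

Lemma at_pos_lead0 L :
  leadl (at_pos L) 0 = \prod_(x <- L) (- spos x.1) ^ x.2.
Proof.
rewrite /leadl big_map big_mkcond; apply: eq_bigr => x _ /=.
by rewrite spos_neq0 sub0r.
Qed.

(** A function with constant [c] and divisor [l] of degree zero has value [c]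
    at infinity and [c * leadl l 0] at zero. *)
Lemma Blist_balanced i b :
  Bcst (site_of b) i ^+ 2 * leadl (Blist i b) 0 = 1.
Proof.
rewrite at_pos_lead0 /Bcst /Bsites; case: (site_of b) => f [x y].
have zE s : spos s != 0 by apply: spos_neq0.
have yE (u : int) : spos (f, (u, y - 1)) = q2 ^+ 2 * spos (f, (u, y + 1)).
  by rewrite expr2 -mulrA !q2_spos addrK.
have xE : spos (f, (x - 1, y)) = q1 ^+ 2 * spos (f, (x + 1, y)).
  by rewrite expr2 -mulrA !q1_spos addrK.
have dE : spos (f, (x + 1, y + 1)) = q3 ^+ 2 * spos (f, (x - 1, y - 1)).
  by rewrite expr2 -mulrA !q3_spos !subrK.
case: ifP => _; rewrite !big_cons big_nil /= !expr1z !exprN1 mulr1.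
  rewrite yE; move: (q2_neq0) (zE (f, (x, y + 1))).
  by move: (Defs.q2 lq) (spos _) => r t r0 t0; field; rewrite r0 t0.
rewrite xE dE; have := q1q3; move: (q1_neq0) (q3_neq0) (q2_neq0).
move: (zE (f, (x + 1, y))) (zE (f, (x - 1, y - 1))) => t0 u0.
move: (Defs.q1 lq ld) (Defs.q3 lq ld) (Defs.q2 lq) (spos _) (spos _) t0 u0.
move=> r1 r3 r2 t u t0 u0 h1 h3 h2 e.
transitivity ((r2 * (r1 * r3)) ^+ 2); first by field; rewrite t0 u0.
by rewrite e divff // expr1n.
Qed.

Lemma Psites_balanced i : Pcst i ^+ 2 * leadl (at_pos (Psites i)) 0 = 1.
Proof.
rewrite at_pos_lead0 /Pcst /Psites.
have qpowE a : qpow lq a ^+ 2 = q2pow a.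
  by rewrite expr2 /qpow -cexpD /Defs.q2pow; congr cexp; ring.
pose g a m n := q2pow a * mono q1 q2 m n.
have gD a m n a' m' n' : g a m n * g a' m' n' = g (a + a') (m + m') (n + n').
  by rewrite /g mulrACA -q2powD mD.
have gV a m n : (g a m n)^-1 = g (- a) (- m) (- n) by rewrite /g invfM -q2powN mV.
have g0 a m n : a = 0 -> m = 0 -> n = 0 -> g a m n = 1.
  by move=> -> -> ->; rewrite /g (q2pow_int 0) mD addr0 mono00.
have sg s : spos s = g (shift s.1) (offx s.1 - s.2.1) (offy s.1 - s.2.2) by [].
have q3g : q3 = g 0 (-1) (-1) by rewrite /g q3E (q2pow_int 0) mD !add0r.
have qg a : qpow lq a ^+ 2 = g a 0 0 by rewrite qpowE /g mono00 mulr1.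
move: g gD gV g0 sg q3g qg => g gD gV g0 sg q3g qg.
case: ifP => _; rewrite !big_cons big_nil /= !expr1z !exprN1 !invrN mulr1;
  rewrite !(mulNr, mulrN, opprK) ?q3g ?exprMn qg ?expr2 !sg !gV !gD;
  apply: g0; rewrite /=; do 1?lia; ring.
Qed.

Lemma leadl_phil0 l i : phic l i ^+ 2 * leadl (phil l i) 0 = 1.
Proof.
have hB (P : pred Gbox) (A : {fset Gbox}) :
    (\prod_(b <- A | P b) Bcst (site_of b) i) ^+ 2
    * \prod_(b <- A | P b) leadl (Blist i b) 0 = 1.
  rewrite -prodrXl -big_split big1 //= => b _; exact: Blist_balanced.
rewrite /phic /phil /Al /Ac !leadl_cat !leadl_flatten.
under [X in _ * (_ * (_ * X))]eq_bigr do rewrite leadl_neg.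
rewrite !prodfV; move: (hB predT l.1) (hB predT l.2) (Psites_balanced i).
move: (Pcst i) (leadl _ _) (\prod_(_ <- _ | _) _) (\prod_(_ <- _ | _) _).
move: (\prod_(_ <- _ | _) _) (\prod_(_ <- _ | _) _) => u v w t x y h1 h2 h3.
have nz (a c : C) : a ^+ 2 * c = 1 -> (a != 0) && (c != 0).
  move=> e; rewrite -negb_or; apply/negP => /orP[]/eqP c0; move: e;
    by rewrite c0 ?expr0n ?mul0r ?mulr0 => /eqP; rewrite eq_sym oner_eq0.
have /andP[v0 u0] := nz _ _ h2.
transitivity ((w ^+ 2 * t) * (y ^+ 2 * x) / (v ^+ 2 * u)).
  by field; rewrite u0 v0.
by rewrite h1 h2 h3 mulr1 divr1.
Qed.

Definition corner l b : bool := `[< okd true l b \/ okd false l b >].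

(** The form [phi_l dz / z] has this residue at a corner, where [phi_l] has a
    simple pole; defined at all boxes as a leading coefficient. *)
Definition res_phi l i b : C := phic l i * leadl (phil l i) (pos b) / pos b.

(** The corners are the only poles and they are simple, the degree is zero and
    there is neither a zero nor a pole at the origin, so partial fractions apply.
    [X] is any finite set containing the corners, to be chosen uniformly in
    sums over several states. *)
Lemma phi_expansion l i (X : {fset Gbox}) : Gstates l ->
  (forall b, corner l b -> b \in X) ->
  exists cp cm : int -> C,
  [/\ expansion true (phi lq ld (GPsi lq ld mu nu) l i) cp,
      expansion false (phi lq ld (GPsi lq ld mu nu) l i) cm,
      cp 0 = phic l i, cp 0 * cm 0 = 1
    & forall k, cp k - cm k =
        \sum_(b <- X) (if corner l b && (Gcolor b == i) then res_phi l i b else 0) * pos b ^ k]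
  /\ exists a c, [/\ is_value (phi lq ld (GPsi lq ld mu nu) l i) 0 a,
       is_value_at_infinity (phi lq ld (GPsi lq ld mu nu) l i) c & a * c = 1].
Proof.
move=> Sl XP; rewrite phi_srat.
pose Y := [seq b <- X | corner l b && (Gcolor b == i)].
pose P := [seq pos b | b <- Y].
have pinj : injective (fun b => pos b) by move=> b b' /spos_inj/site_inj.
have uP : uniq P by rewrite map_inj_uniq ?filter_uniq // fset_uniq.
have inP a : (a \in P) = (ordl (phil l i) a == -1).
  apply/mapP/idP => [[b]|/eqP oa].
    rewrite mem_filter => /andP[/andP[/asboolP cb /eqP cbi] _] ->.
    by rewrite -cbi scol_site; apply/(ordl_corner _ Sl).2; exists b.
  have al : a \in [seq x.1 | x <- phil l i].
    by apply/negPn/negP => /ordl_notin; rewrite oa.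
  have [s sa si] := phil_site al; move: oa; rewrite sa -si => /eqP.
  move=> /(ordl_corner _ Sl).2[b sb /asboolP cb]; exists b; last by rewrite sb.
  by rewrite mem_filter scol_site -sb si eqxx /corner cb XP.
have ord a : -1 <= ordl (phil l i) a.
  have [/phil_site[s -> <-]|/ordl_notin ->//] := boolP (a \in [seq x.1 | x <- phil l i]).
  exact: (ordl_corner _ Sl).1.
have [cp [cm [[ep em cp0 cm0 dE] inf]]] := simple_poles (phic_neq0 l i)
  (degl_phil l i) ord uP inP (ordl_phil0 l i).
have bal := leadl_phil0 l i.
exists cp, cm; split; last first.
  exists (phic l i * leadl (phil l i) 0), (phic l i); split=> //.
    by apply: is_value_lead; rewrite -[X in has_lead _ _ X _](ordl_phil0 l i);
      apply: has_lead_srat (phic_neq0 l i).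
  by rewrite -bal expr2; ring.
split=> //.
  by rewrite cp0 cm0 -bal expr2; ring.
move=> k; rewrite dE /P big_map /Y big_filter big_mkcond; apply: eq_bigr => b _.
by case: ifP; rewrite ?mul0r.
Qed.

(** ** Finiteness *)
(** Finite sets of boxes that exhaust all boxes, so that the corners of a state
    and of its neighbours lie in one of them ([okd_bsize]) *)
Definition Wbox (N : nat) : {fset Gbox} := seq_fset tt
  ([seq Box1 i k | i <- iota 0 N, k <- iota 0 N] ++ [seq Box2 i k | i <- iota 0 N, k <- iota 0 N]
   ++ [seq Box3 n%:Z | n <- iota 0 N] ++ [seq Box3 (- n%:Z) | n <- iota 0 N]).

Lemma mem_Wbox N b : (bsize b < N)%N -> b \in Wbox N.
Proof.
rewrite seq_fsetE !mem_cat; case: b => [i k|i k|n] /= h.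
- by apply/orP; left; apply/allpairsP; exists (i, k); rewrite !mem_iota; split=> //=; lia.
- apply/orP; right; apply/orP; left; apply/allpairsP; exists (i, k).
  by rewrite !mem_iota; split=> //=; lia.
apply/orP; right; apply/orP; right; have [n0|n0] := leP 0 n.
  by apply/orP; left; apply/mapP; exists `|n|%N; rewrite ?mem_iota /= ?gez0_abs.
apply/orP; right; apply/mapP; exists `|n|%N; rewrite ?mem_iota //.
by congr Box3; lia.
Qed.

Arguments Wbox : simpl never.

Lemma within_leq N M l : (N <= M)%N -> within N l -> within M l.
Proof. by move=> NM [h1 h2]; split=> b /[dup] => [/h1|/h2]; lia. Qed.

Lemma okd_bsize d N l b : Gstates l -> within N l -> okd d l b -> (bsize b < N.+2)%N.
Proof.
move=> Sl [h1 h2] /(okdP _ _ Sl)[]; rewrite /innd; case: d => /eqP bl h.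
  move: bl; rewrite /inn; case: ifP => Pb bl; first by have := h1 _ bl; lia.
  have := (cov_succ (fun v => ~~ innd true l v) b).1 h.
  case: b Pb {h bl} => //= n n0; rewrite /innd eqb_id /inn /=.
  by case: ifP => [|_ /negPn/h2 /=]; lia.
move: bl; rewrite /inn; case: ifP => Pb bl; last by have := h2 _ (negbFE bl); lia.
have := (cov_pred (fun v => ~~ innd false l v) b).1 h.
case: b Pb {h bl} => [i k|i k|n] //= n0; rewrite /innd !eqbF_neg !negbK /inn /=.
- move=> /andP[/orP[/eqP k0|/h1 /= ?] /orP[/eqP i0|/h1 /= ?]]; lia.
- move=> /andP[/orP[/eqP k0|/h1 /= ?] /orP[/eqP i0|/h1 /= ?]]; lia.
by case: ifP => [_ /h1 /=|]; lia.
Qed.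

Lemma within_tog d N l b : within N l -> (bsize b < N)%N -> within N (tog d l b).
Proof.
move=> [h1 h2] bN; rewrite /tog /remove_box /add_box /=.
by case: d; case: (Gpositive b); split=> //= b'; rewrite !inE;
  try (by case/orP=> [/eqP ->|]; auto); case/andP; auto.
Qed.

(** ** Matrix coefficients *)
Local Notation Psi := (GPsi lq ld mu nu).

Lemma big_lt_gt (T : Type) (idx : T) (op : Monoid.com_law idx) (A : {fset Gbox}) b
    (F : Gbox -> T) :
  \big[op/idx]_(w <- A) F w = op (op (\big[op/idx]_(w <- A | glt w b) F w)
    (\big[op/idx]_(w <- A | glt b w) F w)) (if b \in A then F b else idx).
Proof.
rewrite (bigID (fun w => glt w b)) /= -Monoid.mulmA; congr (op _ _).
rewrite (bigID (fun w => glt b w)) /=; congr (op _ _).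
  by apply: eq_bigl => w; case h : (glt b w); rewrite ?andbF // (glt_asym h).
have e w : ~~ glt w b && ~~ glt b w = (w == b).
  by case: eqVneq => [->|/glt_total]; [rewrite glt_irr|case: glt; case: glt].
rewrite (eq_bigl _ _ e) -big_filter; case: ifP => bA.
  rewrite (_ : [seq w <- A | w == b] = [:: b]) ?big_seq1 //.
  by have := @filter_pred1_uniq _ A b (fset_uniq A) bA.
by rewrite big1_seq // => w; rewrite mem_filter => /andP[_ /andP[/eqP -> ]]; rewrite bA.
Qed.

(** As a leading coefficient of [A_w^-1] at the position of [v] it is nonzero
    also when [A_w^-1] has a zero or a pole there. *)
Definition kap w v : C := Bcst (site_of w) (Gcolor v) * leadl (Blist (Gcolor v) w) (pos v).

Lemma kap_neq0 w v : kap w v != 0.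
Proof. exact: (mulf_neq0 (Bcst_neq0 _ _) (leadl_neq0 _ _)). Qed.

Definition kapprod (P : pred Gbox) l b : C :=
  \prod_(w <- l.1 | P w) kap w b * \prod_(w <- l.2 | P w) (kap w b)^-1.

Lemma kapprod_neq0 P l b : kapprod P l b != 0.
Proof.
by apply: mulf_neq0; rewrite prodf_seq_neq0; apply/allP => w _; apply/implyP => _;
  rewrite ?invr_eq0 kap_neq0.
Qed.

Lemma lead_A (P : pred Gbox) l b :
  Ac P l (Gcolor b) * leadl (Al P l (Gcolor b)) (pos b) = kapprod P l b.
Proof.
rewrite /Ac /Al leadl_cat !leadl_flatten mulrACA -!big_split /=; congr (_ * _).
by apply: eq_bigr => w _; rewrite leadl_neg -invfM.
Qed.

Definition ordA (P : pred Gbox) l b : int := ordl (Al P l (Gcolor b)) (pos b).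

Lemma has_lead_Aprod (P : pred (Gsystem mu nu)) l b :
  has_lead (Aprod lq ld P l (Gcolor b)) (pos b) (ordA P l b) (kapprod P l b).
Proof.
by rewrite Aprod_srat -lead_A; apply: has_lead_srat; apply: Ac_neq0.
Qed.

Definition ordPsi b : int := ordl (at_pos (Psites (Gcolor b))) (pos b).
Definition leadPsi b : C := Pcst (Gcolor b) * leadl (at_pos (Psites (Gcolor b))) (pos b).

Lemma leadPsi_neq0 b : leadPsi b != 0.
Proof. exact: (mulf_neq0 (Pcst_neq0 _) (leadl_neq0 _ _)). Qed.

Lemma has_lead_Psi b : has_lead (Psi (Gcolor b)) (pos b) (ordPsi b) (leadPsi b).
Proof. by rewrite GPsi_srat; apply: has_lead_srat; apply: Pcst_neq0. Qed.

Definition below b : bool := psi_below lq ld Psi (b : Gsystem mu nu).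

Definition ord_lt l b : int := (if below b then ordPsi b else 0) + ordA (glt^~ b) l b.
Definition ord_gt l b : int := (if below b then 0 else ordPsi b) + ordA (glt b) l b.
Definition lead_lt l b : C := (if below b then leadPsi b else 1) * kapprod (glt^~ b) l b.
Definition lead_gt l b : C := (if below b then 1 else leadPsi b) * kapprod (glt b) l b.

Lemma has_lead_lt l b : has_lead (phi_lt lq ld Psi l (b : Gsystem mu nu) (Gcolor b))
  (pos b) (ord_lt l b) (lead_lt l b).
Proof.
apply: has_leadM.
  rewrite -/(below b); case: (below b); [exact: has_lead_Psi|exact: has_lead1].
have -> : (fun b1 : Gsystem mu nu => box_lt b1 b) = glt^~ b.
  by apply: funext => w; rewrite /= GltE.
exact: has_lead_Aprod.
Qed.

Lemma has_lead_gt l b : has_lead (phi_gt lq ld Psi l (b : Gsystem mu nu) (Gcolor b))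
  (pos b) (ord_gt l b) (lead_gt l b).
Proof.
apply: has_leadM.
  rewrite -/(below b); case: (below b); [exact: has_lead1|exact: has_lead_Psi].
have -> : box_lt (b : Gsystem mu nu) = glt b.
  by apply: funext => w; rewrite /= GltE.
exact: has_lead_Aprod.
Qed.

Lemma ordA_self w : ordl (Blist (Gcolor w) w) (pos w) = 0.
Proof.
rewrite scol_site ordl_at_pos sord_Bsites; case: (site_of w) => f [x y].
have eqE (f1 g1 : option bool) (a b a' b' : int) :
    ((f1, (a, b)) == (g1, (a', b')) :> site) = (f1 == g1) && ((a == a') && (b == b')).
  by [].
have x1 (z : int) : (z == z + 1) = false by lia.
have x2 (z : int) : (z == z - 1) = false by lia.
by rewrite /lap !eqE !x1 !x2 !eqxx.
Qed.

Lemma ord_lt_gt l b : ordl (phil l (Gcolor b)) (pos b) = ord_lt l b + ord_gt l b.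
Proof.
rewrite /phil ordl_cat /ord_lt /ord_gt /ordA /Al !ordl_cat !ordl_flatten.
rewrite (big_lt_gt _ l.1 b) (big_lt_gt _ l.2 b) /= ordl_neg ordA_self oppr0 !if_same !addr0.
by rewrite -/(ordPsi b); case: (below b); ring.
Qed.

Lemma q2_neq1 : q2 != 1.
Proof. by apply/eqP => e; have [] := @monomial_eq1 0 1; rewrite // mono01. Qed.

Lemma leadl_at_pos L s : (forall x, x \in L -> x.1 != s) ->
  leadl (at_pos L) (spos s) = \prod_(x <- L) (spos s - spos x.1) ^ x.2.
Proof.
move=> h; rewrite /leadl big_map [LHS]big_seq_cond [RHS]big_seq_cond; apply: eq_bigl => x /=.
by case: (boolP (x \in L)) => //= /h; rewrite (inj_eq spos_inj).
Qed.

Lemma site_eqE (f g : option bool) (a c a' c' : int) :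
  ((f, (a, c)) == (g, (a', c')) :> site) = (f == g) && ((a == a') && (c == c')).
Proof. by []. Qed.

(** In its own color [A_b^-1] is [(z - q2 p) / (q2 z - p)] with [p] the position
    of [b], and numerator and denominator are opposite at [z = p]. *)
Lemma kap_self b : kap b b = -1.
Proof.
rewrite /kap scol_site /Bcst /Blist /Bsites eqxx.
case: (site_of b) => f [x y]; rewrite leadl_at_pos => [|z]; last first.
  by rewrite !inE => /orP[]/eqP ->; rewrite site_eqE !eqxx /=; lia.
rewrite !big_cons big_nil mulr1 /= expr1z exprN1 -q2_spos -q2V_spos.
move: q2_neq1 q2_neq0 (spos_neq0 (f, (x, y))); move: (Defs.q2 lq) (spos _) => r t r1 r0 t0.
have r2 : t * r - t != 0 by rewrite -[X in _ - X]mulr1 -mulrBr mulf_neq0 // subr_eq0.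
by field; rewrite r0 r2.
Qed.

(** This is [g_{c(u),c(v)}(p(u), p(v))]. *)
Definition gg u v : C :=
  if Gcolor u == Gcolor v then pos u - q2 * pos v
  else (pos u - q1 * pos v) * (pos u - q3 * pos v).

Lemma color_S (m n : nat) : (m.+1%:R : 'Z_2) = n.+1%:R -> n <> m.+1 /\ m <> n.+1.
Proof.
move=> e; split=> k; move: e; rewrite k (colorS _.+1) => /eqP;
  by rewrite ?(eq_sym _.+1%:R) (negPf (Z2_addr1 _)).
Qed.

Lemma color_nS (m n : nat) : (m.+1%:R : 'Z_2) <> n.+1%:R -> n <> m.
Proof. by move=> + e; rewrite e. Qed.

(** The factors of [g] vanish when [u] is one step behind [v] in [y] or in [x],
    by the effect of [q2] and [q1] on positions, or one step ahead of [v] on the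
    diagonal, by the effect of [q3]; the colors agree only for the step in [y]. *)
Lemma gg_eq0 u v : (gg u v == 0) = cov u v || dia v u.
Proof.
rewrite /gg; case ev : (site_of v) => [f [x y]]; rewrite q1_spos q2_spos q3_spos.
case: ifP => c; rewrite ?mulf_eq0 !subr_eq0 !(inj_eq spos_inj);
  case: u v ev c => [i k|i k|n] [i' k'|i' k'|n'] [<- <- <-] //= c; rewrite !site_eqE //=.
- have := color_S (eqP c); lia.
- have := color_S (eqP c); lia.
- lia.
- have := color_nS (elimF eqP c); lia.
- have := color_nS (elimF eqP c); lia.
Qed.

(** The numerator of [A_w^-1] at the position of [v] is [g] in one order of its
    arguments and its denominator is [g] in the other order, up to a constant
    that is a sign because [q1 q2 q3 = 1]. *)
Lemma kap_gg w v : gg w v != 0 -> gg v w != 0 ->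
  kap w v = - (-1) ^+ (Gcolor w + Gcolor v)%N * gg v w / gg w v.
Proof.
have inv (r a c : C) : r != 0 -> c - r * a != 0 -> r^-1 * c != a.
  by move=> r0; rewrite subr_eq0; apply: contraNneq => <-; rewrite mulVKf.
have ne (s t : site) : spos s != spos t -> s != t by apply: contraNneq => ->.
rewrite /gg /kap /Blist /Bcst /Bsites (eq_sym (Gcolor v)).
case ew : (site_of w) => [f [x y]].
have cw : scol (f, (x, y)) = Gcolor w by rewrite scol_site ew.
rewrite cw (eq_sym (Gcolor v)).
have z0 : spos (f, (x, y)) != 0 := spos_neq0 _.
have [cwv|cwv] := eqVneq (Gcolor w) (Gcolor v).
  move=> h1 h2.
  rewrite leadl_at_pos => [|z]; last first.
    rewrite !inE => /orP[]/eqP -> /=; apply: ne.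
      by rewrite -q2_spos eq_sym -subr_eq0.
    by rewrite -q2V_spos; apply: inv q2_neq0 _.
  rewrite !big_cons big_nil mulr1 /= expr1z exprN1 -q2_spos -q2V_spos cwv addnn -mul2n exprM sqrrN expr1n.
  rewrite expr1n; move: h1 h2 z0 q2_neq0; move: (Defs.q2 lq) (pos v) (spos _) => r t z h1 h2 z0 r0.
  have h3 : t * r - z != 0 by rewrite mulrC -opprB oppr_eq0.
  by field; rewrite r0 h1 h3.
have -> : (-1) ^+ (Gcolor w + Gcolor v)%N = -1 :> C.
  by case: (Gcolor w) (Gcolor v) cwv => [[|[|//]] ?] [[|[|//]] ?] cwv //=;
    rewrite ?expr1 //; case/eqP: cwv; apply/val_inj.
move=> h1 h2; rewrite !mulf_eq0 !negb_or in h1 h2.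
case/andP: h1 => h11 h13; case/andP: h2 => h21 h23.
rewrite leadl_at_pos => [|z]; last first.
  rewrite !inE => /or4P[]/eqP -> /=; apply: ne.
  - by rewrite -q1_spos eq_sym -subr_eq0.
  - by rewrite -q3_spos eq_sym -subr_eq0.
  - by rewrite -q1V_spos; apply: inv q1_neq0 _.
  - by rewrite -q3V_spos; apply: inv q3_neq0 _.
rewrite !big_cons big_nil mulr1 /= !expr1z !exprN1.
rewrite -q1_spos -q3_spos -q1V_spos -q3V_spos.
have -> : q2 = (q1 * q3)^-1 by rewrite q1q3 invrK.
move: h11 h13 h21 h23 z0 q1_neq0 q3_neq0.
move: (Defs.q1 lq ld) (Defs.q3 lq ld) (pos v) (spos _) => r s t z h11 h13 h21 h23 z0 r0 s0.
have h3 : t * r - z != 0 by rewrite mulrC -opprB oppr_eq0.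
have h4 : t * s - z != 0 by rewrite mulrC -opprB oppr_eq0.
by field; rewrite r0 s0 h11 h13 h3 h4.
Qed.

Lemma below_positive b : Gpositive b -> below b.
Proof. by move=> h; rewrite /below /psi_below /= h. Qed.

Lemma ordPsi_neg (n : int) : n < 0 -> ordPsi (Box3 n) = - (n == -1)%:Z.
Proof.
move=> n0; rewrite /ordPsi ordl_at_pos sordE /Psites /= !big_cons big_nil /= !site_eqE !eqxx /=.
by lia.
Qed.

Definition is_corner l b : Prop := okd true l b \/ okd false l b.

Lemma corner_pred l b v : Gstates l -> is_corner l b -> cov v b -> inn l v.
Proof.
move=> Sl [/(okdP _ _ Sl)[h _]|/(okdP _ _ Sl)[_ h]] c.
  by have := innd_closed Sl (d := true) c h; rewrite /innd eqb_id.
by have := h _ c; rewrite /innd; case: (inn l v).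
Qed.

(** The order of the boxes extends the partial order, so the boxes before a
    positive box [b] form a state again, in which [b] can be added if it is a
    corner.  This reduces the order of the part of the l-weight before [b] to
    [ordl_corner]. *)
Definition truncate l b : state (Gsystem mu nu) :=
  ([fset w in l.1 | glt w b]%fset, [fset w in l.2 | glt w b]%fset).

Lemma inn_truncate l b v : inn (truncate l b) v =
  if Gpositive v then (v \in l.1) && glt v b else ~~ ((v \in l.2) && glt v b).
Proof. by rewrite /inn /truncate /= !inE /=. Qed.

Lemma truncate_state l b : Gstates l -> Gpositive b -> Gstates (truncate l b).
Proof.
move=> Sl pb; apply/GstatesP; split.
  have [h1 h2] := Gstates_signed Sl.
  by split=> v; rewrite !inE /= => /andP[h _]; [exact: h1 | exact: h2].
move=> u v cuv; rewrite !inn_truncate.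
have := Gstates_closed Sl cuv; rewrite /inn.
have := cov_positive cuv; have := cov_glt cuv.
case pu : (Gpositive u); case pv : (Gpositive v) => //= g.
- by move=> _ h /andP[/h -> /(glt_trans g) ->].
- by move=> /(_ isT).
- by move=> _ h /andP[/h /negPf ->].
move=> _ h; apply: contra => /andP[ul ub]; apply/andP; split.
  by case: (boolP (v \in l.2)) => // /h; rewrite ul.
by case: u v b pu pv pb ub g {cuv h ul} => [? ?|? ?|k] [? ?|? ?|n] [? ?|? ?|m] //=; lia.
Qed.

Lemma ord_corner_positive l b : Gstates l -> Gpositive b -> is_corner l b ->
  ord_lt l b = -1.
Proof.
move=> Sl pb cb; have ST := truncate_state Sl pb.
have -> : ord_lt l b = ordl (phil (truncate l b) (Gcolor b)) (pos b).
  rewrite /ord_lt below_positive // /phil /Al !ordl_cat; congr (_ + _).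
  rewrite /ordA /Al ordl_cat !ordl_flatten /truncate /=.
  by congr (_ + _); exact: big_fset_condE.
have [_ h] := ordl_corner (site_of b) ST.
rewrite scol_site; apply/eqP/h; exists b => //; right; apply/(okdP _ _ ST).
split; first by rewrite /innd inn_truncate pb glt_irr andbF.
move=> v c; have := corner_pred Sl cb c; rewrite /innd inn_truncate /inn (cov_glt c) !andbT.
by case: (Gpositive v) => [->|/negPf ->].
Qed.

(** When a negative box is a corner all boxes of the third family before it are
    filled, that is, absent from [lambda^-], and the boxes of the other two
    families are on other lattices.  Only [Psi] remains; it has a pole at the
    box next to the positive ones, and there it belongs to the other factor of
    the l-weight. *)
Lemma ord_corner_negative l b : Gstates l -> ~~ Gpositive b -> is_corner l b ->
  ord_lt l b = 0.
Proof.
move=> Sl; case: b => // n /= n0 cb; have {}n0 : n < 0 by rewrite ltNge.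
have cl := Gstates_closed Sl; have [s1 s2] := Gstates_signed Sl.
have -> : ord_lt l (Box3 n) = if below (Box3 n) then ordPsi (Box3 n) else 0.
  rewrite /ord_lt -[RHS]addr0; congr (_ + _).
  rewrite /ordA scol_site ordl_Al.
  have z (x y : int) : \sum_(b <- l.1 | glt b (Box3 n)) (site_of b == (Some true, (x, y)))%:Z
      - \sum_(b <- l.2 | glt b (Box3 n)) (site_of b == (Some true, (x, y)))%:Z = 0.
    rewrite big_seq_cond big1 => [|[i k|i k|m] /andP[bl /=] mn]; rewrite ?site_eqE //=; last first.
      by have := s1 _ bl => /=; lia.
    rewrite sub0r big_seq_cond big1 ?oppr0 // => -[i k|i k|m] /andP[bl /=] mn; rewrite ?site_eqE //=.
    have : inn l (Box3 m).
      apply: (closed_Box3 (n := n - 1) cl); first by lia.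
        by apply: (corner_pred Sl cb) => /=; rewrite subrK.
    by rewrite /inn (negPf (s2 _ bl)) bl.
  by rewrite /lap /= !z.
case: ifPn => // bb; rewrite ordPsi_neg //; case: eqP => // en.
case/negP: (elimT idP (isT : ~~ false)).
move: bb; rewrite /below /psi_below /= {1}en /= => /asboolP.
have := has_lead_Psi (Box3 n); rewrite ordPsi_neg // en eqxx => h.
move=> hr; case: (pole_not_regular h).
by move: hr; rewrite (position_site (Box3 (-1))).
Qed.

Lemma ord_corner l b : Gstates l -> is_corner l b -> ord_lt l b + ord_gt l b = -1.
Proof.
move=> Sl cb; rewrite -ord_lt_gt; have [_ h] := ordl_corner (site_of b) Sl.
by rewrite scol_site; apply/eqP/h; exists b.
Qed.

Local Notation qq := (q - q^-1).

Lemma qq_neq0 : qq != 0.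
Proof.
apply/eqP => /subr0_eq e; have := q2_neq1; rewrite /Defs.q2 expr2 {2}e mulfV ?eqxx //.
exact: q_neq0.
Qed.

(** The coefficients of the action are these products only at corners.  The
    products are defined and nonzero for all boxes, which allows exchanging
    letters of a word without distinguishing cases. *)
Definition bl l b : C :=
  (if Gpositive b then qq^-1 * (leadPsi b / pos b) else if below b then leadPsi b else 1)
  * kapprod (glt^~ b) l b.
Definition al l b : C :=
  (if Gpositive b then 1 else - qq^-1 * ((if below b then 1 else leadPsi b) / pos b))
  * kapprod (glt b) l b.

Lemma bl_neq0 l b : bl l b != 0.
Proof.
rewrite mulf_neq0 ?kapprod_neq0 //; case: ifP => _; last first.
  by case: ifP => _; rewrite ?leadPsi_neq0 ?oner_neq0.
by rewrite mulf_neq0 ?invr_neq0 ?qq_neq0 // mulf_neq0 ?invr_neq0 ?leadPsi_neq0 ?spos_neq0.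
Qed.

Lemma al_neq0 l b : al l b != 0.
Proof.
rewrite mulf_neq0 ?kapprod_neq0 //; case: ifP => _; first exact: oner_neq0.
rewrite mulf_neq0 ?oppr_eq0 ?invr_neq0 ?qq_neq0 // mulf_neq0 ?invr_neq0 ?spos_neq0 //.
by case: ifP => _; rewrite ?leadPsi_neq0 ?oner_neq0.
Qed.

Lemma bcoef_bl l b : Gstates l -> is_corner l b ->
  bcoef lq ld Psi (Gcolor b) l (b : Gsystem mu nu) = bl l b.
Proof.
move=> Sl cb; have h := has_lead_lt l b; rewrite /bcoef /bl /= (position_site b).
case: ifPn => pb.
  rewrite ord_corner_positive // in h.
  rewrite (res_dlog_lead (spos_neq0 _) h) /lead_lt below_positive //.
  by rewrite [in LHS]mulrAC mulrA.
by rewrite ord_corner_negative // in h; rewrite (value_lead h).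
Qed.

Lemma acoef_al l b : Gstates l -> is_corner l b ->
  acoef lq ld Psi (Gcolor b) l (b : Gsystem mu nu) = al l b.
Proof.
move=> Sl cb; have h := has_lead_gt l b; rewrite /acoef /al /= (position_site b).
have e := ord_corner Sl cb.
case: ifPn => pb.
  rewrite ord_corner_positive // in e.
  have e0 : ord_gt l b = 0 by lia.
  by rewrite e0 in h; rewrite (value_lead h) /lead_gt below_positive.
rewrite ord_corner_negative // add0r in e; rewrite e in h.
rewrite (res_dlog_lead (spos_neq0 _) h) /lead_gt.
by rewrite [in LHS]mulrAC mulrA.
Qed.

Lemma G_coefs_defined : coefs_defined lq ld (@Gstates R mu nu) Psi.
Proof.
move=> i l b Sl; split=> -[cb <-] pb.
  have cb' : is_corner l b by right.
  have e := ord_corner Sl cb'; have h := has_lead_gt l b.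
  rewrite ord_corner_positive // in e.
  have e0 : ord_gt l b = 0 by lia.
  by rewrite e0 -(position_site b) in h; apply: regular_lead h.
have cb' : is_corner l b by left.
have h := has_lead_lt l b.
by rewrite ord_corner_negative // -(position_site b) in h; apply: regular_lead h.
Qed.

(** The boxes before [b] and the boxes after [b] complete each other to the
    whole l-weight except for the factor of [b] itself, which is
    [kap b b = -1] when [b] belongs to the state and accounts for the sign. *)
Lemma al_bl l b : signed l ->
  al l b * bl l b = (if inn l b then -1 else 1) * (qq^-1 * res_phi l (Gcolor b) b).
Proof.
move=> [s1 s2].
have -> : res_phi l (Gcolor b) b = leadPsi b / pos b *
  (kapprod (glt^~ b) l b * kapprod (glt b) l b
   * (if Gpositive b then (if inn l b then -1 else 1) else if inn l b then 1 else -1)).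
  rewrite /res_phi /phic /phil leadl_cat mulrACA lead_A -/(leadPsi b) [LHS]mulrAC; congr (_ * _).
  have split (A : {fset Gbox}) (F : Gbox -> C) :
      \prod_(w <- A) F w = \prod_(w <- A | glt w b) F w * \prod_(w <- A | glt b w) F w
        * (if b \in A then F b else 1) := big_lt_gt _ A b F.
  rewrite /kapprod !split kap_self invrN1 mulrACA; congr (_ * _).
    by rewrite mulrACA.
  rewrite /inn; case pb : (Gpositive b).
    have -> : (b \in l.2) = false by apply/negP => /s2; rewrite pb.
    by rewrite mulr1.
  have -> : (b \in l.1) = false by apply/negP => /s1; rewrite pb.
  by rewrite mul1r; case: (b \in l.2).
rewrite /al /bl; move: (kapprod _ _ _) (kapprod _ _ _) (leadPsi b) (pos b) (qq) => x y p z r.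
by case: (Gpositive b); case: (inn l b); case: (below b); ring.
Qed.

Lemma kapprod_remove (P : pred Gbox) l u b : signed l -> inn l u ->
  kapprod P (remove_box l u) b = kapprod P l b * (if P u then (kap u b)^-1 else 1).
Proof.
move=> [s1 s2]; rewrite /inn /remove_box /kapprod /=; case pu : (Gpositive u) => /= ul.
  rewrite [in RHS]big_mkcond /= (big_fsetD1 u) //= -big_mkcond /=.
  by case: ifP => _; rewrite ?mulr1 ?mul1r // mulrAC [kap u b * _]mulrC mulfK ?kap_neq0.
rewrite [X in _ * X = _]big_mkcond /= big_fsetU1 //= -big_mkcond /= mulrCA mulrC.
by case: ifP.
Qed.

Lemma kapprod_add (P : pred Gbox) l u b : signed l -> ~~ inn l u ->
  kapprod P (add_box l u) b = kapprod P l b * (if P u then kap u b else 1).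
Proof.
move=> sl ul; have i0 : innd false l u by rewrite /innd (negPf ul).
have i1 : inn (add_box l u) u by rewrite inn_add eqxx.
have s1 : signed (add_box l u) := signed_tog false u sl.
have e := kapprod_remove P b s1 i1.
have e2 := togK sl i0; rewrite /tog /= in e2; rewrite e2 in e.
by rewrite e; case: ifP => _; rewrite ?mulr1 // mulfVK ?kap_neq0.
Qed.

(** ** Words in the creation and annihilation operators *)
Definition coef d l b : C := if d then bl l b else al l b.

(** The factor that the coefficient of [v] acquires when [u] is processed before
    it: for [E] only boxes before [v] count, for [F] only boxes after it *)
Definition kd d u v : C :=
  if d then if glt u v then (kap u v)^-1 else 1 else if glt v u then kap u v else 1.
Definition ggd d u v : C := if d then gg u v else gg v u.

Lemma coef_neq0 d l b : coef d l b != 0.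
Proof. by case: d; [exact: bl_neq0 | exact: al_neq0]. Qed.

Lemma coef_tog d l u v : signed l -> innd d l u ->
  coef d (tog d l u) v = coef d l v * kd d u v.
Proof.
rewrite /innd; case: d => sl ul; rewrite /coef /tog /kd.
  by rewrite /bl kapprod_remove ?mulrA //; case: (inn l u) ul.
by rewrite /al kapprod_add ?mulrA //; case: (inn l u) ul.
Qed.

Definition csign u v : C := (-1) ^+ (Gcolor u + Gcolor v)%N.

Lemma csignP u v : csign u v = 1 \/ csign u v = -1.
Proof.
by rewrite /csign -signr_odd; case: odd; [right; rewrite expr1 | left; rewrite expr0].
Qed.

Lemma csignC u v : csign u v = csign v u.
Proof. by rewrite /csign addnC. Qed.

(** One of the two factors [kd] is [1] and the other a value of [kap] or its
    inverse, according to which box comes first in the order of the boxes; in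
    all cases [kap_gg] gives the same ratio. *)
Lemma kd_ratio d u v : u != v -> gg u v != 0 -> gg v u != 0 ->
  kd d v u * ggd d u v = - csign u v * (kd d u v * ggd d v u).
Proof.
move=> uv guv gvu.
have h1 := kap_gg guv gvu; have h2 := kap_gg gvu guv.
rewrite addnC -/(csign u v) in h2; rewrite -/(csign u v) in h1.
rewrite /kd /ggd; case/orP: (glt_total uv) => g; rewrite g (glt_asym g) {g}; case: d;
  rewrite ?h1 ?h2; move: (gg u v) (gg v u) guv gvu => x y x0 y0;
  by case: (csignP u v) => ->; field; rewrite ?x0 ?y0 // ?oppr_eq0 ?oner_neq0.
Qed.

(** A word lists boxes in the order in which they are processed. *)
Definition em d l b : C := if `[< okd d l b >] then coef d l b else 0.
Fixpoint emw d l (s : seq Gbox) : C :=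
  if s is b :: s' then em d l b * emw d (tog d l b) s' else 1.

(** The condition that each letter be a corner at its turn becomes the vanishing
    of a factor: [u] cannot come before [v] when [v] has to be processed
    first. *)
Definition sg d u v : C := if covd d u v then 0 else kd d u v.
(** The boxes of a word with nonzero coefficient are those between the ideal
    before and the ideal after; this is the condition on them that does not
    depend on the order of the letters. *)
Definition convd d l (s : seq Gbox) : Prop :=
  [/\ uniq s, forall b, b \in s -> innd d l b
    & forall b v, b \in s -> covd d b v -> innd d l v -> v \in s].

Lemma convd_perm d l (s t : seq Gbox) : perm_eq s t -> convd d l s -> convd d l t.
Proof.
move=> st [h1 h2 h3]; have e := perm_mem st.
split; first by rewrite -(perm_uniq st).
  by move=> b; rewrite -e; exact: h2.
by move=> b v; rewrite -!e; exact: h3.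
Qed.

(** A letter is a corner only if everything that has to be processed before it
    has been, so the letters exhaust what they require. *)
Lemma emw_convd d l (s : seq Gbox) : Gstates l -> emw d l s != 0 -> convd d l s.
Proof.
elim: s l => [|b s IH] l Sl //=; rewrite mulf_eq0 negb_or => /andP[].
rewrite /em; case: asboolP => [okb _ |]; last by rewrite eqxx.
move=> /(IH _ (okd_state okb)) [h1 h2 h3]; have [ib hb] := iffLR (okdP _ _ Sl) okb.
split=> /=.
- by rewrite h1 andbT; apply/negP => /h2; rewrite innd_tog eqxx.
- by move=> v; rewrite inE => /orP[/eqP ->|/h2] //; rewrite innd_tog => /andP[].
move=> v w; rewrite !inE => /orP[/eqP -> c|vs c] iw; first by have := hb _ c; rewrite iw.
case: (eqVneq w b) => //= wb; apply: h3 vs c _; by rewrite innd_tog wb.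
Qed.

(** Given [convd], the only obstruction to processing the letters in a given
    order is a pair in the wrong order, which [sg] detects. *)
Lemma emwE d l (s : seq Gbox) : Gstates l -> convd d l s ->
  emw d l s = (\prod_(b <- s) coef d l b) * pairw (sg d) s.
Proof.
have fp (f : Gbox -> C) (r : seq Gbox) : foldr (fun v x => f v * x) 1 r = \prod_(v <- r) f v.
  by elim: r => [|v r IH] /=; rewrite ?big_nil // big_cons IH.
elim: s l => [|b s IH] l Sl /=; first by rewrite big_nil mulr1.
case=> /= /andP[bs us] h2 h3.
rewrite fp; have ib : innd d l b by apply: h2; rewrite mem_head.
have ok1 v : v \in s -> covd d b v -> ~ okd d l b.
  move=> vs c /(okdP _ _ Sl)[_ h]; have := h _ c.
  by rewrite h2 // inE vs orbT.
rewrite /em; case: asboolP => okb; last first.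
  rewrite mul0r; suff [v vs c] : exists2 v, v \in s & covd d b v.
    have -> : \prod_(w <- s) sg d b w = 0.
      by rewrite (perm_big _ (perm_to_rem vs)) big_cons /sg c; exact: mul0r.
    by rewrite mul0r mulr0.
  apply: contrapT => h; apply: okb; apply/(okdP _ _ Sl); split=> // v c.
  apply/negP => iv; apply: h; exists v => //.
  have := h3 b v (mem_head _ _) c iv; rewrite inE => /orP[/eqP e|//].
  by rewrite e covd_irr in c.
have cs : convd d (tog d l b) s.
  split=> // [v vs|v w vs c].
    by rewrite innd_tog h2 ?inE ?vs ?orbT // andbT; apply: contraNneq bs => <-.
  rewrite innd_tog => /andP[wb iw].
  have := h3 v w _ c iw; rewrite !inE vs orbT => /(_ isT).
  by rewrite (negPf wb).
rewrite (IH _ (okd_state okb) cs) big_cons -!mulrA; congr (_ * _); rewrite !mulrA; congr (_ * _).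
rewrite -big_split /=; apply: eq_big_seq => v vs.
rewrite (coef_tog v (Gstates_signed Sl) ib) /sg; case: ifP => // c.
by case: (ok1 _ vs c okb).
Qed.

(** A difference of two ideals contains, with two diagonal neighbours, the two
    boxes that complete them to a square. *)
Lemma covd_dia d l (s : seq Gbox) u v : Gstates l -> convd d l s -> u \in s -> v \in s -> dia u v ->
  exists w w', [/\ w \in s, w' \in s, Gcolor w = Gcolor u, Gcolor w' = Gcolor v
                & [&& w != u, w != v, w' != u & w' != v]].
Proof.
move=> Sl [us h2 h3] us' vs' /dia_between[_ [w [w' [c1 c2 c3 c4 [e1 e2]]]]].
have ms x : cov u x -> cov x v -> x \in s.
  case: d h2 h3 => h2 h3 cx cy.
    by apply: (h3 u) => //; apply: (innd_closed Sl (d := true) cy); apply: h2.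
  by apply: (h3 v) => //; apply: (innd_closed Sl (d := false) cx); apply: h2.
exists w, w'; split=> //; [exact: ms | exact: ms |].
have ne x y : cov x y -> x != y by move=> c; apply: contraTneq c => ->; rewrite cov_irr.
by rewrite eq_sym ne // (ne w v) // eq_sym ne // (ne w' v).
Qed.

(** If both orders are allowed this is [kd_ratio].  If one order is forbidden its
    factor [sg] is zero by definition, and so is the corresponding value of [g],
    because away from diagonal neighbours [g] vanishes exactly on covering
    pairs ([gg_eq0]). *)
Lemma sg_gg d u v : u != v -> ~~ dia u v -> ~~ dia v u ->
  exists c, sg d v u = c * ggd d v u /\ sg d u v = - csign u v * c * ggd d u v.
Proof.
move=> uv d1 d2.
have e1 : (gg u v == 0) = cov u v by rewrite gg_eq0 (negPf d2) orbF.
have e2 : (gg v u == 0) = cov v u by rewrite gg_eq0 (negPf d1) orbF.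
have g1 : (ggd d u v == 0) = covd d u v by rewrite /ggd /covd; case: (d).
have g2 : (ggd d v u == 0) = covd d v u by rewrite /ggd /covd; case: (d).
rewrite /sg; case cuv : (covd d u v).
  have g : ggd d v u != 0.
    rewrite g2; apply/negP => h; move: (cuv) (h); rewrite /covd.
    by case: d {g1 g2 cuv h} => /cov_glt h1 /cov_glt; rewrite (glt_asym h1).
  exists (kd d v u / ggd d v u); rewrite divfK //; split.
    by rewrite -g2 (negPf g).
  by move: g1; rewrite cuv => /eqP ->; rewrite mulr0.
case cvu : (covd d v u).
  exists (- csign u v * kd d u v / ggd d u v); split.
    by move: g2; rewrite cvu => /eqP ->; rewrite mulr0.
  rewrite -mulrA divfK ?g1 ?cuv //.
  by case: (csignP u v) => ->; ring.
have nuv : ggd d u v != 0 by rewrite g1 cuv.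
have nvu : ggd d v u != 0 by rewrite g2 cvu.
exists (kd d v u / ggd d v u); split; first by rewrite divfK.
have h : kd d v u * ggd d u v = - csign u v * (kd d u v * ggd d v u).
  by apply: kd_ratio => //; move: nuv nvu; rewrite /ggd; case: d {g1 g2 cuv cvu}.
rewrite -mulrA mulrAC h; move: nvu; move: (ggd d v u) => x x0.
by rewrite mulrAC; case: (csignP u v) => ->; field.
Qed.

(** Two letters are never diagonal neighbours, because a word containing two
    diagonal neighbours contains at least four letters ([covd_dia]), so
    [sg_gg] applies. *)
Lemma exchange_coef d l u v : Gstates l -> u != v ->
  csign u v * ggd d u v * emw d l [:: v; u] + ggd d v u * emw d l [:: u; v] = 0.
Proof.
move=> Sl uv.
have [c|nc] : convd d l [:: u; v] \/ ~ convd d l [:: u; v] by exact: EM.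
  have p : perm_eq [:: u; v] [:: v; u] by rewrite (perm_catC [:: u] [:: v]).
  have nd (x y : Gbox) : x \in [:: u; v] -> y \in [:: u; v] -> ~~ dia x y.
    move=> xs ys; apply/negP => dxy; have [w [_ [ws _ _ _ /and4P[wx wy _ _]]]] := covd_dia Sl c xs ys dxy.
    have xy : x != y by apply: contraTneq (dia_glt dxy) => ->; rewrite glt_irr.
    by move: xs ys ws xy wx wy; rewrite !inE => /orP[]/eqP -> /orP[]/eqP -> /orP[]/eqP ->; rewrite ?eqxx.
  have [k [e1 e2]] := sg_gg d uv (nd _ _ (mem_head _ _) (mem_last u [:: v])) (nd _ _ (mem_last u [:: v]) (mem_head _ _)).
  rewrite !emwE //; last exact: convd_perm p c.
  rewrite !big_cons !big_nil /= !mulr1 e1 e2.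
  move: (csign u v) (csignP u v) (ggd d u v) (ggd d v u) (coef d l u) (coef d l v) {e1 e2} k.
  by move=> s [] -> x y a a' k; ring.
have z (s : seq Gbox) : perm_eq [:: u; v] s -> emw d l s = 0.
  move=> p; apply/eqP; apply: contraPT nc => /(emw_convd Sl) h; apply.
  by apply: convd_perm h; rewrite perm_sym.
by rewrite !z ?mulr0 ?addr0 // (perm_catC [:: u] [:: v]).
Qed.

Lemma csign_same u v : Gcolor v = Gcolor u -> csign u v = 1.
Proof. by move=> e; rewrite /csign e addnn -signr_odd odd_double expr0. Qed.

Lemma csign_diff u v : Gcolor v = Gcolor u + 1 -> csign u v = -1.
Proof.
move=> e; rewrite /csign e; case: (Gcolor u) => -[|[|//]] i /=.
  by rewrite expr1.
by rewrite expr1.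
Qed.

(** A word with diagonal neighbours contains two letters of each color, by
    [covd_dia], while here the colors are distributed three to one.  So
    [sg_gg] applies to every pair of letters, and the coefficient of the nested
    commutators reduces to [serre_identity]. *)
Lemma serre_coef d l (a b c y : Gbox) : Gstates l ->
  Gcolor b = Gcolor a -> Gcolor c = Gcolor a -> Gcolor y = Gcolor a + 1 ->
  serre_sum q2 q2^-1 (emw d l) a b c y = 0.
Proof.
move=> Sl eb ec ey.
have [cd|nc] : convd d l [:: a; b; c; y] \/ ~ convd d l [:: a; b; c; y] by exact: EM.
  have hE (s : seq Gbox) : perm_eq [:: a; b; c; y] s ->
      emw d l s = (\prod_(v <- [:: a; b; c; y]) coef d l v) * pairw (sg d) s.
    by move=> p; rewrite emwE ?(perm_big _ p) //; apply: convd_perm cd.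
  have [us _ _] := cd.
  have nd (u v : Gbox) : u \in [:: a; b; c; y] -> v \in [:: a; b; c; y] -> ~~ dia u v.
    move=> hu hv; apply/negP => duv.
    have [w [w' [ws ws' ew ew' /and4P[wu wv wu' wv']]]] := covd_dia Sl cd hu hv duv.
    have yN : Gcolor y != Gcolor a by rewrite ey Z2_addr1.
    have [cuv _] := dia_between duv.
    move: hu hv ws ws'; rewrite !inE => hu hv ws ws'.
    have cc (x : Gbox) : [|| x == a, x == b, x == c | x == y] -> x = y \/ Gcolor x = Gcolor a.
      by case/or4P => /eqP ->; auto.
    have [eu|cu] := cc _ hu; have [ev|cv] := cc _ hv.
    - by rewrite eu ev eqxx in cuv.
    - have [e|e] := cc _ ws; first by rewrite e eu eqxx in wu.
      by rewrite -eu -ew e eqxx in yN.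
    - have [e|e] := cc _ ws'; first by rewrite e ev eqxx in wv'.
      by rewrite -ev -ew' e eqxx in yN.
    - by rewrite cu cv eqxx in cuv.
  have N : serre_sum q2 q2^-1 (emw d l) a b c y
      = (\prod_(v <- [:: a; b; c; y]) coef d l v) * serre_sum q2 q2^-1 (pairw (sg d)) a b c y.
    rewrite /serre_sum /serre3.
    do !(rewrite hE; last by apply/seq.permP => f /=; lia).
    move: (\prod_(_ <- _) _) (pairw (sg d)) (q2^-1) (Defs.q2 lq) => N W p r.
    by ring.
  rewrite N [X in _ * X](_ : _ = 0) ?mulr0 // {N hE}.
  have mem : [/\ a \in [:: a; b; c; y], b \in [:: a; b; c; y], c \in [:: a; b; c; y] & y \in [:: a; b; c; y]].
    by rewrite !inE !eqxx !orbT.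
  have [ma mb mc my] := mem.
  have ne : [&& b != a, c != a, c != b, y != a, y != b & y != c].
    move: us; rewrite /= !inE !negb_or => /and4P[/and3P[h1 h2 h3] /andP[h4 h5] h6 _].
    by rewrite (eq_sym b a) (eq_sym c a) (eq_sym c b) !(eq_sym y) h1 h2 h3 h4 h5 h6.
  have /and5P[nba nca ncb nya /andP[nyb nyc]] := ne.
  have [A [e1 e2]] := sg_gg d nba (nd _ _ mb ma) (nd _ _ ma mb).
  have [B [e3 e4]] := sg_gg d nca (nd _ _ mc ma) (nd _ _ ma mc).
  have [D [e5 e6]] := sg_gg d ncb (nd _ _ mc mb) (nd _ _ mb mc).
  have [X [e7 e8]] := sg_gg d nya (nd _ _ my ma) (nd _ _ ma my).
  have [Y [e9 e10]] := sg_gg d nyb (nd _ _ my mb) (nd _ _ mb my).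
  have [Z [e11 e12]] := sg_gg d nyc (nd _ _ my mc) (nd _ _ mc my).
  have p1 (u v : Gbox) (k : C) : Gcolor v = Gcolor u -> - csign v u * k * ggd d v u = - (k * ggd d v u).
    by move=> e; rewrite csignC csign_same // mulN1r mulNr.
  have p2 (u : Gbox) (k : C) : Gcolor u = Gcolor a -> - csign y u * k * ggd d y u = k * ggd d y u.
    by move=> e; rewrite csignC csign_diff ?opprK ?mul1r // ey e.
  have hs (u v : Gbox) : Gcolor u = Gcolor v ->
      ggd d u v = if d then pos u - q2 * pos v else pos v - q2 * pos u.
    by move=> e; rewrite /ggd /gg e eqxx; case: (d).
  (* on different colors [g] is, by [q1 q2 q3 = 1], the form [h] of [serre_identity] divided by [q2] *)
  have hd (u v : Gbox) : Gcolor u != Gcolor v -> ggd d u v = q2^-1 *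
      (if d then q2 * pos u ^+ 2 - q2 * (q1 + q3) * pos u * pos v + pos v ^+ 2
       else q2 * pos v ^+ 2 - q2 * (q1 + q3) * pos v * pos u + pos u ^+ 2).
    have g (x z : C) : (x - q1 * z) * (x - q3 * z)
        = q2^-1 * (q2 * x ^+ 2 - q2 * (q1 + q3) * x * z + z ^+ 2).
      rewrite -q1q3 -[q2]invrK -q1q3; move: q1_neq0 q3_neq0.
      by move: (Defs.q1 lq ld) (Defs.q3 lq ld) => r s r0 s0; field; rewrite r0 s0.
    by move=> e; rewrite /ggd /gg (eq_sym (Gcolor v)) (negPf e); case: (d); rewrite g.
  have ya : Gcolor y != Gcolor a by rewrite ey Z2_addr1.
  have yb : Gcolor y != Gcolor b by rewrite eb.
  have yc : Gcolor y != Gcolor c by rewrite ec.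
  apply: (serre_identity (e := d) (t := q2 * (q1 + q3)) (pt := fun v : Gbox => pos v)
    (A := A) (B := B) (D := D) (X := X * q2^-1) (Y := Y * q2^-1) (Z := Z * q2^-1) q2_neq0).
  - by rewrite e1 hs.
  - by rewrite e2 p1 ?hs.
  - by rewrite e3 hs.
  - by rewrite e4 p1 ?hs.
  - by rewrite e5 hs // eb ec.
  - by rewrite e6 p1 ?hs // eb ec.
  - by rewrite e7 hd 1?eq_sym // mulrA.
  - by rewrite e8 p2 // hd // mulrA.
  - by rewrite e9 hd 1?eq_sym // mulrA.
  - by rewrite e10 p2 // hd // mulrA.
  - by rewrite e11 hd 1?eq_sym // mulrA.
  - by rewrite e12 p2 // hd // mulrA.
have z (s : seq Gbox) : perm_eq [:: a; b; c; y] s -> emw d l s = 0.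
  move=> p; apply/eqP; apply: contraPT nc => /(emw_convd Sl) h; apply.
  by apply: convd_perm h; rewrite perm_sym.
rewrite /serre_sum /serre3.
do !(rewrite z; last by apply/seq.permP => f /=; lia).
by rewrite !(mulr0, subr0, addr0).
Qed.

Lemma kap_inv u v : gg u v != 0 -> gg v u != 0 -> kap v u = (kap u v)^-1.
Proof.
move=> guv gvu; rewrite (kap_gg guv gvu) (kap_gg gvu guv).
rewrite -/(csign u v) -/(csign v u) (csignC v u).
move: (gg u v) (gg v u) guv gvu => x y x0 y0.
by case: (csignP u v) => ->; field; rewrite ?x0 ?y0.
Qed.

Lemma em0 d l b : ~ okd d l b -> em d l b = 0.
Proof. by rewrite /em; case: asboolP. Qed.

Lemma em1 d l b : okd d l b -> em d l b = coef d l b.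
Proof. by rewrite /em; case: asboolP. Qed.

(** Either both orders of adding [v] and removing [u] are possible or none is:
    [v] has to be a minimal box outside, [u] a maximal box inside, and [v] must
    not come directly after [u].  Then [v] and [u] are not related by a zero of
    [g] either, so each step changes the coefficient of the other by the same
    factor [kap], by [kap v u = (kap u v)^-1]. *)
Lemma em_remove_add l u v : Gstates l -> u != v ->
  em false l v * em true (add_box l v) u = em true l u * em false (remove_box l u) v.
Proof.
move=> Sl uv; have cl := Gstates_closed Sl; have sl := Gstates_signed Sl.
pose valid := [/\ ~~ inn l v, inn l u, forall w, cov w v -> inn l w,
  forall w, cov u w -> ~~ inn l w & ~~ cov u v].
have v1 : okd false l v /\ okd true (add_box l v) u <-> valid.
  split=> [[h1 h2]|[i1 i2 c1 c2 c3]].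
    have Sa : Gstates (add_box l v) := okd_state h1.
    move: h1 h2 => /(okdP _ _ Sl)[i1 h1] /(okdP _ _ Sa)[].
    rewrite /innd inn_add (negPf uv) /= eqb_id => i2 h2; split=> //.
    - by move: i1; rewrite /innd; case: inn.
    - by move=> w /h1; rewrite /innd; case: inn.
    - by move=> w /h2; rewrite /innd inn_add eqb_id negb_or => /andP[].
    - by apply/negP => /h2; rewrite /innd inn_add eqxx.
  have h1 : okd false l v.
    apply/(okdP _ _ Sl); split; first by rewrite /innd (negPf i1).
    by move=> w /c1; rewrite /innd => ->.
  split=> //; apply/(okdP _ _ (okd_state h1)); split; first by rewrite /innd inn_add i2 orbT.
  move=> w cw; rewrite /innd inn_add eqb_id negb_or c2 // andbT.
  by apply: contraNneq c3 => <-.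
have v2 : okd true l u /\ okd false (remove_box l u) v <-> valid.
  split=> [[h1 h2]|[i1 i2 c1 c2 c3]].
    have Sr : Gstates (remove_box l u) := okd_state h1.
    move: h1 h2 => /(okdP _ _ Sl)[i1 h1] /(okdP _ _ Sr)[].
    rewrite /innd inn_remove (eq_sym v) (negPf uv) /= => i2 h2; split=> //.
    - by move: i2; case: inn.
    - by move: i1; rewrite /innd; case: inn.
    - by move=> w /h2; rewrite /innd inn_remove; case: inn; rewrite // andbF.
    - by move=> w /h1; rewrite /innd; case: inn.
    - by apply/negP => /h2; rewrite /innd inn_remove eqxx.
  have h1 : okd true l u.
    apply/(okdP _ _ Sl); split; first by rewrite /innd i2.
    by move=> w /c2; rewrite /innd eqb_id.
  split=> //; apply/(okdP _ _ (okd_state h1)); split.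
    by rewrite /innd inn_remove (negPf i1) andbF.
  move=> w cw; rewrite /innd inn_remove c1 // andbT.
  by have -> : w != u by apply: contraNneq c3 => <-.
have [V|nV] : valid \/ ~ valid by exact: EM.
  have [a1 a2] := iffRL v1 V; have [a3 a4] := iffRL v2 V.
  have [i1 i2 c1 c2 c3] := V.
  have g1 : gg u v != 0.
    rewrite gg_eq0 (negPf c3) /=; apply/negP => /dia_between[_ [w [_ [k1 k2 _ _ _]]]].
    by move: i1; rewrite (cl _ _ k1) // (cl _ _ k2).
  have g2 : gg v u != 0.
    rewrite gg_eq0; apply/negP => /orP[k|/dia_between[_ [w [_ [k1 k2 _ _ _]]]]].
      by move: i1; rewrite (cl _ _ k).
    by move: (c1 _ k2); rewrite (negPf (c2 _ k1)).
  rewrite !em1 // /coef /bl /al (kapprod_add _ _ sl) // (kapprod_remove _ _ sl) // (kap_inv g1 g2).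
  by case: (glt v u); rewrite ?mulr1; move: (kapprod _ _ _) (kapprod _ _ _) => ? ?; ring.
have n1 : em false l v * em true (add_box l v) u = 0.
  have [h1|/em0 ->] := EM (okd false l v); last by rewrite mul0r.
  have [h2|/em0 ->] := EM (okd true (add_box l v) u); last by rewrite mulr0.
  by case: nV; apply/v1.
rewrite n1; have [h1|/em0 ->] := EM (okd true l u); last by rewrite mul0r.
have [h2|/em0 ->] := EM (okd false (remove_box l u) v); last by rewrite mulr0.
by case: nV; apply/v2.
Qed.

(** At most one of the two products is nonzero, according to whether [b] is
    outside or inside the ideal; [al_bl] evaluates it, and its sign in the
    commutator cancels the sign in [al_bl]. *)
Lemma em_remove_add_diag l b : Gstates l ->
  em false l b * em true (add_box l b) b - em true l b * em false (remove_box l b) b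
  = qq^-1 * (if corner l b then res_phi l (Gcolor b) b else 0).
Proof.
move=> Sl; have sl := Gstates_signed Sl; have e := al_bl b sl.
have self d : innd d l b -> coef (~~ d) (tog d l b) b = coef (~~ d) l b.
  rewrite /innd; case: d => i; rewrite /coef /tog /=.
    rewrite /al kapprod_remove ?glt_irr ?mulr1 //; by case: inn i.
  rewrite /bl kapprod_add ?glt_irr ?mulr1 //; by case: inn i.
rewrite /corner; case: asboolP => [[h|h]|n]; last first.
- have n1 : ~ okd true l b by move=> h; apply: n; left.
  have n2 : ~ okd false l b by move=> h; apply: n; right.
  by rewrite (em0 n1) (em0 n2) !mul0r subr0 mulr0.
- have [i _] := iffLR (okdP _ _ Sl) h.
  have n : ~ okd true l b.
    by case/(okdP _ _ Sl) => i' _; move: i i'; rewrite /innd; case: inn.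
  rewrite (em0 n) mul0r subr0 (em1 h) (em1 (okd_tog Sl h)) (self false i).
  by rewrite /coef /= e; move: i; rewrite /innd; case: inn => // _; rewrite mul1r.
have [i _] := iffLR (okdP _ _ Sl) h.
have n : ~ okd false l b.
  by case/(okdP _ _ Sl) => i' _; move: i i'; rewrite /innd; case: inn.
rewrite (em0 n) mul0r sub0r (em1 h) (em1 (okd_tog Sl h)) (self true i).
rewrite /coef /= mulrC e; move: i; rewrite /innd; case: inn => // _.
by rewrite mulN1r opprK.
Qed.

(** ** The operators of the action *)
(** As polynomials in [z], the first is [g_{i,j}(z, p)] and the second is
    [g_{j,i}(p, z)] up to sign, and [A] is the quotient of the second by the
    first. *)
Definition gpoly1 (i j : 'Z_2) (p : C) : {poly C} :=
  if i == j then 'X - (q2 * p)%:P else ('X - (q1 * p)%:P) * ('X - (q3 * p)%:P).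
Definition gpoly2 (i j : 'Z_2) (p : C) : {poly C} :=
  if i == j then q2 *: 'X - p%:P else (q1 *: 'X - p%:P) * (q3 *: 'X - p%:P).

Lemma gpoly1_neq0 i j p : gpoly1 i j p != 0.
Proof. by rewrite /gpoly1; case: ifP => _; rewrite ?mulf_neq0 ?polyXsubC_eq0. Qed.

Lemma Afun_gpoly (j : 'Z_2) (p : C) i :
  Afun lq ld j p i = rpoly (gpoly2 i j p) / rpoly (gpoly1 i j p).
Proof.
by rewrite /Afun /gpoly1 /gpoly2; case: ifP => _ //; rewrite [rpoly (_ * _)]rpolyM [rpoly (_ * _)]rpolyM.
Qed.

(** Removing [b] divides the l-weight by a factor [A^-1], or multiplies it by
    [A]; which of the two occurs depends on the sign of [b], the effect does
    not. *)
Lemma phi_remove l b i : signed l -> inn l b ->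
  phi lq ld Psi (remove_box l b) i * rpoly (gpoly1 i (Gcolor b) (pos b))
  = phi lq ld Psi l i * rpoly (gpoly2 i (Gcolor b) (pos b)).
Proof.
move=> [s1 s2] ib.
have z1 : rpoly (gpoly1 i (Gcolor b) (pos b)) != 0 by rewrite rpoly_eq0 gpoly1_neq0.
have z2 : rpoly (gpoly2 i (Gcolor b) (pos b)) != 0.
  rewrite rpoly_eq0 /gpoly2.
  have z (r p : C) : r != 0 -> r *: 'X - p%:P != 0.
    move=> r0; apply/eqP => /(congr1 (fun s : {poly C} => s`_1)).
    by rewrite coefB coefZ coefX coefC /= mulr1 subr0 coef0 => /eqP; rewrite (negPf r0).
  by case: ifP => _; rewrite ?mulf_neq0 ?z ?q1_neq0 ?q2_neq0 ?q3_neq0.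
pose a := Afun lq ld (Gcolor b) (pos b) i.
have ea : a = rpoly (gpoly2 i (Gcolor b) (pos b)) / rpoly (gpoly1 i (Gcolor b) (pos b)) := Afun_gpoly _ _ _.
have gen1 (F : fieldType) (x P Q n m : F) : n != 0 -> m != 0 ->
    x * (P * Q) * m = x * ((n / m)^-1 * P * Q) * n.
  by move=> n0 m0; field; rewrite n0 m0.
have gen2 (F : fieldType) (x P Q n m : F) : n != 0 -> m != 0 ->
    x * (P * (n / m * Q)) * m = x * (P * Q) * n.
  by move=> n0 m0; field; rewrite m0.
rewrite /phi /Aprod /remove_box /=; move: ib; rewrite /inn; case: ifP => pb bl.
  have -> : \prod_(b0 <- l.1) (Afun lq ld (Gcolor b0) (position lq ld (b0 : Gsystem mu nu)) i)^-1
    = a^-1 * \prod_(b0 <- (l.1 `\ b)%fset) (Afun lq ld (Gcolor b0) (position lq ld (b0 : Gsystem mu nu)) i)^-1.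
    by rewrite (big_fsetD1 b bl) /= (position_site b).
  rewrite ea /=; move: (rpoly _) (rpoly _) z1 z2 (Psi i) (\prod_(b0 <- (l.1 `\ b)%fset) _) (\prod_(b0 <- l.2) _).
  by move=> n m m0 n0 x P Q; exact: (gen1 _ x P Q n m n0 m0).
have -> : \prod_(b0 <- (b |` l.2)%fset) Afun lq ld (Gcolor b0) (position lq ld (b0 : Gsystem mu nu)) i
    = a * \prod_(b0 <- l.2) Afun lq ld (Gcolor b0) (position lq ld (b0 : Gsystem mu nu)) i.
  by rewrite (@big_fsetU1 _ _ _ _ _ _ _ bl) /= (position_site b).
rewrite ea /=; move: (rpoly _) (rpoly _) z1 z2 (Psi i) (\prod_(b0 <- l.1) _) (\prod_(b0 <- l.2) _).
by move=> n m m0 n0 x P Q; exact: (gen2 _ x P Q n m n0 m0).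
Qed.

(** The eigenvalues of [K_i^+(z)] for [s = true] and of [K_i^-(z)] for
    [s = false] *)
Definition cK (s : bool) l (i : 'Z_2) : int -> C :=
  xget (fun=> 0) [set c | expansion s (phi lq ld Psi l i) c].

Lemma cK_expansion (s : bool) l i : Gstates l -> expansion s (phi lq ld Psi l i) (cK s l i).
Proof.
move=> Sl; have [N wN] := within_exists l.
have hX b : corner l b -> b \in Wbox N.+2.
  by move=> /asboolP[]h; apply: mem_Wbox; apply: okd_bsize h.
have [cp [cm [[h1 h2 _ _ _] _]]] := phi_expansion i Sl hX.
rewrite /cK; case: s; first exact: (@xgetI _ _ _ cp).
exact: (@xgetI _ _ _ cm).
Qed.

Lemma cK_zero l i : Gstates l -> cK true l i 0 = phic l i /\ cK true l i 0 * cK false l i 0 = 1.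
Proof.
move=> Sl; have [N wN] := within_exists l.
have hX b : corner l b -> b \in Wbox N.+2.
  by move=> /asboolP[]h; apply: mem_Wbox; apply: okd_bsize h.
have [cp [cm [[h1 h2 h3 h4 _] _]]] := phi_expansion i Sl hX.
rewrite (expansion_uniq (cK_expansion true i Sl) h1) (expansion_uniq (cK_expansion false i Sl) h2).
by split.
Qed.

Lemma cK_difference l i (X : {fset Gbox}) k : Gstates l -> (forall b, corner l b -> b \in X) ->
  cK true l i k - cK false l i k =
    \sum_(b <- X) (if corner l b && (Gcolor b == i) then res_phi l i b else 0) * pos b ^ k.
Proof.
move=> Sl hX; have [cp [cm [[h1 h2 h3 h4 h5] _]]] := phi_expansion i Sl hX.
by rewrite (expansion_uniq (cK_expansion true i Sl) h1) (expansion_uniq (cK_expansion false i Sl) h2).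
Qed.

(** This is the exchange relation of [K_i^+(z)] and [K_i^-(z)] with [E_j(w)] on
    the coefficient of [w = p(b)], from the relation of the rational functions
    in [phi_remove]. *)
Lemma cK_remove (s : bool) l b i k : Gstates l -> okd true l b ->
  pmul (gpoly1 i (Gcolor b) (pos b)) (cK s (remove_box l b) i) k
  = pmul (gpoly2 i (Gcolor b) (pos b)) (cK s l i) k.
Proof.
move=> Sl ob; have Sr : Gstates (remove_box l b) := okd_state ob.
have ib : inn l b by have [] := iffLR (okdP _ _ Sl) ob; rewrite /innd; case: inn.
have e1 := cK_expansion s i Sl; have e2 := cK_expansion s i Sr.
apply: (series_quot (expansion_series e1) (expansion_series e2)
  (expansion_one_sided e1) (expansion_one_sided e2)).
exact: (phi_remove i (Gstates_signed Sl) ib).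
Qed.

Lemma cK_add (s : bool) l b i k : Gstates l -> okd false l b ->
  pmul (gpoly1 i (Gcolor b) (pos b)) (cK s l i) k
  = pmul (gpoly2 i (Gcolor b) (pos b)) (cK s (add_box l b) i) k.
Proof.
move=> Sl ob; have Sa : Gstates (add_box l b) := okd_state ob.
rewrite -(cK_remove s i k Sa (okd_tog Sl ob)).
by have [ib _] := iffLR (okdP _ _ Sl) ob; have := togK (Gstates_signed Sl) ib; rewrite /tog /= => ->.
Qed.

Section Distributions.
Variable V : lmodType C.
Implicit Types (x : V) (i j : 'Z_2) (k n : int).

(** The relations for [E] and for [F] contain [g] with [z] and [w] exchanged;
    the Boolean selects the variable in the first argument. *)
Definition mz (e : bool) : dist V -> dist V := if e then @mulz R V else @mulw R V.
Local Notation mulg i j e := (mul_g lq ld i j (mz e) (mz (~~ e))).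

Lemma mul_g_sum (I : Type) (r : seq I) (F : I -> dist V) i j e k n :
  mulg i j e (fun k n => \sum_(a <- r) F a k n) k n = \sum_(a <- r) mulg i j e (F a) k n.
Proof.
rewrite /mul_g /mul_lin /mz /mulz /mulw; case: ifP => _; case: e => /=;
  by do 4 rewrite ?scaler_sumr -?sumrB.
Qed.

Lemma mul_g_scale (c : C) (F : dist V) i j e k n :
  mulg i j e (fun k n => c *: F k n) k n = c *: mulg i j e F k n.
Proof.
have cm (a : C) x : a *: (c *: x) = c *: (a *: x) by rewrite !scalerA mulrC.
rewrite /mul_g /mul_lin /mz /mulz /mulw; case: ifP => _; case: e => /=;
  by do 4 rewrite ?cm -?scalerBr.
Qed.

Lemma mul_g_ext (F G : dist V) i j e k n : (forall k n, F k n = G k n) ->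
  mulg i j e F k n = mulg i j e G k n.
Proof.
by move=> h; rewrite /mul_g /mul_lin /mz /mulz /mulw; case: ifP => _; case: e => /=; rewrite !h.
Qed.

Definition gfun i j (x y : C) : C :=
  if i == j then x - q2 * y else (x - q1 * y) * (x - q3 * y).

(** On a product of delta functions supported at [z = x] and [w = y], formal
    multiplication by [g] is multiplication by its value at the support. *)
Lemma mul_g_mono (x y : C) (w : V) i j e k n : x != 0 -> y != 0 ->
  mulg i j e (fun k n => (x ^ k * y ^ n) *: w) k n
  = (gfun i j (if e then x else y) (if e then y else x)) *: ((x ^ k * y ^ n) *: w).
Proof.
move=> x0 y0; have xS m : x ^ (m + 1) = x * x ^ m by rewrite addrC expfzDr ?expr1z.
have yS m : y ^ (m + 1) = y * y ^ m by rewrite addrC expfzDr ?expr1z.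
rewrite /mul_g /mul_lin /mz /mulz /mulw /gfun.
case: ifP => _; case: e => /=; rewrite ?xS ?yS !(scalerA, =^~ scalerBl); congr (_ *: _);
  move: (x ^ k) (y ^ n) (Defs.q1 lq ld) (Defs.q2 lq) (Defs.q3 lq ld) => ? ? ? ? ?; ring.
Qed.

Lemma pmul_lin (c : int -> C) (a : C) k : pmul ('X - a%:P) c k = c (k + 1) - a * c k.
Proof. by rewrite -polyCN pmulDl pmulC -['X]mul1r pmulMX -[1]/(1%:P) pmulC mul1r mulNr. Qed.

Lemma pmul_scale (c : int -> C) (a r : C) k :
  pmul (r *: 'X - a%:P) c k = r * c (k + 1) - a * c k.
Proof. by rewrite -polyCN pmulDl pmulC -mul_polyC pmulMX pmulC mulNr. Qed.

Lemma mul_g_series1 (c : int -> C) (y : C) (w : V) i j k n : y != 0 ->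
  mulg i j true (fun k n => (c k * y ^ n) *: w) k n
  = (pmul (gpoly1 i j y) c k * y ^ n) *: w.
Proof.
move=> y0; have yS m : y ^ (m + 1) = y * y ^ m by rewrite addrC expfzDr ?expr1z.
rewrite /mul_g /mul_lin /mz /mulz /mulw /gpoly1.
case: ifP => _ /=; rewrite ?pmulM ?pmul_lin ?yS !(scalerA, =^~ scalerBl); congr (_ *: _);
  move: (y ^ n) (Defs.q1 lq ld) (Defs.q2 lq) (Defs.q3 lq ld) => ? ? ? ?; ring.
Qed.

Lemma mul_g_series2 (c : int -> C) (y : C) (w : V) i j k n : y != 0 ->
  mulg j i false (fun k n => (c k * y ^ n) *: w) k n
  = - (-1) ^+ (i + j)%N *: ((pmul (gpoly2 i j y) c k * y ^ n) *: w).
Proof.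
move=> y0; have yS m : y ^ (m + 1) = y * y ^ m by rewrite addrC expfzDr ?expr1z.
have -> : (-1) ^+ (i + j)%N = if i == j then 1 else -1 :> C.
  case: eqP => [->|]; first by rewrite addnn -signr_odd odd_double expr0.
  by case: i j => [[|[|//]] ?] [[|[|//]] ?] ne //=; rewrite ?expr1 //; case: ne; apply/val_inj.
rewrite /mul_g /mul_lin /mz /mulz /mulw /gpoly2 eq_sym.
case: ifP => _ /=; rewrite ?pmulM ?pmul_scale ?yS !(scalerA, =^~ scalerBl); congr (_ *: _);
  move: (y ^ n) (Defs.q1 lq ld) (Defs.q2 lq) (Defs.q3 lq ld) => ? ? ? ?; ring.
Qed.

End Distributions.

Lemma mul_g_linear (V : lmodType C) (F : V -> dist V) i j e k n :
  (forall k n, linear (fun x : V => F x k n)) ->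
  linear (fun x : V => mul_g lq ld i j (mz e) (mz (~~ e)) (F x) k n).
Proof.
move=> h a x y.
rewrite (@mul_g_ext V _ (fun k n => \sum_(c <- [:: true; false]) if c then a *: F x k n else F y k n)).
  by rewrite mul_g_sum !big_cons big_nil addr0 mul_g_scale.
by move=> k' n'; rewrite h !big_cons big_nil addr0.
Qed.

Lemma sumC (V : lmodType C) (X Y : seq Gbox) (F : Gbox -> Gbox -> V) :
  \sum_(u <- X) \sum_(v <- Y) F u v = \sum_(v <- Y) \sum_(u <- X) F u v.
Proof. exact: exchange_big. Qed.

Lemma exchange_linear (V : lmodType C) (A B : int -> {linear V -> V}) (s : C) i j i' j' e e' k n :
  linear (fun x : V =>
    s *: mul_g lq ld i j (mz e) (mz (~~ e)) (fun k' n' => A k' (B n' x)) k n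
    + mul_g lq ld i' j' (mz e') (mz (~~ e')) (fun k' n' => B n' (A k' x)) k n).
Proof.
move=> a x y.
have l1 k' n' : linear (fun x : V => A k' (B n' x)) by move=> b x' y'; rewrite !linearP.
have l2 k' n' : linear (fun x : V => B n' (A k' x)) by move=> b x' y'; rewrite !linearP.
rewrite (mul_g_linear (F := fun (x : V) k' n' => A k' (B n' x)) _ _ _ _ _ l1).
rewrite (mul_g_linear (F := fun (x : V) k' n' => B n' (A k' x)) _ _ _ _ _ l2).
by rewrite !scalerDr !scalerA [s * a]mulrC addrACA.
Qed.

Local Notation St := (@Gstates R mu nu).
Local Notation V := (Gspace mu nu).
Local Notation kt l := (ket St l).

Lemma ket_val (t : set_type St) : kt (val t) = << t >>.
Proof. by rewrite /ket valK. Qed.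

Lemma ket_state l : St l -> exists t : set_type St, val t = l.
Proof. by move=> Sl; exists (exist _ l (mem_set Sl)). Qed.

Lemma St_val (t : set_type St) : St (val t).
Proof. exact: (set_valP t). Qed.

Definition emc d (i : 'Z_2) l b : C := if Gcolor b == i then em d l b else 0.
Definition radius l : nat := sval (cid (within_exists l)).
(** The radius of a state bounds its boxes, so its corners lie in this set; the
    other boxes contribute zero. *)
Definition Gop_fun d i (k : int) (t : set_type St) : V :=
  \sum_(b <- Wbox (radius (val t)).+2)
     (emc d i (val t) b * pos b ^ k) *: kt (tog d (val t) b).
(** The coefficients of [E_i(z)] for [d = true] and of [F_i(z)] for
    [d = false] *)
Definition Gop d i (k : int) : {linear V -> V} := lext (Gop_fun d i k).
Arguments Gop : simpl never.

Lemma emc0 d i l b : ~ okd d l b -> emc d i l b = 0.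
Proof. by move=> h; rewrite /emc em0 // if_same. Qed.

Lemma sum_fset_eq (X Y : {fset Gbox}) (F : Gbox -> V) :
  (forall b, F b != 0 -> (b \in X) && (b \in Y)) ->
  \sum_(b <- X) F b = \sum_(b <- Y) F b.
Proof.
move=> h.
have e (Z : {fset Gbox}) : (forall b, F b != 0 -> b \in Z) ->
    \sum_(b <- Z) F b = \sum_(b <- (X `|` Y)%fset | F b != 0) F b.
  move=> hZ; rewrite (bigID (fun b => F b != 0)) /= [X in _ + X]big1 ?addr0; last first.
    by move=> b /negPn/eqP.
  rewrite big_fset_condE.
  suff -> : [fset b in Z | F b != 0]%fset = [fset b in (X `|` Y)%fset | F b != 0]%fset.
    by rewrite -big_fset_condE.
  apply/fsetP => b; rewrite !inE /=; case: (boolP (F b != 0)) => [Fb|]; rewrite ?andbF // !andbT hZ //.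
  by case/andP: (h _ Fb) => -> ->.
by rewrite !e // => b /h /andP[].
Qed.

Definition good N l : Prop := St l /\ within N l.

Lemma good_radius l : St l -> good (radius l) l.
Proof. by move=> Sl; split=> //; rewrite /radius; case: (cid _). Qed.

Lemma good_tog d N l b : good N l -> okd d l b -> good N.+2 (tog d l b).
Proof.
move=> [Sl wl] ob; split; first exact: okd_state ob.
apply: within_tog; last exact: okd_bsize ob.
by apply: within_leq wl; lia.
Qed.

Lemma good_mem d N M l b : good N l -> (N.+2 <= M)%N -> okd d l b -> b \in Wbox M.
Proof. by move=> [Sl wl] NM ob; apply: mem_Wbox; apply: leq_trans NM; apply: okd_bsize ob. Qed.

(** The sum over corners may be taken over any larger set, so that several
    operators applied one after the other can use a common one. *)
Lemma Gop_ket d i k l N M : good N l -> (N.+2 <= M)%N ->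
  Gop d i k (kt l) = \sum_(b <- Wbox M) (emc d i l b * pos b ^ k) *: kt (tog d l b).
Proof.
move=> gl NM; have [t tl] := ket_state gl.1.
rewrite -tl ket_val /Gop lext_basis /Gop_fun; apply: sum_fset_eq => b nz.
have ob : okd d (val t) b.
  by apply: contrapT => /(emc0 i) e; rewrite e mul0r scale0r eqxx in nz.
rewrite tl in ob *; rewrite (good_mem gl NM ob) andbT.
by apply: (good_mem (good_radius gl.1) _ ob).
Qed.

Lemma basis_ind (G : V -> V) : linear G -> (forall l, St l -> G (kt l) = 0) ->
  forall x, G x = 0.
Proof.
move=> lG h; apply: linear_ext0 lG _ => t; rewrite -ket_val; apply: h; exact: St_val.
Qed.

Fixpoint wt (w : seq ('Z_2 * int)) (s : seq Gbox) : C :=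
  match w, s with
  | (i, k) :: w', b :: s' => (if Gcolor b == i then pos b ^ k else 0) * wt w' s'
  | _, _ => 1
  end.
Definition togw d l (s : seq Gbox) := foldl (tog d) l s.

Lemma wtE (w : seq ('Z_2 * int)) (s : seq Gbox) : wt w s =
  \prod_(x <- zip w s) (if Gcolor x.2 == x.1.1 then pos x.2 ^ x.1.2 else 0).
Proof.
elim: w s => [|[i k] w IH] [|b s] /=; rewrite ?big_nil // big_cons IH //.
Qed.

Lemma togw_perm d (s s' : seq Gbox) l : perm_eq s s' -> togw d l s = togw d l s'.
Proof.
have sw b (r : seq Gbox) l0 : togw d (tog d l0 b) r = tog d (togw d l0 r) b.
  by elim: r l0 => //= v r IH l0; rewrite -IH togC.
elim: s s' l => [|b s IH] s' l p.
  by move: p; rewrite perm_sym => /perm_nilP ->.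
have bs : b \in s' by rewrite -(perm_mem p) mem_head.
case/splitPr: bs p => s1 s2; rewrite perm_sym -cat1s perm_catCA perm_cons perm_sym => p.
by rewrite /togw /= -/(togw d _ s) (IH _ _ p) /togw !foldl_cat /= -/(togw d l s1) -/(togw d _ s1) sw.
Qed.

(** ** Distinct l-weights *)
Lemma glt_site b b' f (x y x' y' : int) :
  site_of b = (f, (x, y)) -> site_of b' = (f, (x', y')) -> (y < y') || (y == y') && (x < x') ->
  glt b b'.
Proof.
case: b b' => [i k|i k|n] [i' k'|i' k'|n'] //= [<- <- <-] [] // <- <-; rewrite ?ltxx ?andbF ?orbF //; lia.
Qed.

(** Among the sites on which the order at [(x + 1, y + 1)] depends, [(x, y)] is
    the first one in the order of the boxes, so when the ideals agree after it
    the order determines them at [(x, y)]. *)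
Lemma lap_inj l l' b :
  (forall s, lap (fun t => (ext l t)%:Z) s = lap (fun t => (ext l' t)%:Z) s) ->
  (forall b', glt b b' -> inn l b' = inn l' b') -> inn l b = inn l' b.
Proof.
move=> hl hb; case e : (site_of b) => [f [x y]].
have above (x' y' : int) : (y < y') || (y == y') && (x < x') -> ext l (f, (x', y')) = ext l' (f, (x', y')).
  move=> g; have [[b' e']|n] := EM (exists b', site_of b' = (f, (x', y'))).
    by rewrite -e' !ext_site hb //; exact: glt_site e e' g.
  by apply: ext_not_site => b' e'; apply: n; exists b'.
have := hl (f, (x + 1, y + 1)); rewrite /lap !addrK -!ext_site e.
have -> : ext l (f, (x + 1, y + 1 + 1)) = ext l' (f, (x + 1, y + 1 + 1)) by apply: above; lia.
have -> : ext l (f, (x + 1 + 1, y + 1)) = ext l' (f, (x + 1 + 1, y + 1)) by apply: above; lia.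
have -> : ext l (f, (x + 1, y)) = ext l' (f, (x + 1, y)) by apply: above; lia.
have -> : ext l (f, (x, y + 1)) = ext l' (f, (x, y + 1)) by apply: above; lia.
have -> : ext l (f, (x + 1 + 1, y + 1 + 1)) = ext l' (f, (x + 1 + 1, y + 1 + 1)) by apply: above; lia.
move: (ext l' (f, (x + 1, y + 1 + 1))) (ext l' (f, (x + 1 + 1, y + 1))) (ext l' (f, (x + 1, y))) (ext l' (f, (x, y + 1)))
  (ext l' (f, (x + 1 + 1, y + 1 + 1))) => A B u1 u2 u3.
by case: (ext l _); case: (ext l' _) => //; lia.
Qed.

(** Two different ideals differ in finitely many boxes; [lap_inj] applies to
    the last of them. *)
Lemma phi_inj l l' : St l -> St l' ->
  (forall i, phi lq ld Psi l i = phi lq ld Psi l' i) -> l = l'.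
Proof.
move=> Sl Sl' e; have sl := Gstates_signed Sl; have sl' := Gstates_signed Sl'.
have hl s : lap (fun t => (ext l t)%:Z) s = lap (fun t => (ext l' t)%:Z) s.
  rewrite -!ordl_phil //; have := e (scol s); rewrite !phi_srat => es.
  have h1 := has_lead_srat (phil l (scol s)) (spos s) (phic_neq0 l (scol s)).
  have h2 := has_lead_srat (phil l' (scol s)) (spos s) (phic_neq0 l' (scol s)).
  by rewrite es in h1; exact: has_lead_ord h1 h2.
apply: state_ext sl sl' _ => b; apply: contrapT => nb.
have [N wN] := within_exists l; have [N' wN'] := within_exists l'.
have bnd b' : inn l b' != inn l' b' -> b' \in Wbox (N + N').
  move=> nb'; apply: mem_Wbox; rewrite ltnNge; apply: contra nb' => big.
  have z (k : state (Gsystem mu nu)) n : within n k -> (n <= bsize b')%N -> inn k b' = ~~ Gpositive b'.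
    move=> [w1 w2] nb2; rewrite /inn; case: ifP => _ /=.
      by apply/negP => /w1; rewrite ltnNge nb2.
    by apply/negP => /w2; rewrite ltnNge nb2.
  by rewrite (z l N) ?(z l' N') //; lia.
pose D := [seq b' <- Wbox (N + N') | inn l b' != inn l' b'].
have bD : b \in D by rewrite mem_filter; apply/andP; split; [|apply: bnd]; apply/eqP.
have nD : D != [::] by case: (D) bD.
have [m Dm hm] := exists_max glt_irr glt_trans nD.
move: (Dm); rewrite mem_filter => /andP[/eqP nm _]; apply: nm; apply: lap_inj hl _ => b' g.
apply/eqP; apply: contraTT g => nb'; apply: hm.
by rewrite mem_filter nb' bnd.
Qed.

Lemma cK_inj l l' : St l -> St l' -> (forall i k, cK true l i k = cK true l' i k) -> l = l'.
Proof.
move=> Sl Sl' e; apply: phi_inj => // i.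
apply: (series_inj (expansion_series (cK_expansion true i Sl))).
apply: series_of_ext (expansion_series (cK_expansion true i Sl')) => k.
by rewrite e.
Qed.

(** The constants of the two components of [A] are [q2] and its inverse, so only
    [Psi] contributes. *)
Lemma phic_level l : phic l 0 * phic l 1 = q3.
Proof.
have B b : Bcst (site_of b) 0 * Bcst (site_of b) 1 = 1.
  have q0 := q2_neq0; rewrite /Bcst.
  by case: (scol (site_of b)) => -[|[|//]] i /=; rewrite ?mulVf ?mulfV.
have P : Pcst 0 * Pcst 1 = q3.
  rewrite /Pcst /= -mulrA /qpow -cexpD -mulrDl.
  have -> : - mu - 2 * nu + (mu + 2 * nu) = 0 by ring.
  by rewrite mul0r cexp0 mulr1.
have bs (A : {fset Gbox}) (f g : Gbox -> C) : (forall b, f b * g b = 1) ->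
    \prod_(b <- A | predT b) f b * \prod_(b <- A | predT b) g b = 1.
  by move=> h; rewrite -big_split /= big1.
have BV b : (Bcst (site_of b) 0)^-1 * (Bcst (site_of b) 1)^-1 = 1 by rewrite -invfM B invr1.
have Ac1 : Ac predT l 0 * Ac predT l 1 = 1.
  rewrite /Ac mulrACA (bs l.1 (fun b => Bcst (site_of b) 0) (fun b => Bcst (site_of b) 1) B).
  by rewrite (bs l.2 (fun b => (Bcst (site_of b) 0)^-1) (fun b => (Bcst (site_of b) 1)^-1) BV) mulr1.
by rewrite /phic mulrACA P Ac1 mulr1.
Qed.

(** ** The relations *)

(** The expansions are divided by their leading coefficients, the eigenvalues of
    the operators [K_i] and their inverses, and their logarithms are taken, as
    prescribed by the definition of [K_i^+(z)] and [K_i^-(z)]. *)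
Definition hH (i : 'Z_2) (r : int) l : C :=
  match r with
  | Posz n => slog (fun m => cK true l i m%:Z / cK true l i 0) n / qq
  | Negz n => - (slog (fun m => cK false l i (- m%:Z) / cK false l i 0) n.+1 / qq)
  end.

(** The relations, and later irreducibility and tameness, only use the action of
    the operators on the vectors [kt l] and the fact that these span; [opd true]
    is [E] and [opd false] is [F]. *)
Section Operators.
Variables (V : lmodType C) (kt : state (Gsystem mu nu) -> V).
Variable opd : bool -> 'Z_2 -> int -> {linear V -> V}.
Hypothesis opd_ket : forall d i k l N M, good N l -> (N.+2 <= M)%N ->
  opd d i k (kt l) = \sum_(b <- Wbox M) (emc d i l b * pos b ^ k) *: kt (tog d l b).
Hypothesis basis_ind : forall G : V -> V, linear G -> (forall l, St l -> G (kt l) = 0) ->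
  forall x, G x = 0.

Fixpoint nsum (X : {fset Gbox}) (n : nat) (G : seq Gbox -> V) : V :=
  if n is n'.+1 then \sum_(b <- X) nsum X n' (fun s : seq Gbox => G (b :: s)) else G [::].

Lemma eq_nsum X n G H : (forall s : seq Gbox, size s = n -> G s = H s) -> nsum X n G = nsum X n H.
Proof.
elim: n G H => [|n IH] G H h /=; first exact: h.
by apply: eq_bigr => b _; apply: IH => s e; apply: h; rewrite /= e.
Qed.

Lemma nsum_scale X n (a : C) G : nsum X n (fun s : seq Gbox => a *: G s) = a *: nsum X n G.
Proof.
elim: n G => [|n IH] G //=; rewrite scaler_sumr.
by apply: eq_bigr => b _; rewrite IH.
Qed.

Fixpoint opw d (w : seq ('Z_2 * int)) (v : V) : V :=
  if w is (i, k) :: w' then opw d w' (opd d i k v) else v.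
Lemma opw_sum d (w : seq ('Z_2 * int)) (I : Type) (r : seq I) (a : I -> C) (x_ : I -> V) :
  opw d w (\sum_(x <- r) a x *: x_ x) = \sum_(x <- r) a x *: opw d w (x_ x).
Proof.
elim: w x_ => [|[i k] w IH] x_ //=.
have -> : opd d i k (\sum_(x <- r) a x *: x_ x) = \sum_(x <- r) a x *: opd d i k (x_ x).
  by rewrite linear_sum; apply: eq_bigr => x _; rewrite linearZ.
exact: IH.
Qed.

(** Each letter increases the bound on the sizes of the boxes of a state by at
    most two; hence the size of the set over which the sums run. *)
Lemma opw_ket d (w : seq ('Z_2 * int)) l N M : good N l -> (N + (size w).*2 <= M)%N ->
  opw d w (kt l)
  = nsum (Wbox M) (size w) (fun s : seq Gbox => (emw d l s * wt w s) *: kt (togw d l s)).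
Proof.
elim: w l N => [|[i k] w IH] l N gl /=; first by rewrite mulr1 scale1r.
move=> NM; rewrite (opd_ket d i k gl (M := M)); last lia.
rewrite opw_sum; apply: eq_bigr => b _.
have [ob|nb] := EM (okd d l b); last first.
  rewrite emc0 // mul0r scale0r.
  rewrite (eq_nsum _ (H := fun s : seq Gbox => 0 *: kt l)) ?nsum_scale ?scale0r // => s _.
  by rewrite em0 // !mul0r !scale0r.
rewrite (IH _ _ (good_tog gl ob)); last lia.
rewrite -nsum_scale; apply: eq_nsum => s _; rewrite scalerA.
have -> : emc d i l b * pos b ^ k * (emw d (tog d l b) s * wt w s)
  = em d l b * emw d (tog d l b) s * ((if Gcolor b == i then pos b ^ k else 0) * wt w s).
  by rewrite /emc; case: ifP => _; rewrite ?mul0r ?mulr0 // mulrACA.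
by [].
Qed.

Definition indic (i j : 'Z_2) u v : C := if (Gcolor u == i) && (Gcolor v == j) then 1 else 0.

Lemma opd_opd d i j l N M (k n : int) : good N l -> (N + 4 <= M)%N ->
  opd d i k (opd d j n (kt l)) =
  \sum_(u <- Wbox M) \sum_(v <- Wbox M)
    (indic i j u v * emw d l [:: v; u]) *: ((pos u ^ k * pos v ^ n) *: kt (tog d (tog d l v) u)).
Proof.
move=> gl NM.
have -> : opd d i k (opd d j n (kt l)) = \sum_(v <- Wbox M) \sum_(u <- Wbox M)
    (emw d l [:: v; u] * wt [:: (j, n); (i, k)] [:: v; u]) *: kt (togw d l [:: v; u]).
  exact: (@opw_ket d [:: (j, n); (i, k)] l N M gl NM).
rewrite sumC; apply: eq_bigr => u _; apply: eq_bigr => v _; rewrite scalerA /togw /=.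
have -> // : em d l v * (em d (tog d l v) u * 1) *
    ((if Gcolor v == j then pos v ^ n else 0) * ((if Gcolor u == i then pos u ^ k else 0) * 1))
  = indic i j u v * (em d l v * (em d (tog d l v) u * 1)) * (pos u ^ k * pos v ^ n).
rewrite /indic; move: (em d l v) (em d _ u) (pos v ^ n) (pos u ^ k) => e1 e2 p1 p2.
by case: (Gcolor u == i); case: (Gcolor v == j) => /=; ring.
Qed.

Lemma emw_dup d l u : Gstates l -> emw d l [:: u; u] = 0.
Proof.
move=> Sl; apply/eqP; apply: contraT => /(emw_convd Sl)[/=].
by rewrite inE eqxx.
Qed.

Lemma exchange_scalar d (i j : 'Z_2) l u v : Gstates l ->
  (-1) ^+ (i + j)%N * (indic i j u v * emw d l [:: v; u])
    * gfun (if d then i else j) (if d then j else i) (if d then pos u else pos v)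
           (if d then pos v else pos u)
  + indic i j u v * emw d l [:: u; v]
    * gfun (if d then j else i) (if d then i else j) (if ~~ d then pos u else pos v)
           (if ~~ d then pos v else pos u) = 0.
Proof.
move=> Sl.
have g0 (F : fieldType) (s e1 e2 g1 g2 : F) : s * (0 * e1) * g1 + 0 * e2 * g2 = 0 by ring.
have g1 (F : fieldType) (s e1 e2 g1 g2 : F) : s * g1 * e1 + g2 * e2 = 0 ->
    s * (1 * e1) * g1 + 1 * e2 * g2 = 0 by move=> <-; ring.
rewrite /indic; case: ifP => [/andP[/eqP cu /eqP cv]|_]; last exact: g0.
apply: g1; have [e|uv] := eqVneq u v.
  by rewrite e (emw_dup d v Sl) [X in X + _]mulr0 [X in _ + X]mulr0 addr0.
have := exchange_coef d Sl uv; rewrite /csign cu cv.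
have -> : gfun (if d then i else j) (if d then j else i) (if d then pos u else pos v)
   (if d then pos v else pos u) = ggd d u v by rewrite /gfun /ggd /gg cu cv; case: (d).
have -> // : gfun (if d then j else i) (if d then i else j) (if ~~ d then pos u else pos v)
   (if ~~ d then pos v else pos u) = ggd d v u by rewrite /gfun /ggd /gg cu cv; case: (d).
Qed.

Lemma opd_exchange d (i j : 'Z_2) (k n : int) (x : V) :
  (-1) ^+ (i + j)%N *: mul_g lq ld (if d then i else j) (if d then j else i) (mz d) (mz (~~ d))
     (fun k' n' => opd d i k' (opd d j n' x)) k n
  + mul_g lq ld (if d then j else i) (if d then i else j) (mz (~~ d)) (mz (~~ ~~ d))
     (fun k' n' => opd d j n' (opd d i k' x)) k n = 0.
Proof.
move: x; apply: basis_ind => [|l Sl].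
  exact: exchange_linear.
pose N := radius l; have gl : good N l := good_radius Sl.
rewrite (mul_g_ext _ _ _ _ _ (fun k' n' => opd_opd d i j k' n' gl (leqnn _))).
have h2 k' n' : opd d j n' (opd d i k' (kt l)) = \sum_(u <- Wbox (N + 4)) \sum_(v <- Wbox (N + 4))
    (indic i j u v * emw d l [:: u; v]) *: ((pos u ^ k' * pos v ^ n') *: kt (tog d (tog d l v) u)).
  rewrite (opd_opd d j i n' k' gl (leqnn _)) sumC.
  apply: eq_bigr => u _; apply: eq_bigr => v _.
  by rewrite togC [pos v ^ _ * _]mulrC /indic andbC.
rewrite (mul_g_ext _ _ _ _ _ h2) !mul_g_sum scaler_sumr -big_split /= big1 // => u _.
rewrite !mul_g_sum scaler_sumr -big_split /= big1 // => v _.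
rewrite !mul_g_scale !mul_g_mono ?spos_neq0 // !scalerA -scalerDl -mulrDl.
by rewrite (exchange_scalar d i j u v Sl) mul0r scale0r.
Qed.

Section FourSums.
Variables (X : seq Gbox).
Implicit Types G : Gbox -> Gbox -> Gbox -> Gbox -> V.
Definition sum4 G : V :=
  \sum_(a <- X) \sum_(b <- X) \sum_(c <- X) \sum_(y <- X) G a b c y.
Lemma sum4_12 G : sum4 G = sum4 (fun a b c y => G b a c y).
Proof. by rewrite /sum4 sumC. Qed.
Lemma sum4_23 G : sum4 G = sum4 (fun a b c y => G a c b y).
Proof. by rewrite /sum4; apply: eq_bigr => a _; rewrite sumC. Qed.
Lemma sum4_34 G : sum4 G = sum4 (fun a b c y => G a b y c).
Proof. by rewrite /sum4; apply: eq_bigr => a _; apply: eq_bigr => b _; rewrite sumC. Qed.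
Lemma eq_sum4 G G' : (forall a b c y, G a b c y = G' a b c y) -> sum4 G = sum4 G'.
Proof.
by move=> h; do 4 (apply: eq_bigr => ? _).
Qed.
Lemma sum4D G G' : sum4 G + sum4 G' = sum4 (fun a b c y => G a b c y + G' a b c y).
Proof. by rewrite /sum4; do 4 (rewrite -big_split; apply: eq_bigr => ? _). Qed.
Lemma sum4Z (r : C) G : r *: sum4 G = sum4 (fun a b c y => r *: G a b c y).
Proof. by rewrite /sum4; do 4 (rewrite scaler_sumr; apply: eq_bigr => ? _). Qed.
Lemma sum4B G G' : sum4 G - sum4 G' = sum4 (fun a b c y => G a b c y - G' a b c y).
Proof. by rewrite /sum4; do 4 (rewrite -sumrB; apply: eq_bigr => ? _). Qed.
Lemma sum4_comb (r p : C) G1 G2 G3 G4 G5 G6 G7 G8 :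
  sum4 G1 - r *: sum4 G2 - (sum4 G3 - r *: sum4 G4)
  - p *: (sum4 G5 - r *: sum4 G6 - (sum4 G7 - r *: sum4 G8))
  = sum4 (fun a b c y => G1 a b c y - r *: G2 a b c y - (G3 a b c y - r *: G4 a b c y)
      - p *: (G5 a b c y - r *: G6 a b c y - (G7 a b c y - r *: G8 a b c y))).
Proof. by rewrite !sum4Z !sum4B sum4Z sum4B. Qed.
End FourSums.

Definition nested d i (k0 k1 k2 m : int) (x : V) : V :=
  qbracket (q ^- 2) (opd d i k0) (qbracket 1 (opd d i k1)
    (qbracket (q ^+ 2) (opd d i k2) (opd d (i + 1) m))) x.

Definition wt4 i (k0 k1 k2 m : int) (a b c y : Gbox) : C :=
  wt [:: (i, k0); (i, k1); (i, k2); (i + 1, m)] [:: a; b; c; y].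

(** The eight orders in which the four operators of the nested commutator act are
    relabelled so that [a], [b], [c], [y] always stand for the boxes processed by
    the operators with modes [k0], [k1], [k2], [m].  Then mode factors and the
    final state are common to the eight terms. *)
Lemma nested_ket d i k0 k1 k2 m l N M : good N l -> (N + 8 <= M)%N ->
  nested d i k0 k1 k2 m (kt l) = sum4 (Wbox M) (fun a b c y =>
    (serre3 q2 q2^-1 (emw d l) a b c y * wt4 i k0 k1 k2 m a b c y)
      *: kt (togw d l [:: a; b; c; y])).
Proof.
move=> gl NM.
pose A := opd d i k0; pose B := opd d i k1; pose D := opd d i k2; pose Y := opd d (i + 1) m.
pose T W := sum4 (Wbox M) (fun a b c y =>
  (emw d l (W a b c y) * wt4 i k0 k1 k2 m a b c y) *: kt (togw d l [:: a; b; c; y])).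
pose x := kt l.
have word (n1 n2 n3 n4 : 'Z_2 * int) : opw d [:: n1; n2; n3; n4] x = sum4 (Wbox M) (fun a b c y =>
      (emw d l [:: a; b; c; y] * wt [:: n1; n2; n3; n4] [:: a; b; c; y]) *: kt (togw d l [:: a; b; c; y])).
  exact: (@opw_ket d [:: n1; n2; n3; n4] l N M gl NM).
have term (e w1 w2 : C) (s1 s2 : seq Gbox) : w1 = w2 -> perm_eq s1 s2 ->
    (e * w1) *: kt (togw d l s1) = (e * w2) *: kt (togw d l s2).
  by move=> -> p; rewrite (togw_perm d l p).
have W1 : A (B (D (Y x))) = T (fun a b c y => [:: y; c; b; a]).
  rewrite -[LHS]/(opw d [:: (i + 1, m); (i, k2); (i, k1); (i, k0)] x) word /T [RHS]sum4_12 [RHS]sum4_23 [RHS]sum4_12 [RHS]sum4_34 [RHS]sum4_23 [RHS]sum4_12.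
  apply: eq_sum4 => a b c y; apply: term; last by apply/seq.permP => f /=; lia.
  by rewrite /wt4 !wtE; apply: perm_big; apply/seq.permP => f /=; ring.
have W2 : A (B (Y (D x))) = T (fun a b c y => [:: c; y; b; a]).
  rewrite -[LHS]/(opw d [:: (i, k2); (i + 1, m); (i, k1); (i, k0)] x) word /T [RHS]sum4_12 [RHS]sum4_23 [RHS]sum4_12 [RHS]sum4_34 [RHS]sum4_23.
  apply: eq_sum4 => a b c y; apply: term; last by apply/seq.permP => f /=; lia.
  by rewrite /wt4 !wtE; apply: perm_big; apply/seq.permP => f /=; ring.
have W3 : A (D (Y (B x))) = T (fun a b c y => [:: b; y; c; a]).
  rewrite -[LHS]/(opw d [:: (i, k1); (i + 1, m); (i, k2); (i, k0)] x) word /T [RHS]sum4_12 [RHS]sum4_23 [RHS]sum4_34 [RHS]sum4_23.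
  apply: eq_sum4 => a b c y; apply: term; last by apply/seq.permP => f /=; lia.
  by rewrite /wt4 !wtE; apply: perm_big; apply/seq.permP => f /=; ring.
have W4 : A (Y (D (B x))) = T (fun a b c y => [:: b; c; y; a]).
  rewrite -[LHS]/(opw d [:: (i, k1); (i, k2); (i + 1, m); (i, k0)] x) word /T [RHS]sum4_12 [RHS]sum4_23 [RHS]sum4_34.
  apply: eq_sum4 => a b c y; apply: term; last by apply/seq.permP => f /=; lia.
  by rewrite /wt4 !wtE; apply: perm_big; apply/seq.permP => f /=; ring.
have W5 : B (D (Y (A x))) = T (fun a b c y => [:: a; y; c; b]).
  rewrite -[LHS]/(opw d [:: (i, k0); (i + 1, m); (i, k2); (i, k1)] x) word /T [RHS]sum4_23 [RHS]sum4_34 [RHS]sum4_23.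
  apply: eq_sum4 => a b c y; apply: term; last by apply/seq.permP => f /=; lia.
  by rewrite /wt4 !wtE; apply: perm_big; apply/seq.permP => f /=; ring.
have W6 : B (Y (D (A x))) = T (fun a b c y => [:: a; c; y; b]).
  rewrite -[LHS]/(opw d [:: (i, k0); (i, k2); (i + 1, m); (i, k1)] x) word /T [RHS]sum4_23 [RHS]sum4_34.
  apply: eq_sum4 => a b c y; apply: term; last by apply/seq.permP => f /=; lia.
  by rewrite /wt4 !wtE; apply: perm_big; apply/seq.permP => f /=; ring.
have W7 : D (Y (B (A x))) = T (fun a b c y => [:: a; b; y; c]).
  rewrite -[LHS]/(opw d [:: (i, k0); (i, k1); (i + 1, m); (i, k2)] x) word /T [RHS]sum4_34.
  apply: eq_sum4 => a b c y; apply: term; last by apply/seq.permP => f /=; lia.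
  by rewrite /wt4 !wtE; apply: perm_big; apply/seq.permP => f /=; ring.
have W8 : Y (D (B (A x))) = T (fun a b c y => [:: a; b; c; y]).
  rewrite -[LHS]/(opw d [:: (i, k0); (i, k1); (i, k2); (i + 1, m)] x) word /T.
  apply: eq_sum4 => a b c y; apply: term; last by apply/seq.permP => f /=; lia.
  by rewrite /wt4 !wtE; apply: perm_big; apply/seq.permP => f /=; ring.
have -> : nested d i k0 k1 k2 m x = A (B (D (Y x))) - q2 *: A (B (Y (D x)))
    - (A (D (Y (B x))) - q2 *: A (Y (D (B x))))
    - q2^-1 *: (B (D (Y (A x))) - q2 *: B (Y (D (A x))) - (D (Y (B (A x))) - q2 *: Y (D (B (A x))))).
  by rewrite /nested /qbracket !scale1r !linearB !linearZ.
rewrite W1 W2 W3 W4 W5 W6 W7 W8 {W1 W2 W3 W4 W5 W6 W7 W8 word term} /T sum4_comb.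
apply: eq_sum4 => a b c y; rewrite /serre3.
move: (emw d l) (wt4 _ _ _ _ _ _ _ _ _) (q2^-1) (Defs.q2 lq) (kt _) => W z p r K.
by rewrite !(scalerA, =^~ scalerBl); congr (_ *: _); ring.
Qed.

(** Permuting the modes of the nested commutator and then relabelling the boxes
    amounts to symmetrizing the coefficient over the three boxes of color [i],
    with fixed mode factors, so [serre_coef] applies. *)
Lemma opd_serre d i (k : 'I_3 -> int) (m : int) (x : V) :
  \sum_(s : 'S_3) nested d i (k (s ord0)) (k (s (inord 1))) (k (s (inord 2))) m x = 0.
Proof.
move: x; apply: basis_ind => [a x y|l Sl].
  rewrite scaler_sumr -big_split; apply: eq_bigr => s _.
  by apply: qbracket_linear; [exact: linearP | apply: qbracket_linear;
    [exact: linearP | apply: qbracket_linear; exact: linearP]].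
pose N := radius l; have gl : good N l := good_radius Sl.
rewrite (sum_perm3 (fun i0 i1 i2 => nested d i (k i0) (k i1) (k i2) m (kt l))).
rewrite !(nested_ket _ _ _ _ _ _ gl (leqnn _)).
move: (k ord0) (k (inord 1)) (k (inord 2)) => k0 k1 k2.
pose T W := sum4 (Wbox (N + 8)) (fun a b c y =>
  (serre3 q2 q2^-1 (emw d l) (W a b c).1.1 (W a b c).1.2 (W a b c).2 y * wt4 i k0 k1 k2 m a b c y)
    *: kt (togw d l [:: a; b; c; y])).
have term (e w1 w2 : C) (s1 s2 : seq Gbox) : w1 = w2 -> perm_eq s1 s2 ->
    (e * w1) *: kt (togw d l s1) = (e * w2) *: kt (togw d l s2).
  by move=> -> p; rewrite (togw_perm d l p).
rewrite [X in _ + X + _ + _ + _ + _](_ : _ = T (fun a b c => (a, c, b))); last first.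
  rewrite /T [RHS]sum4_23; apply: eq_sum4 => a b c y; apply: term; last by apply/seq.permP => f /=; lia.
  by rewrite /wt4 !wtE; apply: perm_big; apply/seq.permP => f /=; ring.
rewrite [X in _ + _ + X + _ + _ + _](_ : _ = T (fun a b c => (b, a, c))); last first.
  rewrite /T [RHS]sum4_12; apply: eq_sum4 => a b c y; apply: term; last by apply/seq.permP => f /=; lia.
  by rewrite /wt4 !wtE; apply: perm_big; apply/seq.permP => f /=; ring.
rewrite [X in _ + _ + _ + X + _ + _](_ : _ = T (fun a b c => (b, c, a))); last first.
  rewrite /T [RHS]sum4_12 [RHS]sum4_23; apply: eq_sum4 => a b c y; apply: term; last by apply/seq.permP => f /=; lia.
  by rewrite /wt4 !wtE; apply: perm_big; apply/seq.permP => f /=; ring.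
rewrite [X in _ + _ + _ + _ + X + _](_ : _ = T (fun a b c => (c, a, b))); last first.
  rewrite /T [RHS]sum4_23 [RHS]sum4_12; apply: eq_sum4 => a b c y; apply: term; last by apply/seq.permP => f /=; lia.
  by rewrite /wt4 !wtE; apply: perm_big; apply/seq.permP => f /=; ring.
rewrite [X in _ + _ + _ + _ + _ + X](_ : _ = T (fun a b c => (c, b, a))); last first.
  rewrite /T [RHS]sum4_12 [RHS]sum4_23 [RHS]sum4_12; apply: eq_sum4 => a b c y; apply: term; last by apply/seq.permP => f /=; lia.
  by rewrite /wt4 !wtE; apply: perm_big; apply/seq.permP => f /=; ring.
rewrite /T !sum4D /=.
rewrite /sum4 big1 // => a _; rewrite big1 // => b _; rewrite big1 // => c _; rewrite big1 // => y _.
suff: serre_sum q2 q2^-1 (emw d l) a b c y * wt4 i k0 k1 k2 m a b c y = 0 by exact: factor6.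
have [e|] := eqVneq (wt4 i k0 k1 k2 m a b c y) 0; first by rewrite e mulr0.
rewrite /wt4 /= !mulf_eq0 !negb_or => /and5P[ca cb cc cy _].
have col (j : 'Z_2) b' (z : C) : (if Gcolor b' == j then z else 0) != 0 -> Gcolor b' = j.
  by move=> h; apply/eqP; apply: contraNT h => /negPf ->; exact: eqxx.
have e := serre_coef d Sl (a := a) (b := b) (c := c) (y := y).
rewrite (col _ _ _ ca) (col _ _ _ cb) (col _ _ _ cc) (col _ _ _ cy) in e.
by rewrite (e erefl erefl erefl) mul0r.
Qed.

Lemma opd_comp (f : {linear V -> V}) d i k l N M (G : Gbox -> V) :
  good N l -> (N.+2 <= M)%N ->
  (forall b, okd d l b -> f (kt (tog d l b)) = G b) ->
  f (opd d i k (kt l)) = \sum_(b <- Wbox M) (emc d i l b * pos b ^ k) *: G b.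
Proof.
move=> gl NM h; rewrite (opd_ket d i k gl NM) linear_sum; apply: eq_bigr => b _.
rewrite linearZ /=; have [/h -> //|/(emc0 i) ->] := EM (okd d l b).
by rewrite !mul0r !scale0r.
Qed.

Variable Dop : (state (Gsystem mu nu) -> C) -> {linear V -> V}.
Hypothesis Dop_ket : forall f l, St l -> Dop f (kt l) = f l *: kt l.

Definition Kop (s : bool) i (k : int) : {linear V -> V} := Dop (fun l => cK s l i k).

Lemma Kop_ket (s : bool) i k l : St l -> Kop s i k (kt l) = cK s l i k *: kt l.
Proof. exact: Dop_ket. Qed.

(** [g] acts on the product of the expansion of an l-weight and a delta function
    at [p(b)] through the polynomials [gpoly1] and [gpoly2] ([mul_g_series1],
    [mul_g_series2]), and these relate the l-weights before and after the step
    ([cK_remove], [cK_add]). *)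
Lemma K_exchange d (s : bool) (i j : 'Z_2) (k n : int) (x : V) :
  (-1) ^+ (i + j)%N *: mul_g lq ld (if d then i else j) (if d then j else i) (mz d) (mz (~~ d))
     (fun k' n' => Kop s i k' (opd d j n' x)) k n
  + mul_g lq ld (if d then j else i) (if d then i else j) (mz (~~ d)) (mz (~~ ~~ d))
     (fun k' n' => opd d j n' (Kop s i k' x)) k n = 0.
Proof.
move: x; apply: basis_ind => [|l Sl]; first exact: exchange_linear.
pose N := radius l; have gl : good N l := good_radius Sl.
have h1 k' n' : Kop s i k' (opd d j n' (kt l)) = \sum_(b <- Wbox N.+2)
    emc d j l b *: ((cK s (tog d l b) i k' * pos b ^ n') *: kt (tog d l b)).
  rewrite (@opd_comp _ _ _ _ _ N N.+2 (fun b => cK s (tog d l b) i k' *: kt (tog d l b))) //.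
    by apply: eq_bigr => b _; rewrite !scalerA [cK _ _ _ _ * _]mulrC mulrA.
  by move=> b ob; rewrite Kop_ket //; apply: okd_state ob.
have h2 k' n' : opd d j n' (Kop s i k' (kt l)) = \sum_(b <- Wbox N.+2)
    emc d j l b *: ((cK s l i k' * pos b ^ n') *: kt (tog d l b)).
  rewrite (Kop_ket _ _ _ Sl) linearZ /= (opd_ket _ _ _ gl (leqnn _)) scaler_sumr.
  by apply: eq_bigr => b _; rewrite !scalerA mulrCA.
rewrite (mul_g_ext _ _ _ _ _ h1) (mul_g_ext _ _ _ _ _ h2) !mul_g_sum scaler_sumr -big_split /=.
rewrite big1 // => b _; rewrite !mul_g_scale scalerA [_ * emc _ _ _ _]mulrC -scalerA -scalerDr.
have [ob|/(emc0 j) ->] := EM (okd d l b); last by rewrite scale0r.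
rewrite /emc; case: eqP => [cb|_]; last by rewrite scale0r.
rewrite [X in _ *: X](_ : _ = 0) ?scaler0 //.
have ss : (-1) ^+ (i + j)%N * (-1) ^+ (i + j)%N = 1 :> C by rewrite -expr2 exprAC sqrrN !expr1n.
case: d ob {h1 h2} => ob; rewrite /= (mul_g_series1 _ _ _ _ _ _ (spos_neq0 _)) (mul_g_series2 _ _ _ _ _ _ (spos_neq0 _)).
  by rewrite -cb (cK_remove s i k Sl ob) scaleNr subrr.
by rewrite -cb (cK_add s i k Sl ob) scalerA mulrN cb ss scaleN1r addNr.
Qed.

Lemma EF_off i j l u v (k n : int) : St l -> u != v ->
  emc false j l v * pos v ^ n * (emc true i (add_box l v) u * pos u ^ k)
  = emc true i l u * pos u ^ k * (emc false j (remove_box l u) v * pos v ^ n).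
Proof.
move=> Sl uv; have e := em_remove_add Sl uv; rewrite /emc.
have gen0 (F : fieldType) (a b c a' b' : F) : a * b = a' * b' -> forall x y, a * x * (b * y) = a' * y * (b' * x).
  by move=> h x y; rewrite mulrACA h [RHS]mulrACA [y * x]mulrC.
apply: gen0; case: (Gcolor v == j); case: (Gcolor u == i); rewrite ?mul0r ?mulr0 //.
Qed.

Lemma EF_pair i j l u v (k n : int) : St l ->
  (emc false j l v * pos v ^ n) *: ((emc true i (add_box l v) u * pos u ^ k) *: kt (remove_box (add_box l v) u))
  - (emc true i l u * pos u ^ k) *: ((emc false j (remove_box l u) v * pos v ^ n) *: kt (add_box (remove_box l u) v))
  = if (v == u) && (i == j) then
      (qq^-1 * ((if corner l u && (Gcolor u == i) then res_phi l i u else 0) * pos u ^ (k + n))) *: kt l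
    else 0.
Proof.
move=> Sl; rewrite !scalerA; have [e|vu] := eqVneq v u; last first.
  have uv : u != v by rewrite eq_sym.
  by rewrite (EF_off _ _ _ _ Sl uv) (remove_addC _ vu) subrr.
rewrite e.
have E1 : (emc false j l u * pos u ^ n * (emc true i (add_box l u) u * pos u ^ k)) *: kt (remove_box (add_box l u) u)
   = (emc false j l u * pos u ^ n * (emc true i (add_box l u) u * pos u ^ k)) *: kt l.
  have [ob|/(emc0 j) ->] := EM (okd false l u); last by rewrite !mul0r !scale0r.
  have [iu _] := iffLR (okdP _ _ Sl) ob.
  by have := togK (Gstates_signed Sl) iu; rewrite /tog /= => ->.
have E2 : (emc true i l u * pos u ^ k * (emc false j (remove_box l u) u * pos u ^ n)) *: kt (add_box (remove_box l u) u)
   = (emc true i l u * pos u ^ k * (emc false j (remove_box l u) u * pos u ^ n)) *: kt l.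
  have [ob|/(emc0 i) ->] := EM (okd true l u); last by rewrite !mul0r !scale0r.
  have [iu _] := iffLR (okdP _ _ Sl) ob.
  by have := togK (Gstates_signed Sl) iu; rewrite /tog /= => ->.
rewrite E1 E2 -scalerBl /= /emc; have pw : pos u ^ (k + n) = pos u ^ k * pos u ^ n.
  by rewrite expfzDr // spos_neq0.
have [ij|ij] := eqVneq i j.
  rewrite -ij /=; case: (Gcolor u =P i) => [cu|_]; last by rewrite andbF !mul0r mulr0 subrr.
  rewrite andbT; have := em_remove_add_diag u Sl; rewrite cu pw => h.
  by rewrite (EF_scalar _ _ h).
case: (Gcolor u =P j) => [cu|_]; last by rewrite !mul0r mulr0 subrr scale0r.
by rewrite cu eq_sym (negPf ij) !mul0r mulr0 subrr scale0r.
Qed.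

(** Only the terms in which the same box is added and removed survive; they are
    the residues at the corners, and sum to the difference of the two expansions
    of the l-weight ([cK_difference]). *)
Lemma EF_relation (i j : 'Z_2) (k n : int) (x : V) :
  opd true i k (opd false j n x) - opd false j n (opd true i k x)
  = if i == j then qq^-1 *: (Kop true i (k + n) x - Kop false i (k + n) x) else 0.
Proof.
suff h : forall x, opd true i k (opd false j n x) - opd false j n (opd true i k x)
  - (if i == j then qq^-1 *: (Kop true i (k + n) x - Kop false i (k + n) x) else 0) = 0.
  by apply/eqP; rewrite -subr_eq0 h.
move=> {}x; move: x; apply: basis_ind => [|l Sl].
  apply: linear_sub; first by apply: linear_sub => b x' y'; rewrite !linearP.
  apply: (@linear_if _ _ (i == j) qq^-1 (fun x => Kop true i (k + n) x - Kop false i (k + n) x)).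
  by apply: linear_sub => b x' y'; rewrite linearP.
pose N := radius l; have gl : good N l := good_radius Sl; pose M := N.+4.
have NM : (N.+2 <= M)%N by rewrite /M; lia.
have h1 : opd true i k (opd false j n (kt l)) = \sum_(u <- Wbox M) \sum_(v <- Wbox M)
  (emc false j l v * pos v ^ n) *: ((emc true i (add_box l v) u * pos u ^ k) *: kt (remove_box (add_box l v) u)).
  rewrite sumC (@opd_comp _ _ _ _ _ N M (fun v => \sum_(u <- Wbox M)
    (emc true i (add_box l v) u * pos u ^ k) *: kt (remove_box (add_box l v) u))) //; last first.
    by move=> v ov; rewrite (opd_ket true i k (good_tog gl ov) (leqnn _)).
  by apply: eq_bigr => v _; rewrite scaler_sumr.
have h2 : opd false j n (opd true i k (kt l)) = \sum_(u <- Wbox M) \sum_(v <- Wbox M)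
  (emc true i l u * pos u ^ k) *: ((emc false j (remove_box l u) v * pos v ^ n) *: kt (add_box (remove_box l u) v)).
  rewrite (@opd_comp _ _ _ _ _ N M (fun u => \sum_(v <- Wbox M)
    (emc false j (remove_box l u) v * pos v ^ n) *: kt (add_box (remove_box l u) v))) //; last first.
    by move=> v ov; rewrite (opd_ket false j n (good_tog gl ov) (leqnn _)).
  by apply: eq_bigr => u _; rewrite scaler_sumr.
rewrite h1 h2 -sumrB.
rewrite (eq_bigr (fun u => \sum_(v <- Wbox M) if (v == u) && (i == j) then
      (qq^-1 * ((if corner l u && (Gcolor u == i) then res_phi l i u else 0) * pos u ^ (k + n))) *: kt l
    else 0)); last first.
  by move=> u _; rewrite -sumrB; apply: eq_bigr => v _; exact: EF_pair.
case: eqP => [ij|_]; last first.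
  by rewrite big1 ?subr0 // => u _; rewrite big1 // => v _; rewrite andbF.
rewrite !(Kop_ket _ _ _ Sl) -scalerBl scalerA.
rewrite (cK_difference i (X := Wbox M)) //; last first.
  move=> b /asboolP hb; apply: (@mem_Wbox M).
  have [_ wl] := gl; suff : (bsize b < N.+2)%N by rewrite /M; lia.
  by case: hb => hb; exact: (okd_bsize Sl wl hb).
apply/eqP; rewrite subr_eq0; apply/eqP.
rewrite mulr_sumr scaler_suml; apply: eq_big_seq => u uM.
rewrite (bigD1_seq u) ?fset_uniq // eqxx big1; last by move=> v /negPf ->.
exact: addr0.
Qed.

(** ** The module *)
Definition Mops : toroidal_ops V :=
  ToroidalOps (opd true) (opd false) (fun i r => Dop (hH i r))
    (fun i => Kop true i 0) (fun i => Kop false i 0) idfun idfun.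

Lemma eq_on_kets (f g : V -> V) : linear f -> linear g ->
  (forall l, St l -> f (kt l) = g (kt l)) -> forall x, f x = g x.
Proof.
move=> lf lg h x; apply/eqP; rewrite -subr_eq0; apply/eqP; move: x.
apply: basis_ind; first exact: linear_sub.
by move=> l Sl; rewrite h // subrr.
Qed.

Lemma cK_neq0 (s : bool) l i : St l -> cK s l i 0 != 0.
Proof.
move=> Sl; have [_ e] := cK_zero i Sl.
by apply: contra_eq_neq e => /eqP; case: s => /eqP ->; rewrite ?mul0r ?mulr0 eq_sym oner_neq0.
Qed.

(** On a state [H_{i,r}] is a scalar, so the exponential of the series of
    operators is the scalar exponential, which recovers the expansion whose
    logarithm was taken. *)
Lemma Kser_Kop (s : bool) i k x : Kser lq Mops s i k x = Kop s i k x.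
Proof.
have lZ (a : C) (f : {linear V -> V}) : linear (fun x => a *: f x).
  by move=> b y z; rewrite linearP scalerDr !scalerA mulrC.
have lc (f : {linear V -> V}) (g : V -> V) : linear g -> linear (fun x => f (g x)).
  by move=> lg b y z; rewrite lg linearP.
have l0 : linear (fun _ : V => 0 : V) by move=> b y z; rewrite scaler0 addr0.
move: x; case: s => /=.
  case: k => [n|n]; last first.
    apply: eq_on_kets => [||l Sl]; [exact: l0 | exact: linearP |].
    by have [_ z] := cK_expansion true i Sl; rewrite Kop_ket // z // scale0r.
  have lh r : linear (fun u : V => qq *: Dop (hH i r%:Z) u) by exact: lZ.
  apply: eq_on_kets => [||l Sl]; [exact: (lc (Kop true i 0) _ (exp_coef_linear n lh)) | exact: linearP |].
  rewrite /Kplus /= (exp_coef_eigen n (e := slog (fun m => cK true l i m%:Z / cK true l i 0)) lh) => [|r].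
    rewrite linearZ /= !Kop_ket // sexp_slog ?mulfV ?cK_neq0 // scalerA.
    by rewrite mulfVK ?cK_neq0.
  by rewrite Dop_ket // scalerA /hH mulrC divfK // qq_neq0.
rewrite /Kminus; case en : (- k) => [n|n]; last first.
  apply: eq_on_kets => [||l Sl]; [exact: l0 | exact: linearP |].
  by have [_ z] := cK_expansion false i Sl; rewrite Kop_ket // z ?scale0r //; lia.
have -> : k = - n%:Z by rewrite -en opprK.
have lh r : linear (fun u : V => - qq *: Dop (hH i (- r%:Z)) u) by exact: lZ.
apply: eq_on_kets => [||l Sl]; [exact: (lc (Kop false i 0) _ (exp_coef_linear n lh)) | exact: linearP |].
rewrite /= (exp_coef_eigen n (e := slog (fun m => cK false l i (- m%:Z) / cK false l i 0)) lh) => [|r].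
  rewrite linearZ /= !Kop_ket // sexp_slog ?oppr0 ?mulfV ?cK_neq0 // scalerA.
  by rewrite mulfVK ?cK_neq0.
rewrite Dop_ket // scalerA; case: r => [|r].
  by rewrite oppr0 /hH /slog /= mul0r mulr0.
have -> : - r.+1%:Z = Negz r by rewrite NegzE.
by rewrite /hH mulrNN mulrC divfK // qq_neq0.
Qed.

Lemma Dop_comm f g x : Dop f (Dop g x) = Dop g (Dop f x).
Proof.
move: x; apply: eq_on_kets => [a x y|a x y|l Sl]; rewrite ?linearP //.
by rewrite (Dop_ket g Sl) (Dop_ket f Sl) !linearZ /= (Dop_ket f Sl) (Dop_ket g Sl) !scalerA mulrC.
Qed.

Lemma Kop_inv i x : Kop true i 0 (Kop false i 0 x) = x.
Proof.
move: x; apply: eq_on_kets => [a x y|a x y|l Sl]; rewrite ?linearP //.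
rewrite Kop_ket // linearZ /= Kop_ket // scalerA mulrC.
by have [_ ->] := cK_zero i Sl; rewrite scale1r.
Qed.

Lemma M_toroidal : toroidal_module lq ld Mops.
Proof.
have kE (s : bool) i : Kser lq Mops s i = fun k x => Kop s i k x.
  by apply/funext => k; apply/funext => x; exact: Kser_Kop.
split=> //.
- move=> i x; exact: Kop_inv.
- by move=> i x /=; rewrite /Kop Dop_comm; exact: Kop_inv.
- by move=> s s' i j k l x; rewrite !kE; exact: Dop_comm.
- by move=> s i j k l x; rewrite kE; exact: (K_exchange true s i j k l x).
- by move=> s i j k l x; rewrite kE; exact: (K_exchange false s i j k l x).
- move=> i j k l x; rewrite -[Kplus _ _ _ _ _]/(Kser lq Mops true i (k + l) x).
  rewrite -[Kminus _ _ _ _ _]/(Kser lq Mops false i (k + l) x) !Kser_Kop.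
  exact: EF_relation.
- by move=> i j k l x; exact: (opd_exchange true i j k l x).
- by move=> i j k l x; exact: (opd_exchange false i j k l x).
- by move=> i k l x; have := opd_serre true i k l x; rewrite /nested => ->; rewrite scaler0.
- by move=> i k l x; have := opd_serre false i k l x; rewrite /nested => ->; rewrite scaler0.
Qed.

Lemma M_lweight l : St l -> has_lweight lq Mops (kt l) (phi lq ld Psi l).
Proof.
move=> Sl i; split.
  exists (cK true l i) => [|k]; first exact: (cK_expansion true i Sl).
  by rewrite -[Kplus _ _ _ _ _]/(Kser lq Mops true i k (kt l)) Kser_Kop Kop_ket.
exists (cK false l i) => [|k]; first exact: (cK_expansion false i Sl).
by rewrite -[Kminus _ _ _ _ _]/(Kser lq Mops false i k (kt l)) Kser_Kop Kop_ket.
Qed.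

Lemma M_level : has_level Mops q3.
Proof.
move=> x; move: x; apply: eq_on_kets => [a x y|a x y|l Sl].
- by rewrite !linearP.
- by rewrite scalerDr !scalerA mulrC.
rewrite /= Kop_ket // linearZ /= Kop_ket // scalerA.
by have [-> _] := cK_zero 0 Sl; have [-> _] := cK_zero 1 Sl; rewrite mulrC phic_level.
Qed.

Hypothesis kt_span : forall x, exists (r : seq (state (Gsystem mu nu))) (c : state (Gsystem mu nu) -> C),
  [/\ uniq r, (forall l, l \in r -> St l) & x = \sum_(l <- r) c l *: kt l].
Hypothesis kt_free : forall (r : seq (state (Gsystem mu nu))) (c : state (Gsystem mu nu) -> C),
  uniq r -> (forall l, l \in r -> St l) -> \sum_(l <- r) c l *: kt l = 0 ->
  forall l, l \in r -> c l = 0.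

Lemma kt_neq0 l : St l -> kt l != 0.
Proof.
move=> Sl; apply/negP => /eqP e.
have := @kt_free [:: l] (fun=> 1) isT; rewrite big_seq1 e scaler0 => /(_ _ erefl l).
rewrite mem_head => h; have := oner_neq0 C; rewrite h ?eqxx //.
by move=> k; rewrite inE => /eqP ->.
Qed.

Lemma kt_scale l (a c : C) : St l -> a *: kt l = c *: kt l -> a = c.
Proof.
move=> Sl e; apply/eqP; rewrite -subr_eq0; have := kt_neq0 Sl.
have : (a - c) *: kt l == 0 by rewrite scalerBl e subrr.
by rewrite scaler_eq0 => /orP[//|->].
Qed.

Lemma kt_inj l l' : St l -> St l' -> kt l = kt l' -> l = l'.
Proof.
move=> Sl Sl' e; apply: cK_inj => // i k; apply: (kt_scale Sl).
by rewrite -(Kop_ket true) // e Kop_ket.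
Qed.

(** Another component [L x1] is removed by subtracting from a coefficient of
    [K_i^+(z)] its eigenvalue on [kt (L x1)]; the coefficient is chosen such that
    the eigenvalue on [kt (L x0)] is different ([cK_inj]). *)
Lemma submodule_component (W : set V) (I : eqType) (r : seq I) (L : I -> state (Gsystem mu nu))
    (a : I -> C) x0 :
  (forall (s : bool) i k x, W x -> W (Kop s i k x)) ->
  (forall (c : C) x y, W x -> W y -> W (c *: x + y)) -> W 0 ->
  uniq r -> (forall x, x \in r -> St (L x)) -> x0 \in r ->
  (forall x, x \in r -> x != x0 -> L x <> L x0) -> a x0 != 0 ->
  W (\sum_(x <- r) a x *: kt (L x)) -> W (kt (L x0)).
Proof.
move=> WK Wl W0; elim: {r}(size r) {-2}r (erefl (size r)) a => [|n IH] r.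
  by move/eqP/nilP => ->.
move=> sz a ur Sr x0r inj ax0 Wx.
case: (boolP (all (pred1 x0) r)) => [|].
  rewrite all_count (count_uniq_mem _ ur) x0r => /eqP/esym s1.
  have r1 : r = [:: x0].
    by case: (r) s1 x0r => [|x [|? ?]] //= _; rewrite inE => /eqP ->.
  rewrite r1 big_seq1 in Wx.
  have := Wl (a x0)^-1 _ _ Wx W0; rewrite addr0 scalerA mulVf // scale1r //.
rewrite -has_predC => /hasP[x1 x1r /= x10].
have [i [k ne]] : exists i k, cK true (L x1) i k != cK true (L x0) i k.
  apply: contrapT => h; apply: (inj _ x1r x10); apply: cK_inj; [exact: Sr | exact: Sr |].
  by move=> i k; apply: contrapT => /eqP h2; apply: h; exists i, k.
have x0r1 : x0 \in rem x1 r by rewrite mem_rem_uniq // inE eq_sym x10.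
have sub x : x \in rem x1 r -> x \in r by exact: mem_rem.
apply: (IH (rem x1 r) _ (fun x => a x * (cK true (L x) i k - cK true (L x1) i k))).
- by rewrite size_rem // sz.
- exact: rem_uniq.
- by move=> x /sub; exact: Sr.
- exact: x0r1.
- by move=> x /sub; exact: inj.
- by rewrite mulf_neq0 // subr_eq0 eq_sym.
have := Wl (- cK true (L x1) i k) _ _ Wx (WK true i k _ Wx).
rewrite scaler_sumr linear_sum -big_split /= (perm_big _ (perm_to_rem x1r)) big_cons /=.
have e x : x \in r -> - cK true (L x1) i k *: (a x *: kt (L x)) + Kop true i k (a x *: kt (L x))
    = (a x * (cK true (L x) i k - cK true (L x1) i k)) *: kt (L x).
  move=> xr; have -> : Kop true i k (a x *: kt (L x)) = (a x * cK true (L x) i k) *: kt (L x).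
    by rewrite linearZ /= (Kop_ket _ _ _ (Sr _ xr)) scalerA.
  by rewrite scalerA -scalerDl mulNr addrC mulrBr [cK _ _ _ _ * a x]mulrC.
rewrite e // subrr mulr0 scale0r add0r.
by rewrite (eq_big_seq (fun x => (a x * (cK true (L x) i k - cK true (L x1) i k)) *: kt (L x))) // => x /sub /e.
Qed.

(** The basis of states has distinct l-weights, as the eigenvalues determine the
    expansions and these the state ([cK_inj]). *)
Lemma M_tame : tame lq Mops.
Proof.
exists [set x | exists2 l, St l & x = kt l]; split.
- move=> r c ur hr e.
  have [rk hrk] : exists k : V -> state (Gsystem mu nu), forall x, x \in r -> St (k x) /\ x = kt (k x).
    have h x : exists l, x \in r -> St l /\ x = kt l.
      case: (boolP (x \in r)) => [/hr [l Sl ->]|_]; last by exists vac.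
      by exists l.
    by have [k hk] := choice h; exists k => x; exact: hk.
  move=> x xr.
  have ui : uniq (map rk r).
    rewrite map_inj_in_uniq // => y z yr zr eyz.
    by have [_ ->] := hrk _ yr; have [_ ->] := hrk _ zr; rewrite eyz.
  have Si l : l \in map rk r -> St l by case/mapP => y /hrk [Sy _] ->.
  have := kt_free (c := fun l => c (kt l)) ui Si; rewrite big_map.
  rewrite (eq_big_seq (fun y => c y *: y)) => [|y yr]; last by have [_ <-] := hrk _ yr.
  move=> /(_ e (rk x) (map_f rk xr)).
  by have [_ <-] := hrk _ xr.
- move=> x; have [r [c [ur Sr ->]]] := kt_span x.
  have ui : uniq (map kt r).
    by rewrite map_inj_in_uniq // => y z yr zr; apply: kt_inj; apply: Sr.
  pose c' y := c (nth vac r (index y (map kt r))).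
  exists (map kt r), c'; split; first by move=> y /mapP[l lr ->]; exists l => //; exact: Sr.
  rewrite big_map; apply: eq_big_seq => l lr; rewrite /c'.
  suff -> : index (kt l) (map kt r) = index l r by rewrite nth_index.
  have il : (index l r < size r)%N by rewrite index_mem.
  rewrite -[in LHS](nth_index vac lr) -(nth_map vac (kt vac)) // index_uniq // ?size_map //.
- by move=> x [l Sl ->]; exists (phi lq ld Psi l); exact: M_lweight.
move=> x y f [l Sl ->] [l' Sl' ->] h h'; congr kt; apply: cK_inj => // i k.
have [[c ec hc] _] := h i; have [[c' ec' hc'] _] := h' i.
have cc : c =1 c' := expansion_uniq (ec : expansion true _ _) (ec' : expansion true _ _).
have e1 : cK true l i k = c k.
  by apply: (kt_scale Sl); rewrite -Kop_ket // -Kser_Kop; exact: hc.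
have e2 : cK true l' i k = c' k.
  by apply: (kt_scale Sl'); rewrite -Kop_ket // -Kser_Kop; exact: hc'.
by rewrite e1 e2 cc.
Qed.

Lemma submodule_linear (W : set V) : submodule Mops W ->
  [/\ forall (s : bool) i k x, W x -> W (Kop s i k x),
      forall (c : C) x y, W x -> W y -> W (c *: x + y), W 0
    & forall d i k x, W x -> W (opd d i k x)].
Proof.
case=> W0 Wl WE WH WK.
have Wsum (I : Type) (r : seq I) (F : I -> V) : (forall x, W (F x)) -> W (\sum_(x <- r) F x).
  move=> hF; elim: r => [|x r IH]; first by rewrite big_nil.
  by rewrite big_cons -[F x]scale1r; apply: Wl.
have WZ (c : C) x : W x -> W (c *: x) by move=> Wx; rewrite -[_ *: x]addr0; apply: Wl.
have Wexp (h : nat -> V -> V) n x : (forall r y, W y -> W (h r.+1 y)) -> W x -> W (exp_coef h n x).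
  move=> Wh Wx.
  have Wp m n' : W (pow_coef h m n' x).
    elim: m n' => [|m IH] n' /=; first by case: ifP.
    by apply: Wsum => r; apply: Wh.
  by apply: Wsum => m; apply: WZ.
split=> //; last first.
  by case=> i k x Wx; have [] := WE i k x Wx.
move=> s i k x Wx; rewrite -Kser_Kop; case: s => /=.
  rewrite /Kplus; case: k => n //.
  have Wy : W (exp_coef (fun r y => qq *: genH Mops i r%:Z y) n x).
    by apply: Wexp => // r y Wy; apply: WZ; apply: WH.
  by have [h _] := WK _ Wy; have [] := h i.
rewrite /Kminus; case: (- k) => n //.
have Wy : W (exp_coef (fun r y => - qq *: genH Mops i (- r%:Z) y) n x).
  by apply: Wexp => // r y Wy; apply: WZ; apply: WH.
by have [h _] := WK _ Wy; have [] := h i.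
Qed.

(** The last box of [lambda^+] can be removed, since covering boxes come later,
    are positive again and so would belong to [lambda^+].  If [lambda^+] is
    empty, the first box of [lambda^-] can be restored for the symmetric
    reason. *)
Lemma corner_exists l : St l -> l <> vac -> exists d b, okd d l b /\
  (#|` (tog d l b).1| + #|` (tog d l b).2| < #|` l.1| + #|` l.2|)%N.
Proof.
move=> Sl nl; have [s1 s2] := Gstates_signed Sl; have cl := Gstates_closed Sl.
have [e1|n1] := eqVneq (l.1 : seq Gbox) [::]; last first.
  have [b bl hb] := exists_max glt_irr glt_trans n1.
  exists true, b; split.
    apply/(okdP _ _ Sl); split; first by rewrite /innd /inn s1 // bl.
    move=> v cv; rewrite /innd /inn (cov_positive cv (s1 _ bl)) eqb_id.
    by apply: contraL (cov_glt cv) => vl; exact: hb.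
  rewrite /tog /remove_box /= s1 //= ltn_add2r.
  by rewrite [X in (_ < X)%N](cardfsD1 b) bl.
have [e2|n2] := eqVneq (l.2 : seq Gbox) [::].
  case: nl; rewrite [l]surjective_pairing; congr pair.
    by apply/fsetP => b; rewrite inE; apply/negbTE; rewrite -[b \in l.1]/(b \in (l.1 : seq Gbox)) e1.
  by apply/fsetP => b; rewrite inE; apply/negbTE; rewrite -[b \in l.2]/(b \in (l.2 : seq Gbox)) e2.
have gtr : transitive (fun x y => glt y x) by move=> y x z h1 h2; exact: glt_trans h2 h1.
have [b bl hb] := exists_max (r := fun x y => glt y x) glt_irr gtr n2.
have nb := s2 _ bl.
exists false, b; split.
  apply/(okdP _ _ Sl); split; first by rewrite /innd /inn (negPf nb) bl.
  move=> v cv; have nv : Gpositive v = false by apply/negP => /(cov_positive cv); apply/negP.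
  rewrite /innd /inn nv; have : v \notin l.2.
    by apply: contraL (cov_glt cv) => vl; exact: hb.
  by move=> ->.
rewrite /tog /add_box /= (negPf nb) /= ltn_add2l.
by rewrite [X in (_ < X)%N](cardfsD1 b) bl.
Qed.

(** One application of [E_i] or [F_i] to a state is a combination of the
    neighbouring states with nonzero coefficients, and its components can be
    separated.  So a submodule contains with a state all its neighbours, hence
    the reference state and then every state ([corner_exists]). *)
Lemma M_irreducible : irreducible Mops.
Proof.
split; first by exists (kt vac); apply: kt_neq0; exact: Gstates_empty.
move=> W SW; have [WK Wl W0 WO] := submodule_linear SW.
have step d l b : St l -> okd d l b -> W (kt l) -> W (kt (tog d l b)).
  move=> Sl ob Wk; have gl := good_radius Sl; pose N := radius l.
  have Wo := WO d (Gcolor b) 0 _ Wk; rewrite (opd_ket d (Gcolor b) 0 gl (leqnn _)) in Wo.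
  pose r := [seq b' <- Wbox N.+2 | `[< okd d l b' >]].
  have br : b \in r by rewrite mem_filter (good_mem gl (leqnn _) ob) andbT; apply/asboolP.
  apply: (@submodule_component W _ r (tog d l) (fun b' => emc d (Gcolor b) l b' * pos b' ^ 0) b) => //.
  - by rewrite filter_uniq // fset_uniq.
  - by move=> b'; rewrite mem_filter => /andP[/asboolP ob' _]; exact: okd_state ob'.
  - move=> b' _ bb e; have := congr1 (fun k => innd d k b) e; rewrite /= !innd_tog eqxx eq_sym bb /=.
    by have [-> _] := iffLR (okdP _ _ Sl) ob.
  - by rewrite /emc eqxx em1 // mulr1 coef_neq0.
  suff -> : \sum_(b' <- r) (emc d (Gcolor b) l b' * pos b' ^ 0) *: kt (tog d l b')
    = \sum_(b' <- Wbox N.+2) (emc d (Gcolor b) l b' * pos b' ^ 0) *: kt (tog d l b') by [].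
  rewrite /r big_filter [RHS](bigID (fun b' => `[< okd d l b' >])) /= [X in _ + X]big1 ?addr0 //.
  by move=> b' /asboolP nb; rewrite emc0 // mul0r scale0r.
have both l : St l -> W (kt l) <-> W (kt vac).
  have [n] := ubnP (#|` l.1| + #|` l.2|); elim: n l => // n IH l ln Sl.
  have [->//|nl] := EM (l = vac).
  have [d [b [ob sz]]] := corner_exists Sl nl.
  rewrite -(IH (tog d l b)); [|by apply: leq_trans sz _|exact: okd_state ob].
  split; first exact: step.
  have [ib _] := iffLR (okdP _ _ Sl) ob.
  move/(step _ _ _ (okd_state ob) (okd_tog Sl ob)).
  by rewrite (togK (Gstates_signed Sl) ib).
have [[x Wx xn0]|n] := EM (exists2 x, W x & x != 0); [right|left]; last first.
  rewrite eqEsubset; split=> x /=; last by move=> ->.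
  by move=> Wx; apply: contrapT => /eqP xn; apply: n; exists x.
have [r [c [ur Sr ex]]] := kt_span x.
have [l0 l0r cl0] : exists2 l0, l0 \in r & c l0 != 0.
  apply: contrapT => h; move/negP: xn0; apply; rewrite ex big_seq big1 // => l lr.
  have [->|cl] := eqVneq (c l) 0; first by rewrite scale0r.
  by case: h; exists l.
have W0k : W (kt l0).
  by rewrite ex in Wx; apply: (@submodule_component W _ r id c l0) => //; first by move=> l _ /eqP.
have Wv : W (kt vac) by apply/(both _ (Sr _ l0r)).
rewrite eqEsubset; split=> y //= _.
have [r' [c' [ur' Sr' ->]]] := kt_span y.
elim: r' Sr' {ur'} => [|l r' IH] Sr'; first by rewrite big_nil.
rewrite big_cons; apply: Wl; first by apply/(both _ (Sr' _ (mem_head _ _))).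
by apply: IH => k kr; apply: Sr'; rewrite inE kr orbT.
Qed.

End Operators.

(** ** The space spanned by the states *)
Definition Gdiag (f : state (Gsystem mu nu) -> C) : {linear V -> V} :=
  diag (fun t : set_type St => f (val t)).
Arguments Gdiag : simpl never.

Lemma Gdiag_ket f l : St l -> Gdiag f (kt l) = f l *: kt l.
Proof. by move=> /ket_state[t <-]; rewrite ket_val; exact: diag_basis. Qed.

Lemma ket_span (x : V) : exists (r : seq (state (Gsystem mu nu))) (c : state (Gsystem mu nu) -> C),
  [/\ uniq r, (forall l, l \in r -> St l) & x = \sum_(l <- r) c l *: kt l].
Proof.
pose y : {malg C[set_type St]} := x.
exists (map val (msupp y)), (fun l => if insub l is Some t then y@_t else 0); split.
- by rewrite map_inj_uniq ?fset_uniq //; exact: val_inj.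
- by move=> l /mapP[t _ ->]; exact: St_val.
rewrite big_map -[LHS]/y [LHS]malg_sumZ; apply: eq_bigr => t _.
by rewrite valK ket_val.
Qed.

Lemma linear_coordinate (W : lmodType C) (f : {linear W -> C^o}) (I : eqType) (k : I -> W)
    (r : seq I) (c : I -> C) x0 : uniq r -> x0 \in r ->
  (forall x, x \in r -> f (k x) = (x == x0)%:R) -> f (\sum_(x <- r) c x *: k x) = c x0.
Proof.
move=> ur x0r fk; rewrite linear_sum (bigD1_seq x0) //= linearZ /= fk // eqxx.
rewrite big_seq_cond big1 => [|x /andP[xr nx]].
  by rewrite addr0; exact: mulr1.
by rewrite linearZ /= fk // (negPf nx) scaler0.
Qed.

Lemma ket_free (r : seq (state (Gsystem mu nu))) (c : state (Gsystem mu nu) -> C) :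
  uniq r -> (forall l, l \in r -> St l) -> \sum_(l <- r) c l *: kt l = 0 ->
  forall l, l \in r -> c l = 0.
Proof.
move=> ur Sr e l lr.
pose f : {linear V -> C^o} := lext (fun t : set_type St => (val t == l)%:R : C^o).
have fk l' : St l' -> f (kt l') = (l' == l)%:R.
  by move=> /ket_state[t <-]; rewrite ket_val; exact: lext_basis.
rewrite -(linear_coordinate (f := f) (k := fun l => kt l) c ur lr) => [|l' lr'].
  by rewrite e linear0.
by apply: fk; exact: Sr.
Qed.

Definition GM : toroidal_ops V := Mops Gop Gdiag.

Lemma fsum_fset (W : lmodType C) (A : set Gbox) (X : {fset Gbox}) (F G : Gbox -> W) :
  (forall b, A b -> b \in X) -> (forall b, A b -> F b = G b) -> (forall b, ~ A b -> G b = 0) ->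
  \sum_(b \in A) F b = \sum_(b <- X) G b.
Proof.
move=> AX FG G0; rewrite (eq_fsbigr G) => [|b]; last by rewrite inE; exact: FG.
rewrite (fsbig_seq _ _ (fset_uniq X)); apply: fsbig_widen; first by move=> b /AX.
by move=> b [_ nA]; exact: G0.
Qed.

Lemma GM_creation l i k : St l -> genF GM i k (kt l) =
  \sum_(b \in CC St i l) (acoef lq ld Psi i l b * position lq ld b ^ k) *: kt (add_box l b).
Proof.
move=> Sl; have gl := good_radius Sl.
rewrite -[LHS]/(Gop false i k (kt l)) (Gop_ket false i k gl (leqnn _)); apply: esym.
apply: fsum_fset => b.
- by move=> [ob _]; exact: (good_mem (d := false) gl (leqnn _) ob).
- move=> [ob cb']; have cb : Gcolor b = i := cb'.
  rewrite /emc cb eqxx (em1 (d := false) ob) -cb.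
  by rewrite (acoef_al Sl) ?(position_site b) //; right.
move=> nb; rewrite /emc; case: eqP => cb; last by rewrite mul0r scale0r.
by rewrite em0 ?mul0r ?scale0r // => ob; apply: nb.
Qed.

Lemma GM_annihilation l i k : St l -> genE GM i k (kt l) =
  \sum_(b \in CV St i l) (bcoef lq ld Psi i l b * position lq ld b ^ k) *: kt (remove_box l b).
Proof.
move=> Sl; have gl := good_radius Sl.
rewrite -[LHS]/(Gop true i k (kt l)) (Gop_ket true i k gl (leqnn _)); apply: esym.
apply: fsum_fset => b.
- by move=> [ob _]; exact: (good_mem (d := true) gl (leqnn _) ob).
- move=> [ob cb']; have cb : Gcolor b = i := cb'.
  rewrite /emc cb eqxx (em1 (d := true) ob) -cb.
  by rewrite (bcoef_bl Sl) ?(position_site b) //; left.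
move=> nb; rewrite /emc; case: eqP => cb; last by rewrite mul0r scale0r.
by rewrite em0 ?mul0r ?scale0r // => ob; apply: nb.
Qed.

Lemma G_combinatorial_data : combinatorial_data lq ld St Psi.
Proof.
split; first split.
- by move=> b; rewrite /= GltE glt_irr.
- by move=> b b' b'' /=; rewrite !GltE; exact: glt_trans.
- by move=> b b' /= nb; rewrite !GltE; exact: glt_total.
split.
- by move=> b b'; rewrite !position_site => /spos_inj/site_inj ->.
- by move=> l /Gstates_signed.
- exact: Gstates_empty.
move=> i; have Sv : St vac := Gstates_empty mu nu.
have hX b : corner vac b -> b \in Wbox (radius vac).+2.
  by move=> /asboolP[]h; exact: (good_mem (good_radius Sv) (leqnn _) h).
have [_ [_ [_ h]]] := phi_expansion i Sv hX.
have <- // : phi lq ld Psi vac i = Psi i.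
rewrite /phi /Aprod /= !big_seq_fset0.
have gen1 (F : fieldType) (x : F) : x * (1 * 1) = x by rewrite !mulr1.
exact: gen1.
Qed.

Lemma GM_action : combinatorial_action lq ld Psi GM.
Proof.
split; [exact: G_combinatorial_data | exact: G_coefs_defined |].
split=> // l Sl.
- by apply: M_lweight => //; [exact: basis_ind | exact: Gdiag_ket].
- by move=> i k; exact: GM_creation.
by move=> i k; exact: GM_annihilation.
Qed.

End Positions.

Theorem proposition4p6 (R : realType) (lq ld mu nu : R[i]) :
  generic_parameters lq ld ->
  not_integer mu -> not_integer nu -> not_integer (mu + nu) ->
  nonresonant lq ld mu -> nonresonant lq ld nu ->
  nonresonant lq ld (mu + nu) ->
  exists M : toroidal_ops (Gspace mu nu),
    [/\ toroidal_module lq ld M,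
        combinatorial_action lq ld (GPsi lq ld mu nu) M,
        irreducible M,
        tame lq M
      & has_level M (q3 lq ld)].
Proof.
move=> gen mu_int nu_int munu_int mu_res nu_res munu_res.
exists (GM lq ld mu nu); split.
- apply: M_toroidal => //; [exact: Gop_ket | exact: basis_ind | exact: Gdiag_ket].
- exact: GM_action.
- apply: M_irreducible => //; [exact: Gop_ket | exact: basis_ind | exact: Gdiag_ket | exact: ket_span | exact: ket_free].
- apply: M_tame => //; [exact: basis_ind | exact: Gdiag_ket | exact: ket_span | exact: ket_free].
apply: M_level => //; [exact: basis_ind | exact: Gdiag_ket].
Qed.
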